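(* Let $X$ be an infinite dimensional separable reflexive real Banach space which has an equivalent a.u.s. norm and an equivalent a.u.c. norm. Then there exist $1<q\le p<\infty$ so that a) $X$ embeds isomorphically into a reflexive space with an FDD satisfying $1$-$(p,q)$-estimates; and hence b) $X$ can be renormed to be simultaneously a.u.s. of power type $q$ and a.u.c. of power type $p$.
   Context: $\operatorname{cof}(X)$ is the set of closed finite codimensional subspaces of $X$ and $B_Y$ the unit ball of $Y$. For $t>0$, $\bar\rho_X(t)=\sup_{\|x\|=1}\inf_{Y\in\operatorname{cof}(X)}\sup_{y\in tB_Y}\|x+y\|-1$ and $\bar\delta_X(t)=\inf_{\|x\|=1}\sup_{Y\in\operatorname{cof}(X)}\inf_{y\in Y,\ \|y\|\ge t}\|x+y\|-1$. $X$ is a.u.s. (asymptotically uniformly smooth) if $\lim_{t\to0^+}\bar\rho_X(t)/t=0$, and a.u.s. of power type $q$ if for some $K<\infty$, $\bar\rho_X(t)\le Kt^q$ for $t>0$. $X$ is a.u.c. (asymptotically uniformly convex) if $\bar\delta_X(t)>0$ for all $t>0$, and a.u.c. of power type $p$ if for some $K>0$, $\bar\delta_X(t)\ge Kt^p$ for $0<t\le1$. FDD means finite dimensional decomposition. For an FDD $(E_i)$ of $Z$, a (finite or infinite) sequence of nonzero finitely supported vectors $(x_i)$ is a block sequence if $\max\operatorname{supp}(x_i)<\min\operatorname{supp}(x_{i+1})$ for all $i$, where supp is the set of coordinates $j$ at which the $E_j$-component is nonzero. $(E_i)$ satisfies $C$-$(p,q)$-estimates if for all $n$ and all block sequences $(x_i)_{i=1}^n$,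 $C^{-1}(\sum_1^n\|x_i\|^p)^{1/p}\le\|\sum_1^nx_i\|\le C(\sum_1^n\|x_i\|^q)^{1/q}$. *)

(* Defs.v *)
From mathcomp Require Import all_boot all_order all_algebra.
From mathcomp Require Import all_classical all_reals all_analysis.
Import Order.TTheory GRing.Theory Num.Theory.
Import numFieldNormedType.Exports.

Set Implicit Arguments.
Unset Strict Implicit.
Unset Printing Implicit Defensive.

Local Open Scope classical_set_scope.
Local Open Scope ring_scope.

Section NormedSpaces.
Variables (R : realType) (X : normedModType R).

(* The linear span of a finite (possibly empty) family. *)
Definition finite_dim (E : set X) : Prop :=
  exists n (b : 'I_n -> X), E = range (fun c : 'I_n -> R => \sum_i c i *: b i).

Definition finite_codim (Y : set X) : Prop :=
  exists2 F : set X, finite_dim F &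
    forall x, exists y f, [/\ Y y, F f & x = y + f].

Definition cof : set (set X) :=
  [set Y | [/\ GRing.submod_closed [in Y], closed Y & finite_codim Y]].

Definition is_separable : Prop := exists2 A : set X, countable A & dense A.

(* The dual space, as a linear subspace of the space of functions [X -> R^o]. *)
Definition dual : set (X -> R^o) := [set f | linear f /\ continuous f].

Definition dual_norm (f : X -> R^o) : R :=
  sup [set `|f x| | x in [set x : X | `|x| <= 1]].

(* A bidual element is given by a function [Phi] of which only the values on
   [dual] matter. *)
Definition bidual (Phi : (X -> R^o) -> R) : Prop :=
  (forall a f g, dual f -> dual g -> Phi (a *: f + g) = a * Phi f + Phi g) /\
  (exists C : R, forall f, dual f -> `|Phi f| <= C * dual_norm f).

Definition reflexive_space : Prop :=
  forall Phi, bidual Phi -> exists x : X, forall f, dual f -> Phi f = f x.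

Definition is_norm (N : X -> R) : Prop :=
  [/\ forall x y, N (x + y) <= N x + N y,
      forall a x, N (a *: x) = `|a| * N x
    & forall x, N x = 0 -> x = 0].

Definition equivalent_norm (N : X -> R) : Prop :=
  is_norm N /\
  exists c C : R, [/\ 0 < c, 0 < C & forall x, c * `|x| <= N x <= C * `|x|].

(* The moduli of [X] endowed with the equivalent norm [N]. As [N] induces the
   topology of [X], [cof] does not depend on [N]. *)
Section Moduli.
Variable N : X -> R.

Definition rho_bar (t : R) : \bar R :=
  (ereal_sup [set ereal_inf [set ereal_sup [set (N (x + y))%:E
      | y in [set y | Y y /\ (N y <= t)%R]]
    | Y in cof]
  | x in [set x | N x = 1%R]] - 1)%E.

Definition delta_bar (t : R) : \bar R :=
  (ereal_inf [set ereal_sup [set ereal_inf [set (N (x + y))%:E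
      | y in [set y | Y y /\ (t <= N y)%R]]
    | Y in cof]
  | x in [set x | N x = 1%R]] - 1)%E.

Definition aus : Prop :=
  (fun t : R => rho_bar t * (t^-1)%:E)%E @ 0^'+ --> 0%E.

Definition aus_power_type (q : R) : Prop :=
  exists K : R, forall t, 0 < t -> (rho_bar t <= (K * t `^ q)%:E)%E.

Definition auc : Prop := forall t, 0 < t -> (0 < delta_bar t)%E.

Definition auc_power_type (p : R) : Prop :=
  exists2 K : R, 0 < K &
    forall t, 0 < t -> t <= 1 -> ((K * t `^ p)%:E <= delta_bar t)%E.

End Moduli.

Section FDD.
Variable E : nat -> set X.

Definition fdd_expansion (z : X) (u : nat -> X) : Prop :=
  (forall j, E j (u j)) /\ series u @ \oo --> z.

Definition is_fdd : Prop :=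
  (forall j, finite_dim (E j)) /\
  (forall z, exists! u : nat -> X, fdd_expansion z u).

(* The [j]-th term is the [E j]-component of [z]; meaningful under [is_fdd]. *)
Definition fdd_components (z : X) : nat -> X :=
  xget (fun=> 0) [set u | fdd_expansion z u].

Definition supp (z : X) : set nat := [set j | fdd_components z j != 0].

(* For nonempty finite supports, the last condition says that
   max (supp (x i)) < min (supp (x i')). *)
Definition block_sequence n (x : 'I_n -> X) : Prop :=
  [/\ forall i, x i != 0,
      forall i, finite_set (supp (x i))
    & forall i i' : 'I_n, i' = i.+1 :> nat ->
        forall j k, supp (x i) j -> supp (x i') k -> (j < k)%N].

Definition satisfies_estimates (C p q : R) : Prop :=
  forall n (x : 'I_n -> X), block_sequence x ->
    C^-1 * (\sum_i `|x i| `^ p) `^ (p^-1) <= `|\sum_i x i|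
      <= C * (\sum_i `|x i| `^ q) `^ (q^-1).

End FDD.

End NormedSpaces.

Arguments cof {R} X.
Arguments is_separable {R} X.
Arguments dual {R} X.
Arguments reflexive_space {R} X.

Definition isomorphic_embedding (R : realType) (X Z : normedModType R)
    (T : {linear X -> Z}) : Prop :=
  exists c C : R, [/\ 0 < c, 0 < C & forall x, c * `|x| <= `|T x| <= C * `|x|].

(* Main.v *)
(** Write [W] for the dual of [X]. Asymptotic uniform convexity of [X], and dually
    asymptotic uniform smoothness, give the same growth property in [X] and in
    [W]: for every finite dimensional [G] there is a finite set [F] of functionals
    such that a vector annihilated by [F] which is not too short increases the
    norm of every element of [G] by a fixed proportion of its own norm. A vector
    of either space is approximated weakly by elements of a fixed increasing
    sequence of finite dimensional spaces; by weak compactness (this is where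
    reflexivity enters) the approximants can be chosen so that the growth property
    applies to all their differences. Iterating the growth shows that these
    approximants have bounded [p]-variation in the norm, for some large [p].

    The space [Z] is then written down: its elements are sequences of functionals
    on finite dimensional subspaces [U_i] of [W], normed by the smallest set of
    test sequences that contains those of [p]-variation at most one and in which
    splicing obeys an upper estimate with the conjugate exponent [q]. Splicing
    gives the lower [p]-estimate of [Z], splitting a test sequence gives the upper
    [q]-estimate, both with constant one, and together they make [Z] reflexive.
    The map sending [x] to its restrictions to the [U_i] is bounded because [x]
    has approximants of bounded variation, and bounded below because norming
    functionals have. *)
Require Import Defs.
From HB Require Import structures.
From mathcomp Require Import all_boot all_order all_algebra.
From mathcomp Require Import all_classical all_reals all_analysis.
From mathcomp Require Import lra.
Import Order.TTheory GRing.Theory Num.Theory.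
Import numFieldNormedType.Exports.
Set Implicit Arguments.
Unset Strict Implicit.
Unset Printing Implicit Defensive.
Local Open Scope classical_set_scope.
Local Open Scope ring_scope.

(** * Finite spans and pairings *)

(** The two growth properties come from unrelated norms: [X] carries the a.u.c. norm, [W] the dual
    of the a.u.s. norm. Only the constants [cB] and [c0] of the pairing see this, and they end up in
    the isomorphism constant. Sequences of p-variation at most one can be cut, but in general not
    spliced with constant one: a block sum across the junction mixes both pieces. Hence the
    inductive closure [norming_body]. Two things have to survive it: cutting, by convexity of powers
    ([norming_body_split]), and boundedness of the elements of [X] on the set, where Hoelder's
    inequality turns splices back into a chain ([norming_body_bound]). The exponents are p = k + 1
    and q = (k + 1) / k for a natural number k. Scalars belonging to the exponent q are written as
    k-th powers, so real exponents appear only in the final statements. *)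

Section FiniteLists.
Variables (R : realType) (V : lmodType R).

Definition subspace (P : set V) : Prop :=
  P 0 /\ forall a x y, P x -> P y -> P (a *: x + y).

Fixpoint lspan (s : seq V) : set V :=
  if s is x :: s' then [set v | exists c, lspan s' (v - c *: x)] else [set 0].

Lemma subspaceD P x y : subspace P -> P x -> P y -> P (x + y).
Proof. by move=> [_ PD] Px Py; rewrite -[x]scale1r; exact: PD. Qed.

Lemma subspaceZ P a x : subspace P -> P x -> P (a *: x).
Proof. by move=> [P0 PD] Px; rewrite -[_ *: _]addr0; exact: PD. Qed.

Lemma subspaceB P x y : subspace P -> P x -> P y -> P (x - y).
Proof.
by move=> PP Px Py; rewrite -scaleN1r; apply: subspaceD => //; exact: subspaceZ.
Qed.

Lemma subspace_sum (I : Type) (r : seq I) (Q : pred I) (F : I -> V) P :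
  subspace P -> (forall i, Q i -> P (F i)) -> P (\sum_(i <- r | Q i) F i).
Proof.
move=> PP PF; elim/big_ind : _ => //; first by case: PP.
by move=> x y; exact: subspaceD.
Qed.

Lemma subspaceI P Q : subspace P -> subspace Q -> subspace (P `&` Q).
Proof.
move=> [P0 PD] [Q0 QD]; split => // a x y [Px Qx] [Py Qy].
by split; [exact: PD|exact: QD].
Qed.

Lemma lspan_subspace s : subspace (lspan s).
Proof.
elim: s => [|x s [s0 sD]] /=.
  by split=> // a x y -> ->; rewrite scaler0 addr0.
split=> [|a u v [c uc] [d vd]]; first by exists 0; rewrite scale0r subr0.
exists (a * c + d); have -> : a *: u + v - (a * c + d) *: x =
  a *: (u - c *: x) + (v - d *: x); last exact: sD.
by rewrite scalerDl scalerBr scalerA opprD addrACA.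
Qed.

Lemma lspan_min s P : subspace P -> (forall x, x \in s -> P x) ->
  lspan s `<=` P.
Proof.
move=> PP; elim: s => [_ v ->|x s IH sP v /= [c vc]]; first by case: PP.
rewrite -(subrK (c *: x) v); apply: subspaceD => //.
  by apply: IH vc => y ys; apply: sP; rewrite inE ys orbT.
by apply: subspaceZ => //; apply: sP; rewrite mem_head.
Qed.

Lemma mem_lspan s x : x \in s -> lspan s x.
Proof.
elim: s => //= y s IH; rewrite inE => /orP[/eqP ->|xs].
  by exists 1; rewrite scale1r subrr; case: (lspan_subspace s).
by exists 0; rewrite scale0r subr0; exact: IH.
Qed.

Lemma lspanS s t : {subset s <= t} -> lspan s `<=` lspan t.
Proof.
move=> st; apply: lspan_min; first exact: lspan_subspace.
by move=> x /st; exact: mem_lspan.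
Qed.

(** Gaussian elimination: the induction hypothesis generates the part of [P] inside the span of the
    tail; if [P] leaves that span, one [v] in [P] with nonzero coordinate along [x] generates the
    rest. *)
Lemma subspace_lspan P s : subspace P -> P `<=` lspan s ->
  exists2 t, (forall x, x \in t -> P x) & P = lspan t.
Proof.
elim: s P => [|x s IH] P PP Ps.
  by exists [::] => //; apply/seteqP; split=> // v /= ->; case: PP.
have [t tP Pt] : exists2 t, (forall y, y \in t -> (P `&` lspan s) y) &
    P `&` lspan s = lspan t.
  apply: IH; last by move=> v [].
  exact: subspaceI PP (lspan_subspace s).
have [sub|/existsNP[v /not_implyP[Pv vs]]] :=
    pselect (forall v, P v -> lspan s v).
  exists t; first by move=> y /tP[].
  by rewrite -Pt; apply/seteqP; split=> [v Pv|v []//]; split=> //; exact: sub.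
exists (v :: t) => [y|].
  by rewrite inE => /orP[/eqP ->//|/tP[]].
apply/seteqP; split=> [u Pu|]; last first.
  apply: lspan_min => // y; rewrite inE => /orP[/eqP ->//|/tP[]//].
have [c vc] := Ps _ Pv; have [d ud] := Ps _ Pu.
have c0 : c != 0.
  by apply: contra_notN vs => /eqP c0; move: vc; rewrite c0 scale0r subr0.
exists (d / c); rewrite -Pt; split; first by apply: subspaceB => //; exact: subspaceZ.
have -> : u - (d / c) *: v = (u - d *: x) - (d / c) *: (v - c *: x).
  by rewrite scalerBr scalerA divfK// opprB addrA subrK.
by apply: subspaceB => //; [exact: lspan_subspace|apply: subspaceZ => //; exact: lspan_subspace].
Qed.

End FiniteLists.

Section Pairing.
Variable R : realType.

Definition pairing (A C : lmodType R) (B : A -> C -> R) : Prop :=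
  (forall a x y w, B (a *: x + y) w = a * B x w + B y w) /\
  (forall a x v w, B x (a *: v + w) = a * B x v + B x w).

Definition flip_pairing (A C : lmodType R) (B : A -> C -> R) := fun w x => B x w.

Lemma pairing_flip (A C : lmodType R) (B : A -> C -> R) :
  pairing B -> pairing (flip_pairing B).
Proof. by move=> [Bl Br]; split => *; rewrite /flip_pairing ?Br ?Bl. Qed.

Section Theory.
Variables (A C : lmodType R) (B : A -> C -> R).
Hypothesis PB : pairing B.

Lemma pairingDl x y w : B (x + y) w = B x w + B y w.
Proof. by rewrite -[x in LHS]scale1r PB.1 mul1r. Qed.

Lemma pairingDr x v w : B x (v + w) = B x v + B x w.
Proof. by rewrite -[v in LHS]scale1r PB.2 mul1r. Qed.

Lemma pairing0l w : B 0 w = 0.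
Proof. by apply: (addrI (B 0 w)); rewrite -pairingDl !addr0. Qed.

Lemma pairing0r x : B x 0 = 0.
Proof. by apply: (addrI (B x 0)); rewrite -pairingDr !addr0. Qed.

Lemma pairingZl a x w : B (a *: x) w = a * B x w.
Proof. by rewrite -[_ *: _]addr0 PB.1 pairing0l addr0. Qed.

Lemma pairingZr a x w : B x (a *: w) = a * B x w.
Proof. by rewrite -[_ *: _]addr0 PB.2 pairing0r addr0. Qed.

Lemma pairingBl x y w : B (x - y) w = B x w - B y w.
Proof. by rewrite -scaleN1r pairingDl pairingZl mulN1r. Qed.

Lemma pairingBr x v w : B x (v - w) = B x v - B x w.
Proof. by rewrite -scaleN1r pairingDr pairingZr mulN1r. Qed.

Lemma pairing_suml (I : Type) (r : seq I) (P : pred I) (F : I -> A) w :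
  B (\sum_(i <- r | P i) F i) w = \sum_(i <- r | P i) B (F i) w.
Proof.
by apply: (big_morph (B^~ w)) => [x y|]; [exact: pairingDl|exact: pairing0l].
Qed.

Lemma pairing_sumr (I : Type) (r : seq I) (P : pred I) (F : I -> C) x :
  B x (\sum_(i <- r | P i) F i) = \sum_(i <- r | P i) B x (F i).
Proof.
by apply: (big_morph (B x)) => [y z|]; [exact: pairingDr|exact: pairing0r].
Qed.

Definition annih (s : seq C) : set A := [set x | forall w, w \in s -> B x w = 0].

Lemma annih_subspace s : subspace (annih s).
Proof.
split=> [w _|a x y xs ys w ws]; first exact: pairing0l.
by rewrite PB.1 xs// ys// mulr0 addr0.
Qed.

Lemma annih_lspan s x w : annih s x -> lspan s w -> B x w = 0.
Proof.
move=> xs; apply: (@lspan_min _ _ s [set w | B x w = 0]) => //.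
split=> [|a v u /= v0 u0]; first exact: pairing0r.
by rewrite PB.2 v0 u0 mulr0 addr0.
Qed.

(* A "reproducing system" [t] for [lspan s]: [x] is recovered from the numbers
   [B x f.2]; this replaces a biorthogonal basis. *)
Lemma reproducing_system (s : seq A) :
  (forall x, (forall w, B x w = 0) -> x = 0) ->
  exists2 t : seq (A * C), (forall f, f \in t -> lspan s f.1) &
    forall x, lspan s x -> x = \sum_(f <- t) B x f.2 *: f.1.
Proof.
move=> sepB; elim: s => [|a s [t ts tr]].
  by exists [::] => // x /= ->; rewrite big_nil.
pose P x := \sum_(f <- t) B x f.2 *: f.1.
have PD c x y : P (c *: x + y) = c *: P x + P y.
  rewrite /P scaler_sumr -big_split; apply: eq_bigr => f _ /=.
  by rewrite PB.1 scalerDl scalerA.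
have Ps x : lspan s (P x).
  rewrite /P big_seq; apply: subspace_sum; first exact: lspan_subspace.
  by move=> f ft; apply: subspaceZ (ts _ ft); exact: lspan_subspace.
have sas : lspan s `<=` lspan (a :: s).
  by apply: lspanS => x xs; rewrite inE xs orbT.
have Px x c : lspan s (x - c *: a) -> P x = c *: P a + (x - c *: a).
  by move=> xc; rewrite -{1}(subrK (c *: a) x) addrC PD -[P (x - _)]tr.
have [a0|/eqP a0] := pselect (a - P a = 0).
  exists t => [f /ts /sas//|x [c xc]].
  have aP : P a = a by apply/esym/eqP; rewrite -subr_eq0; exact/eqP.
  by rewrite -/(P x) (Px _ _ xc) aP addrC subrK.
have [phi aphi] : exists phi, B (a - P a) phi != 0.
  apply: contrapT => /forallNP H; move/eqP: a0; apply; apply: sepB => w.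
  by apply: contrapT => /eqP; exact: H.
(* The adjoint of 1 - P applied to [phi]: it vanishes on [lspan s], so its multiple [chi] reads off
   the new coordinate alone. *)
pose psi := phi - \sum_(f <- t) B f.1 phi *: f.2.
have Bpsi x : B x psi = B (x - P x) phi.
  rewrite pairingBr pairingBl; congr (_ - _); rewrite pairing_sumr pairing_suml.
  by apply: eq_bigr => f _; rewrite pairingZr pairingZl mulrC.
pose chi := (B (a - P a) phi)^-1 *: psi.
exists ((a - P a, chi) :: t) => [f|x [c xc]].
  rewrite inE => /orP[/eqP ->|/ts/sas//].
  apply: subspaceB; first exact: lspan_subspace.
    by apply: mem_lspan; rewrite mem_head.
  exact: sas.
rewrite big_cons -/(P x) /= /chi pairingZr Bpsi.
rewrite (Px _ _ xc).
have -> : x - (c *: P a + (x - c *: a)) = c *: (a - P a).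
  by rewrite scalerBr opprD opprB addrCA [x + _]addrCA subrr addr0 addrC.
by rewrite pairingZl mulrC mulfK// scalerBr addrA subrK addrC subrK.
Qed.

End Theory.
End Pairing.

(** * Bounded variation from growth *)

Section Chains.
Variable R : realType.
Implicit Types (f d : nat -> nat -> R) (e : nat -> R).

Fixpoint chain_sum f (a : nat) (s : seq nat) : R :=
  if s is b :: s' then f a b + chain_sum f b s' else 0.

Lemma chain_sum_cat f a s t :
  chain_sum f a (s ++ t) = chain_sum f a s + chain_sum f (last a s) t.
Proof. by elim: s a => [|b s IH] a /=; rewrite ?add0r// IH addrA. Qed.

Lemma ler_chain_sum f g a s : (forall i j, f i j <= g i j) ->
  chain_sum f a s <= chain_sum g a s.
Proof. by move=> fg; elim: s a => //= b s IH a; rewrite lerD. Qed.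

Lemma chain_sumZ c f a s :
  chain_sum (fun i j => c * f i j) a s = c * chain_sum f a s.
Proof. by elim: s a => [|b s IH] a /=; rewrite ?mulr0// IH mulrDr. Qed.

Lemma chain_sum_map f (h : nat -> nat) a s :
  chain_sum (fun i j => f (h i) (h j)) a s = chain_sum f (h a) (map h s).
Proof. by elim: s a => //= b s IH a; rewrite IH. Qed.

Lemma chain_sum_iota f m n :
  chain_sum f m (iota m.+1 n) = \sum_(m <= i < m + n) f i i.+1.
Proof.
elim: n m => [|n IH] m /=; first by rewrite addn0 big_geq.
by rewrite IH addnS -addSn [in RHS]big_ltn// addSn ltnS leq_addr.
Qed.

Lemma split_has (T : Type) (P : pred T) s : has P s ->
  exists s1 x s2, [/\ s = s1 ++ x :: s2, P x & ~~ has P s1].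
Proof.
elim: s => //= y s IH; case: (boolP (P y)) => /= [Py _|Py /IH].
  by exists [::], y, s.
move=> [s1 [x [s2 [-> Px s1P]]]]; exists (y :: s1), x, s2; split => //=.
by rewrite negb_or Py.
Qed.

(** A piece without long steps has diameter at most [T / 2]; an error of at most [T / 8] makes the
    ratio 5/8. [M] such pieces shall weigh at most one half. *)
Lemma geometric_small (M : R) :
  exists n0, forall n, (n0 <= n)%N -> M * (5 / 8) ^+ n <= 2^-1.
Proof.
have pow n : 1 + n%:R / 2 <= (8 / 5 : R) ^+ n.
  elim: n => [|n IH]; first by rewrite expr0; lra.
  have : 0 <= n%:R :> R by [].
  by rewrite exprS -natr1; nra.
exists (Num.bound (4 * `|M|)) => n nM.
have M1 : 2 * M <= (8 / 5) ^+ n.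
  have := pow n; have := ler_norm M.
  have : 4 * `|M| <= n%:R.
    apply: le_trans (ltW (archi_boundP _)) _; first by rewrite mulr_ge0.
    by rewrite ler_nat.
  lra.
have -> : (5 / 8 : R) = (8 / 5)^-1 by rewrite invf_div.
by rewrite exprVn ler_pdivrMr ?exprn_gt0//; lra.
Qed.

(* [growth] says that a long step away from [j] increases the distance from
   every earlier point by a definite amount. Within a set of diameter [T] one can
   therefore make only boundedly many steps of length [T / 4], and the pieces in
   between have diameter at most [T / 2]: this gives the [n]-variation bound by
   induction on the length of the chain, once [n] is large. *)
Lemma chain_variation (delta : R) : 0 < delta <= 1 ->
  exists n0, forall n, (n0 <= n)%N -> exists2 C : R, 0 <= C & forall d e,
  (forall i, d i i = 0) -> (forall c i j, d i j <= d c i + d c j) ->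
  (forall i, 0 < e i) -> (forall i j, (i < j)%N -> e j <= delta / 16 * e i) ->
  (forall i j k, (i < j)%N -> (j < k)%N -> 8^-1 * (d i j + e j) <= d j k ->
     d i j + delta * d j k - 2 * e j <= d i k) ->
  forall a s D, path leq a s ->
  (forall x y, x \in a :: s -> y \in a :: s -> d x y <= D) ->
  chain_sum (fun i j => d i j ^+ n) a s <= C * (D + e a) ^+ n.
Proof.
move=> /andP[dl0 dl1]; pose M := Num.bound (16 / delta).
have [n0 n0P] := geometric_small M%:R.
(* [C] solves C = (M + 1) + C / 2: the first step and the long steps give [M + 1] powers of [T], the
   pieces at most half of [C]. The successor excludes n = 0, where a step from a point to itself
   would count 1. *)
exists n0.+1 => n n0n; pose C : R := 2 * (M%:R + 1); exists C.
  by rewrite mulr_ge0// addr_ge0.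
have C0 : 0 <= C by rewrite mulr_ge0// addr_ge0.
move=> d e d0 tri e0 edec growth.
have dge0 i j : 0 <= d i j by have := tri i j j; rewrite d0; lra.
set S := chain_sum _.
have n_gt0 : (0 < n)%N by apply: leq_trans n0n.
suff: forall k a s D, (size s <= k)%N -> path leq a s ->
  (forall x y, x \in a :: s -> y \in a :: s -> d x y <= D) ->
  S a s <= C * (D + e a) ^+ n.
  by move=> H a s D; exact: H (leqnn _).
elim => [|k IH] a s D.
  case: s => // _ _ sD; rewrite mulr_ge0// exprn_ge0// addr_ge0 ?(ltW (e0 _))//.
  by have := sD a a (mem_head _ _) (mem_head _ _); rewrite d0.
case: s => [_ _ sD|b s].
  rewrite mulr_ge0// exprn_ge0// addr_ge0 ?(ltW (e0 _))//.
  by have := sD a a (mem_head _ _) (mem_head _ _); rewrite d0.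
move=> /= sk /andP[]; rewrite leq_eqVlt => /orP[/eqP <-|ab] ps sD.
  rewrite /S /= d0 expr0n eqn0Ngt n_gt0 add0r.
  by apply: IH => // x y xs ys; apply: sD; rewrite inE ?xs ?ys orbT.
have ea := e0 a.
(* With the error at [a] included in [T], all later errors are at most [delta / 16 * T]. This is why
   [a] is split off and distances are measured from its successor [b]. *)
pose T := D + e a; have T_gt0 : 0 < T.
  by rewrite /T; have := sD a a (mem_head _ _) (mem_head _ _); rewrite d0; lra.
have D0 : 0 <= D by have := sD a a (mem_head _ _) (mem_head _ _); rewrite d0.
have DT : D < T by rewrite /T; lra.
have smallT c : (b <= c)%N -> e c <= delta / 16 * T.
  move=> bc; apply: le_trans (edec _ _ (leq_trans ab bc)) _.
  by rewrite ler_pM2l ?divr_gt0// /T; lra.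
have e8 c : (b <= c)%N -> e c <= T / 8 by move=> /smallT; nra.
have piece c u : (size u <= k)%N -> path leq c u -> (b <= c)%N ->
    (forall y, y \in u -> d c y <= T / 4) -> S c u <= C * (5 / 8 * T) ^+ n.
  move=> uk pu bc cu; apply: le_trans (IH _ _ (T / 2) uk pu _) _.
    have cu' y : y \in c :: u -> d c y <= T / 4.
      by rewrite inE => /orP[/eqP ->|/cu//]; rewrite d0; lra.
    by move=> x y /cu' cx /cu' cy; have := tri c x y; lra.
  rewrite ler_wpM2l// lerXn2r// ?nnegrE; have := e8 _ bc; have := e0 c; lra.
pose Q := T ^+ n + C * (5 / 8 * T) ^+ n.
have Q0 : 0 <= Q.
  by apply: addr_ge0; [|apply: mulr_ge0 => //]; apply: exprn_ge0; lra.
(* The last premise says that [d b c] is at most [r] units of [delta * T / 16] short of [T]. Each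
   long step consumes a unit, and [T] is out of reach because [D < T]. *)
have inner r : forall c u, (size u <= k)%N -> path leq c u -> (b <= c)%N ->
    (forall x y, x \in c :: u -> y \in c :: u -> d x y <= D) ->
    (forall y, y \in c :: u -> d b y <= D) ->
    T - r%:R * (delta * T / 16) <= d b c -> S c u <= r%:R * Q.
  elim: r => [|r IHr] c u uk pu bc uD ubD rT.
    by have := ubD c (mem_head _ _); lra.
  have r0 : 0 <= r%:R :> R by [].
  case: (boolP (has (fun l => T / 4 < d c l) u)) => [/split_has|/hasPn uT].
  - move=> [u1 [l [u2 [uE cl /hasPn u1T]]]].
    have lu : l \in u by rewrite uE mem_cat mem_head orbT.
    have cl' : (c <= l)%N.
      by have /allP/(_ _ lu) := order_path_min leq_trans pu.
    have /andP[pu1 /= /andP[_ pu2]] : path leq c u1 && path leq (last c u1) (l :: u2).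
      by rewrite -cat_path -uE.
    have su : size u = (size u1 + (size u2).+1)%N by rewrite uE size_cat.
    rewrite uE /S chain_sum_cat /= -/(S c u1) -/(S l u2).
    have H1 : S c u1 <= C * (5 / 8 * T) ^+ n.
      apply: piece => //; first by apply: leq_trans uk; rewrite su leq_addr.
      by move=> y /u1T; rewrite -leNgt.
    have H2 : d (last c u1) l ^+ n <= T ^+ n.
      rewrite lerXn2r ?nnegrE ?dge0 ?(ltW T_gt0)//.
      apply: le_trans (ltW DT); apply: uD; last by rewrite inE lu orbT.
      have := mem_last c u1; rewrite !inE => /orP[->//|h].
      by rewrite uE mem_cat h orbT.
    have sub : {subset l :: u2 <= u}.
      by move=> y y2; rewrite uE mem_cat y2 orbT.
    have H3 : S l u2 <= r%:R * Q.
      apply: IHr => //.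
      + by apply: leq_trans uk; rewrite su; exact: leq_trans (leqnSn _) (leq_addl _ _).
      + exact: leq_trans cl'.
      + by move=> x y /sub xu /sub yu; apply: uD; rewrite inE ?xu ?yu orbT.
      + by move=> y /sub yu; apply: ubD; rewrite inE yu orbT.
      have cl2 : (c < l)%N.
        by rewrite ltn_neqAle cl' andbT; apply/eqP => E; move: cl; rewrite E d0; lra.
      have /orP[/eqP bc2|bc2] : (b == c) || (b < c)%N by rewrite -leq_eqVlt.
        by move: rT; rewrite -bc2 d0 -natr1 bc2; nra.
      have := growth _ _ _ bc2 cl2.
      have := ubD c (mem_head _ _); have := e8 _ bc; have := smallT _ bc.
      move=> h1 h2 h3 /(_ _); rewrite -natr1 in rT.
      have h4 : 8^-1 * (d b c + e c) <= d c l by lra.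
      move=> /(_ h4) h5; have h6 : 4 * (delta * T / 16) <= delta * d c l.
        by have := ler_wpM2l (ltW dl0) (ltW cl); lra.
      rewrite mulrDl mul1r in rT; have h7 : e c <= delta * T / 16 by lra.
      have : 0 <= delta * T / 16 by rewrite divr_ge0// mulr_ge0 ?ltW.
      lra.
    by rewrite -natr1 mulrDl mul1r /Q; rewrite /Q in H3; lra.
  have H : S c u <= C * (5 / 8 * T) ^+ n.
    by apply: piece => // y /uT; rewrite -leNgt.
  have : 0 <= T ^+ n by rewrite exprn_ge0// ltW.
  have : 0 <= r%:R * Q by rewrite mulr_ge0.
  move=> rQ Tn; apply: le_trans H _.
  rewrite -[r.+1%:R]natr1 (mulrDl r%:R 1 Q) mul1r.
  apply: (@le_trans _ _ Q).
    by rewrite /Q lerDr.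
  by rewrite lerDr.
have sub x : x \in b :: s -> x \in [:: a, b & s].
  by move=> xs; rewrite in_cons xs orbT.
have H : S b s <= M%:R * Q.
  apply: inner => //.
  - by move=> x y /sub xs /sub ys; exact: sD.
  - by move=> y /sub ys; apply: sD => //; rewrite !inE eqxx orbT.
  rewrite d0; suff : 16 / delta <= M%:R.
    by rewrite ler_pdivrMr// => h; nra.
  by apply/ltW/archi_boundP; rewrite divr_ge0// ltW.
rewrite /S /= -/(S b s).
have H1 : d a b ^+ n <= T ^+ n.
  rewrite lerXn2r ?nnegrE ?dge0 ?(ltW T_gt0)//; apply: le_trans (ltW DT).
  by apply: sD; rewrite !inE eqxx ?orbT.
apply: le_trans (lerD H1 H) _.
have Tn : 0 <= T ^+ n by rewrite exprn_ge0// ltW.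
rewrite -/T /Q exprMn.
have /(ler_wpM2l (mulr_ge0 C0 Tn)) := n0P n (ltnW n0n).
have -> : M%:R * (T ^+ n + C * ((5 / 8) ^+ n * T ^+ n)) =
  M%:R * T ^+ n + C * T ^+ n * (M%:R * (5 / 8) ^+ n) by lra.
have : C * T ^+ n = 2 * (M%:R * T ^+ n) + 2 * T ^+ n by rewrite /C; lra.
lra.
Qed.

End Chains.

(** * Decompositions along finite dimensional spaces *)

Section Seminorms.
Variables (R : realType) (V : lmodType R).

Definition seminorm (N : V -> R) : Prop :=
  (forall x y, N (x + y) <= N x + N y) /\ (forall a x, N (a *: x) = `|a| * N x).

Variables (N : V -> R) (SN : seminorm N).

Lemma seminorm0 : N 0 = 0.
Proof. by have := SN.2 0 0; rewrite scale0r normr0 mul0r. Qed.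

Lemma seminormN x : N (- x) = N x.
Proof. by rewrite -scaleN1r SN.2 normrN1 mul1r. Qed.

Lemma seminormB x y : N (x - y) = N (y - x).
Proof. by rewrite -opprB seminormN. Qed.

Lemma seminorm_ge0 x : 0 <= N x.
Proof.
have := SN.1 x (- x); rewrite subrr seminorm0 seminormN.
by rewrite -mulr2n pmulrn_lge0.
Qed.

Lemma seminorm_subD x y z : N (x - y) <= N (x - z) + N (z - y).
Proof. by have := SN.1 (x - z) (z - y); rewrite addrA subrK. Qed.

Lemma seminorm_sum (I : Type) (r : seq I) (P : pred I) (F : I -> V) :
  N (\sum_(i <- r | P i) F i) <= \sum_(i <- r | P i) N (F i).
Proof.
apply: (big_ind2 (fun x y => N x <= y)) => [|x1 x2 y1 y2 h1 h2|//].
  by rewrite seminorm0.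
by apply: le_trans (SN.1 _ _) _; exact: lerD.
Qed.

End Seminorms.

Section OneSide.
Variables (R : realType) (A C : lmodType R) (B : A -> C -> R) (N : A -> R).
Hypotheses (PB : pairing B) (SN : seminorm N).

(** Weak compactness as a finite subcover of a cover with one basic neighbourhood per centre. [L]
    and [eps] may depend on the centre, which [step_exists] exploits. *)
Definition weakly_compact_ball : Prop :=
  forall (L : A -> seq C) (eps : A -> R), (forall a, 0 < eps a) ->
  exists2 s : seq A, (forall a, a \in s -> N a <= 1) &
    forall a, N a <= 1 -> exists2 a0, a0 \in s &
      forall c, c \in L a0 -> `|B (a - a0) c| < eps a0.

(* Asymptotic uniform convexity at the single scale [1/8], with the finite
   codimensional subspace given as the annihilator of a finite list. *)
Definition asymptotic_growth (delta : R) : Prop :=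
  forall G : seq A, exists F : seq C, forall g v, lspan G g -> annih B F v ->
    8^-1 * N g <= N v -> N g + delta * N v <= N (g + v).

(** [F1] is fixed before [a], and a later approximant [h'] enters only through
    [annih B F1 (a - h')]. So the approximants of a vector can be chosen independently of each
    other. *)
Definition step_property (delta eps : R) (G G1 : seq A) (F F1 : seq C) : Prop :=
  forall a, N a <= 1 -> exists h, [/\ lspan G1 h, annih B F (a - h),
    N h <= 1 + eps & forall g h', lspan G g -> annih B F1 (a - h') ->
      8^-1 * (N (h - g) + eps) <= N (h' - h) ->
      N (h - g) + delta * N (h' - h) - 2 * eps <= N (h' - g)].

Lemma annih_sub (F1 F2 : seq C) v : {subset F1 <= F2} -> annih B F2 v -> annih B F1 v.
Proof. by move=> F12 F2v c /F12; exact: F2v. Qed.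

Hypotheses (compN : weakly_compact_ball).
Hypothesis sepC : forall c, (forall a, B a c = 0) -> c = 0.
Variable delta : R.
Hypothesis growth : asymptotic_growth delta.

(* Every [a] in the ball is weakly close to one of finitely many centers [a0];
   [h] corrects [a0] by a small vector so that [a - h] is exactly orthogonal to
   the list that makes [a0 - g] grow. *)
Lemma step_exists (eps : R) (G : seq A) (F : seq C) : 0 < eps ->
  exists G1 F1, [/\ {subset G <= G1}, {subset F <= F1} &
    step_property delta eps G G1 F F1].
Proof.
move=> eps0.
(* The first list makes [a0 - g] grow for all [g] in the span of [G]; the second is a reproducing
   system for [F] and that list, from which the correction [e] is computed. *)
have /choice[f fP] : forall a0, exists p : seq C * seq (C * A),
    [/\ forall g v, lspan (a0 :: G) g -> annih B p.1 v ->
          8^-1 * N g <= N v -> N g + delta * N v <= N (g + v),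
      forall c, c \in p.2 -> lspan (F ++ p.1) c.1 &
      forall c, lspan (F ++ p.1) c -> c = \sum_(x <- p.2) B x.2 c *: x.1].
  move=> a0; have [L LP] := growth (a0 :: G).
  have [t tL tr] := reproducing_system (pairing_flip PB) (F ++ L) sepC.
  by exists (L, t).
pose eta a0 := eps / (1 + \sum_(x <- (f a0).2) N x.2).
have S0 a0 : 0 <= \sum_(x <- (f a0).2) N x.2.
  by apply: sumr_ge0 => x _; exact: seminorm_ge0.
have S1 a0 : 0 < 1 + \sum_(x <- (f a0).2) N x.2 by rewrite ltr_pwDl.
have eta0 a0 : 0 < eta a0 by rewrite divr_gt0.
have [s s1 scov] := compN (fun a0 => map fst (f a0).2) eta0.
exists (G ++ flatten [seq a0 :: map snd (f a0).2 | a0 <- s]).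
exists (F ++ flatten [seq F ++ (f a0).1 | a0 <- s]).
split=> [x xG|x xF|a a1]; try by rewrite mem_cat ?xG ?xF.
have [a0 a0s a0P] := scov _ a1; have [gr tL tr] := fP a0.
pose e := \sum_(x <- (f a0).2) B (a - a0) x.1 *: x.2.
have Ne : N e <= eps.
  apply: le_trans (seminorm_sum SN _ _ _) _.
  apply: (@le_trans _ _ (\sum_(x <- (f a0).2) eta a0 * N x.2)).
    rewrite big_seq [leRHS]big_seq; apply: ler_sum => x xf.
    rewrite SN.2 ler_wpM2r ?seminorm_ge0//; apply/ltW/a0P.
    exact: map_f.
  by rewrite -mulr_sumr /eta mulrAC ler_pdivrMr// ler_wpM2l ?ltW// ltrDr.
have orth c : lspan (F ++ (f a0).1) c -> B (a - (a0 + e)) c = 0.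
  move=> /tr cE; rewrite opprD addrA (pairingBl PB) /e (pairing_suml PB) {1}cE.
  rewrite (pairing_sumr PB) -sumrB big1// => x _.
  by rewrite (pairingZr PB) (pairingZl PB) mulrC subrr.
exists (a0 + e); split.
- apply: subspaceD; first exact: lspan_subspace.
    apply: mem_lspan; rewrite mem_cat; apply/orP; right; apply/flatten_mapP.
    by exists a0 => //; rewrite mem_head.
  rewrite /e big_seq; apply: subspace_sum => [|x xf]; first exact: lspan_subspace.
  apply: subspaceZ; first exact: lspan_subspace.
  apply: mem_lspan; rewrite mem_cat; apply/orP; right; apply/flatten_mapP.
  by exists a0 => //; rewrite in_cons map_f ?orbT.
- by move=> c cF; apply: orth; apply: mem_lspan; rewrite mem_cat cF.
- by apply: le_trans (SN.1 _ _) _; rewrite lerD// s1.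
move=> g h' gG h'F hv.
have vF : annih B (f a0).1 (h' - (a0 + e)).
  move=> c cf; have -> : h' - (a0 + e) = (a - (a0 + e)) - (a - h').
    by rewrite [in RHS]opprB [RHS]addrC addrA subrK.
  rewrite (pairingBl PB) orth; last by apply: mem_lspan; rewrite mem_cat cf orbT.
  rewrite h'F ?subrr// mem_cat; apply/orP; right; apply/flatten_mapP.
  by exists a0 => //; rewrite mem_cat cf orbT.
have gg : lspan (a0 :: G) (a0 - g).
  apply: subspaceB; [exact: lspan_subspace|apply: mem_lspan; exact: mem_head|].
  by apply: lspanS gG => y yG; rewrite in_cons yG orbT.
have h1 : N (a0 - g) <= N (a0 + e - g) + N e.
  have := seminorm_subD SN a0 g (a0 + e).
  by rewrite [- (a0 + e)]opprD addrA subrr sub0r seminormN// [N e + _]addrC.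
have h2 : N (a0 + e - g) <= N (a0 - g) + N e.
  by rewrite addrAC; exact: SN.1.
have h3 : N (a0 - g + (h' - (a0 + e))) <= N (h' - g) + N e.
  have -> : a0 - g + (h' - (a0 + e)) = (h' - g) - e.
    by rewrite addrAC [a0 + (_ - _)]addrC opprD [h' + _]addrCA [- a0 + _]addrC subrK addrAC.
  by apply: le_trans (SN.1 _ _) _; rewrite seminormN.
(* Growth holds at [a0 - g]. Replacing [a0] by [h = a0 + e] costs at most [eps] in the threshold and
   [eps] on each side of the conclusion, whence [2 * eps]. *)
have := gr _ _ gg vF; lra.
Qed.

End OneSide.

Section Decomposition.
Variables (R : realType) (A C : lmodType R) (B : A -> C -> R) (N : A -> R).
Hypotheses (PB : pairing B) (SN : seminorm N).
Variables (delta : R) (e : nat -> R).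
Variables (G G1 : nat -> seq A) (F F1 : nat -> seq C).
Hypotheses (GG1 : forall m, {subset G m <= G1 m})
  (G1G : forall m, {subset G1 m <= G m.+1})
  (FF1 : forall m, {subset F m <= F1 m})
  (F1F : forall m, {subset F1 m <= F m.+1})
  (e_gt0 : forall m, 0 < e m) (e_le1 : forall m, e m <= 1)
  (steps : forall m, step_property B N delta (e m.+1) (G m) (G1 m) (F m) (F1 m)).

Definition growing (h : nat -> A) : Prop :=
  forall i j k, (i < j)%N -> (j < k)%N ->
    8^-1 * (N (h j - h i) + e j) <= N (h k - h j) ->
    N (h j - h i) + delta * N (h k - h j) - 2 * e j <= N (h k - h i).

Lemma decomposition a : N a <= 1 -> exists h : nat -> A, [/\ h 0%N = 0,
  forall m, lspan (G1 m) (h m.+1), forall m, annih B (F m) (a - h m.+1),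
  forall m, N (h m) <= 2 & growing h].
Proof.
move=> a1.
(* All steps are chosen at once, without recursion; step [m] yields [h m.+1]. *)
have /choice[k kP] := fun m => steps m a1.
pose h m := if m is m'.+1 then k m' else 0.
have Gmono m n : (m <= n)%N -> {subset G m <= G n}.
  by move/subnK <-; elim: (n - m)%N => //= d IH x /IH /GG1 /G1G.
have Fmono m n : (m <= n)%N -> {subset F m <= F n}.
  by move/subnK <-; elim: (n - m)%N => //= d IH x /IH /FF1 /F1F.
exists h; split=> //=.
- by move=> m; have [] := kP m.
- by move=> m; have [] := kP m.
- move=> [|m] /=; first by rewrite seminorm0.
  by have [_ _ h2 _] := kP m; apply: le_trans h2 _; have := e_le1 m.+1; lra.
move=> i [//|j] [//|l] ij jl /=; have [_ _ _] := kP j; apply.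
  case: i ij => [|i] ij /=; first by case: (lspan_subspace (G j)).
  have [ki _ _ _] := kP i; apply: lspanS ki => x /G1G; exact: Gmono.
have [_ kl _ _] := kP l; apply: annih_sub kl => x /F1F; exact: Fmono.
Qed.

End Decomposition.

(** * The set of norming test sequences *)

Section Powers.
Variable R : realType.
Implicit Types x y a b l s t : R.

Lemma root_exists n x : (0 < n)%N -> 0 <= x -> exists2 r, 0 <= r & r ^+ n = x.
Proof.
move=> n0 x0; exists (x `^ n%:R^-1); first exact: powR_ge0.
by rewrite -powR_mulrn ?powR_ge0// -powRrM mulVf ?powRr1// pnatr_eq0 -lt0n.
Qed.

Lemma young k x y : 0 <= x -> 0 <= y ->
  k.+1%:R * (x * y ^+ k) <= x ^+ k.+1 + k%:R * y ^+ k.+1.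
Proof.
move=> x0 y0; elim: k => [|k IH]; first by rewrite mul1r expr0 mulr1 expr1 mul0r addr0.
have h1 := ler_wpM2l x0 IH.
have h2 : 0 <= k.+1%:R * y ^+ k * (x - y) ^+ 2.
  by rewrite mulr_ge0 ?sqr_ge0// mulr_ge0// exprn_ge0.
have e2 : k.+2%:R = k%:R + 2 :> R by rewrite -natr1 -natr1 -addrA.
have e1 : k.+1%:R = k%:R + 1 :> R by rewrite -natr1.
move: h1 h2; rewrite e1 e2 !exprS expr0 mulr1.
move: (y ^+ k) (x ^+ k) (k%:R : R) => p q r h1 h2; lra.
Qed.

(** Jensen's inequality with weights [a], [b], [1 - a - b] at the points [l], 1, 0. *)
Lemma pow_convex m a b l : 0 <= a -> 0 <= b -> a + b <= 1 -> 0 <= l ->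
  (a * l + b) ^+ m.+1 <= a * l ^+ m.+1 + b.
Proof.
move=> a0 b0 ab l0; elim: m => [|m IH]; first by rewrite !expr1.
have abl : 0 <= a * l + b by rewrite addr_ge0 ?mulr_ge0.
have h1 := ler_wpM2r abl IH.
have h2 : 0 <= (1 - l) * (1 - l ^+ m.+1).
  have [l1|/ltW l1] := leP l 1.
    by rewrite mulr_ge0 ?subr_ge0// exprn_ile1.
  by rewrite mulr_le0 ?subr_le0// exprn_ege1.
have h3 : 0 <= a * b * ((1 - l) * (1 - l ^+ m.+1)).
  by rewrite mulr_ge0// mulr_ge0.
have lm : 0 <= l ^+ m.+1 by rewrite exprn_ge0.
have h4 : 0 <= (1 - a - b) * (a * (l * l ^+ m.+1) + b).
  by apply: mulr_ge0; [lra|rewrite addr_ge0// !mulr_ge0].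
rewrite [in leLHS]exprSr [in leRHS]exprS; apply: le_trans h1 _.
move: (l ^+ m.+1) h3 h4 => q h3 h4; lra.
Qed.

(* Hoelder's inequality for the conjugate exponents [k.+1] and [k.+1 / k]; the latter
   is hidden in the [k]-th powers, which avoids real exponents. *)
Lemma hoelder_pair k x y s t r : 0 <= x -> 0 <= y -> 0 <= s -> 0 <= t -> 0 <= r ->
  x ^+ k.+1 + y ^+ k.+1 <= 1 -> s ^+ k.+1 + t ^+ k.+1 = r ^+ k.+1 ->
  x * s ^+ k + y * t ^+ k <= r ^+ k.
Proof.
move=> x0 y0 s0 t0; rewrite le_eqVlt => /orP[/eqP <-|r0] xy st.
  have /andP[/eqP s00 /eqP t00] : (s == 0) && (t == 0).
    have := st; rewrite expr0n /= => /eqP.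
    by rewrite paddr_eq0 ?exprn_ge0// !expf_eq0.
  case: k xy st => [|k] xy st; last by rewrite s00 t00 !expr0n /= !mulr0 addr0.
  by move: xy; rewrite !expr1 !expr0 !mulr1.
have rk m : 0 < r ^+ m by rewrite exprn_gt0.
have h1 := young k x0 (divr_ge0 s0 (ltW r0)).
have h2 := young k y0 (divr_ge0 t0 (ltW r0)).
have h3 : (s / r) ^+ k.+1 + (t / r) ^+ k.+1 = 1.
  by rewrite !expr_div_n -mulrDl st divff// gt_eqF.
have h4 : k%:R * (s / r) ^+ k.+1 + k%:R * (t / r) ^+ k.+1 = k%:R.
  by rewrite -mulrDr h3 mulr1.
have : k.+1%:R * (x * (s / r) ^+ k + y * (t / r) ^+ k) <= k.+1%:R * 1.
  by rewrite mulrDr mulr1 -[X in _ <= X]natr1; lra.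
rewrite ler_pM2l ?ltr0n// !expr_div_n !mulrA -mulrDl ler_pdivrMr//.
by rewrite mul1r.
Qed.

(** Here the coefficients lie in the q-ball, as k-th powers, and the values are measured with
    exponent p. This controls a splice by its two pieces. *)
Lemma hoelder_dual k x y s t : 0 <= x -> 0 <= y -> 0 <= s -> 0 <= t ->
  s ^+ k.+1 + t ^+ k.+1 <= 1 ->
  (s ^+ k * x + t ^+ k * y) ^+ k.+1 <= x ^+ k.+1 + y ^+ k.+1.
Proof.
move=> x0 y0 s0 t0 st.
have xy0 : 0 <= x ^+ k.+1 + y ^+ k.+1 by rewrite addr_ge0 ?exprn_ge0.
have [r r0 rE] := root_exists (ltn0Sn k) xy0.
rewrite -rE lerXn2r ?nnegrE ?addr_ge0 ?mulr_ge0 ?exprn_ge0//.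
move: r0 rE; rewrite le_eqVlt => /orP[/eqP <-|r0] rE.
  have := rE; rewrite expr0n /= => /esym/eqP.
  rewrite paddr_eq0 ?exprn_ge0// !expf_eq0 /= => /andP[/eqP -> /eqP ->].
  by rewrite !mulr0 addr0.
have h1 := young k (divr_ge0 x0 (ltW r0)) s0.
have h2 := young k (divr_ge0 y0 (ltW r0)) t0.
have h3 : (x / r) ^+ k.+1 + (y / r) ^+ k.+1 = 1.
  by rewrite !expr_div_n -mulrDl -rE divff// gt_eqF// exprn_gt0.
have h4 : k%:R * s ^+ k.+1 + k%:R * t ^+ k.+1 <= k%:R.
  by rewrite -mulrDr -[leRHS]mulr1 ler_wpM2l.
have : k.+1%:R * ((x / r) * s ^+ k + (y / r) * t ^+ k) <= k.+1%:R * 1.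
  by rewrite mulrDr mulr1 -[X in _ <= X]natr1; lra.
rewrite ler_pM2l ?ltr0n// ![_ / r * _]mulrAC -mulrDl ler_pdivrMr// mul1r.
by rewrite ![_ ^+ k * _]mulrC.
Qed.

Lemma exprD_le k x y : 0 <= x -> 0 <= y ->
  (x + y) ^+ k <= 2 ^+ k * (x ^+ k + y ^+ k).
Proof.
move=> x0 y0; wlog xy : x y x0 y0 / x <= y.
  move=> H; have /orP[xy|yx] := le_total x y; first exact: H.
  by rewrite addrC [x ^+ k + _]addrC; exact: H.
apply: (@le_trans _ _ ((2 * y) ^+ k)).
  by rewrite lerXn2r ?nnegrE; lra.
by rewrite exprMn ler_wpM2l ?exprn_ge0// lerDr exprn_ge0.
Qed.

End Powers.

Section BlockBody.
Variables (R : realType) (W : lmodType R) (N : W -> R) (U : nat -> set W).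
Variable k : nat.
Hypotheses (SN : seminorm N) (N0 : forall w, N w = 0 -> w = 0).
Hypotheses (US : forall i, subspace (U i)) (k_gt0 : (0 < k)%N).
Implicit Types u v : nat -> W.

Definition block_sum u a b : W := \sum_(a <= i < b) u i.

(** For [u i = h i.+1 - h i] block sums are differences of [h], and this is the p-variation of [h]
    along the chain, p being [k.+1]. *)
Definition block_variation u a s : R :=
  chain_sum (fun i j => N (block_sum u i j) ^+ k.+1) a s.

Definition variation_body u : Prop :=
  (forall i, U i (u i)) /\ forall a s, path leq a s -> block_variation u a s <= 1.

Definition splice c s t u v : nat -> W :=
  fun i => if (i < c)%N then s ^+ k *: u i else t ^+ k *: v i.

(* With [a = s ^+ k], [b = t ^+ k] and the conjugate exponent [q = k.+1 / k], the
   side condition of [norming_splice] reads [a ^ q + b ^ q <= 1]. *)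
Inductive norming_body : (nat -> W) -> Prop :=
| norming_base u : variation_body u -> norming_body u
| norming_splice c s t u v : 0 <= s -> 0 <= t -> s ^+ k.+1 + t ^+ k.+1 <= 1 ->
    norming_body u -> norming_body v -> norming_body (splice c s t u v).

Lemma norming_body_sub u i : norming_body u -> U i (u i).
Proof.
elim=> [{}u [] //|c s t {}u v s0 t0 st _ Uu _ Uv]; rewrite /splice.
by case: ifP => _; exact: subspaceZ.
Qed.

Lemma norming_body0 : norming_body (fun=> 0).
Proof.
apply: norming_base; split=> [i|a s _]; first by case: (US i).
rewrite /block_variation; elim: s a => //= b s IH a.
by rewrite /block_sum big1// seminorm0// expr0n /= add0r.
Qed.

Lemma norming_bodyN u : norming_body u -> norming_body (fun i => - u i).
Proof.
elim=> [{}u [Uu Vu]|c s t {}u v s0 t0 st _ Ku _ Kv].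
  apply: norming_base; split=> [i|a s /Vu].
    by rewrite -scaleN1r; exact: subspaceZ.
  apply: le_trans; apply: ler_chain_sum => i j.
  by rewrite /block_sum sumrN seminormN.
have := norming_splice c s0 t0 st Ku Kv.
congr norming_body; apply/funext => i.
by rewrite /splice; case: ifP; rewrite scalerN.
Qed.

Lemma norming_body_trunc c u : norming_body u ->
  norming_body (fun i => if (i < c)%N then u i else 0).
Proof.
move=> Ku; have h : (1 : R) ^+ k.+1 + 0 ^+ k.+1 <= 1 by rewrite expr1n expr0n addr0.
have := norming_splice c ler01 (lexx 0) h Ku norming_body0; congr norming_body.
by apply/funext => i; rewrite /splice expr1n scale1r scaler0.
Qed.

Lemma variation_body_single i w : U i w -> N w <= 1 ->
  variation_body (fun j => if j == i then w else 0).
Proof.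
move=> Uw w1; split=> [j|a s].
  by case: eqP => [->//|_]; case: (US j).
have w0 := seminorm_ge0 SN w.
rewrite /block_variation; set f := fun _ _ => _ ^+ _.
suff H : path leq a s -> chain_sum f a s <= (a <= i)%N%:R.
  by move=> /H/le_trans; apply; rewrite lern1 leq_b1.
have fE x y : f x y = if (x <= i < y)%N then N w ^+ k.+1 else 0.
  rewrite /f /block_sum -big_mkcond big_nat1_eq; case: ifP => //.
  by rewrite seminorm0// expr0n.
elim: s a => //= b s IH a /andP[ab /IH H]; rewrite fE.
have w1' : N w ^+ k.+1 <= 1 by rewrite exprn_ile1.
case: (leqP a i) => ai /=; last first.
  by rewrite add0r (le_trans H)// leqNgt (leq_trans ai ab).
case: (leqP b i) H => bi H /=; first by rewrite add0r.
by rewrite -[leRHS]addr0 lerD.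
Qed.

Lemma norming_body_single i w : U i w -> exists2 c, 0 < c &
  norming_body (fun j => if j == i then c *: w else 0).
Proof.
move=> Uw; have w0 := seminorm_ge0 SN w.
have w1 : 0 < 1 + N w by rewrite ltr_pwDl.
exists (1 + N w)^-1; first by rewrite invr_gt0.
apply/norming_base/variation_body_single; first exact: subspaceZ.
by rewrite SN.2 gtr0_norm ?invr_gt0// mulrC ler_pdivrMr// mul1r lerDr.
Qed.

Lemma norming_body_le1 u i : norming_body u -> N (u i) <= 1.
Proof.
elim=> [{}u [_ /(_ i [:: i.+1])]|c s t {}u v s0 t0 st _ Ku _ Kv].
  rewrite /= leqnSn /block_variation /= addr0 /block_sum big_nat1 => /(_ isT).
  by rewrite expr_le1// seminorm_ge0.
have [sn tn] : 0 <= s ^+ k.+1 /\ 0 <= t ^+ k.+1 by rewrite !exprn_ge0.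
have le1 x y : 0 <= x -> x ^+ k.+1 <= 1 -> N y <= 1 -> N (x ^+ k *: y) <= 1.
  move=> x0 x1 y1; rewrite SN.2 ger0_norm ?exprn_ge0// mulr_ile1 ?exprn_ge0 ?seminorm_ge0//.
  by rewrite exprn_ile1//; move: x1; rewrite expr_le1.
by rewrite /splice; case: ifP => _; apply: le1 => //; lra.
Qed.

Lemma block_sum_restrict (P : pred nat) (h : nat -> nat) a u x y :
  (forall x y F, \sum_(x <= i < y | P i) F i = \sum_(h x <= i < h y) F i :> W) ->
  block_sum (fun i => if P i then a *: u i else 0) x y =
  a *: block_sum u (h x) (h y).
Proof. by move=> hP; rewrite /block_sum -big_mkcond hP scaler_sumr. Qed.

Lemma big_nat_minn c x y (F : nat -> W) :
  \sum_(x <= i < y | (i < c)%N) F i = \sum_(minn c x <= i < minn c y) F i.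
Proof.
have [cx|xc] := leqP c x.
  rewrite big_nat_cond big_pred0 ?big_geq//; first by rewrite geq_min leqnn.
  move=> i; apply/negbTE/negP => /andP[/andP[xi _] ic].
  by have := leq_trans ic (leq_trans cx xi); rewrite ltnn.
have [cy|yc] := leqP c y.
  by rewrite [RHS](big_nat_widen _ _ _ _ _ cy).
rewrite big_nat_cond [RHS]big_nat_cond; apply: eq_bigl => i.
by case: (leqP x i) => //= _; case: (ltnP i y) => //= iy; rewrite (ltn_trans iy yc).
Qed.

Lemma big_nat_maxn c x y (F : nat -> W) :
  \sum_(x <= i < y | (c <= i)%N) F i = \sum_(maxn c x <= i < maxn c y) F i.
Proof.
have [yc|cy] := leqP y c.
  rewrite big_nat_cond big_pred0 ?big_geq//; first by rewrite leq_maxl.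
  move=> i; apply/negbTE/negP => /andP[/andP[_ iy] ci].
  by have := leq_trans iy (leq_trans yc ci); rewrite ltnn.
have [xc|cx] := leqP x c.
  rewrite (big_cat_nat xc (ltnW cy)) /= [X in X + _]big_nat_cond big_pred0 ?add0r.
    rewrite big_nat_cond [RHS]big_nat_cond; apply: eq_bigl => i.
    by case: (leqP c i).
  move=> i; apply/negbTE/negP => /andP[/andP[_ ic] ci].
  by have := leq_trans ic ci; rewrite ltnn.
rewrite big_nat_cond [RHS]big_nat_cond; apply: eq_bigl => i.
by case: (leqP x i) => //= xi; rewrite (ltnW (leq_trans cx xi)).
Qed.

Definition chains (D : nat -> seq nat -> Prop) : set (nat * seq nat) :=
  [set p | path leq p.1 p.2 /\ D p.1 p.2].

(** Serves both sides of a cut: [P] is the side, [h] clamps endpoints to it, [D] selects the chains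
    staying there. Dividing by the p-th root [l] of the variation over these chains normalises the
    restriction. *)
Lemma variation_body_restrict u (P : pred nat) (h : nat -> nat)
    (D : nat -> seq nat -> Prop) c :
  variation_body u -> {homo h : x y / (x <= y)%N} ->
  (forall x y F, \sum_(x <= i < y | P i) F i = \sum_(h x <= i < h y) F i :> W) ->
  (forall a s, path leq a s -> D (h a) (map h s)) ->
  (forall i, P i -> D i [:: i.+1]) -> D c [::] ->
  exists l u1, [/\ 0 <= l, l ^+ k.+1 =
      sup [set block_variation u p.1 p.2 | p in chains D],
    variation_body u1 & forall i, P i -> u i = l *: u1 i].
Proof.
move=> [Uu Vu] hh hP Dh DP Dc; set S := [set _ | _ in _].
have ubS : has_ubound S by exists 1 => _ [[a s] [ps _] <-]; exact: Vu.
have S0 : 0 <= sup S by apply: (ub_le_sup ubS); exists (c, [::]).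
have [l l0 lE] := root_exists (ltn0Sn k) S0.
exists l; exists (fun i => if P i then l^-1 *: u i else 0); split=> //.
  split=> [i|a s ps].
    by case: ifP => _; [exact: subspaceZ|case: (US i)].
  rewrite /block_variation.
  have -> : (fun i j => N (block_sum (fun i => if P i then l^-1 *: u i else 0) i j) ^+ k.+1) =
      (fun i j => l^-1 ^+ k.+1 * N (block_sum u (h i) (h j)) ^+ k.+1).
    apply/funext => i; apply/funext => j.
    by rewrite (block_sum_restrict _ _ _ _ hP) SN.2 exprMn ger0_norm ?invr_ge0.
  rewrite chain_sumZ (chain_sum_map (fun i j => N (block_sum u i j) ^+ k.+1)).
  rewrite exprVn lE mulrC; have [->|/eqP Sn0] := pselect (sup S = 0).
    by rewrite invr0 mulr0.
  rewrite ler_pdivrMr ?lt0r ?Sn0// mul1r; apply: (ub_le_sup ubS).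
  exists (h a, map h s) => //; split; last exact: Dh.
  exact: (homo_path hh).
(* If [l = 0], then [u] vanishes on the side, because [D] admits the chain from [i] to [i.+1]. *)
move=> i Pi; rewrite Pi; have [l0'|/eqP ln0] := pselect (l = 0); last first.
  by rewrite scalerA divff// scale1r.
rewrite l0' scale0r; apply: N0; apply/eqP.
suff : N (u i) ^+ k.+1 == 0 by rewrite expf_eq0.
rewrite eq_le exprn_ge0 ?seminorm_ge0// andbT.
have -> : 0 = sup S by rewrite -lE l0' expr0n.
apply: (ub_le_sup ubS); exists (i, [:: i.+1]); first by split=> /=; [rewrite leqnSn|exact: DP].
by rewrite /block_variation /= addr0 /block_sum big_nat1.
Qed.

Definition splits_at c u := exists l1 l2 u1 u2,
  [/\ 0 <= l1, 0 <= l2, l1 ^+ k.+1 + l2 ^+ k.+1 <= 1,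
      norming_body u1 /\ norming_body u2 &
      forall i, u i = if (i < c)%N then l1 *: u1 i else l2 *: u2 i].

(** A chain left of [c] followed by one right of [c] is a chain, and the gap between them only adds
    a nonnegative term; so the two variations sum to at most one. *)
Lemma variation_body_split u c : variation_body u -> splits_at c u.
Proof.
move=> Vu.
have [||||//|l1 [u1 [l10 l1E V1 uE1]]] := @variation_body_restrict u (fun i => i < c)%N
    (minn c) (fun a s => last a s <= c)%N c Vu.
- by move=> x y xy; rewrite leq_min geq_minl (leq_trans (geq_minr _ _)).
- exact: big_nat_minn.
- by move=> a s _; rewrite last_map geq_minl.
- by [].
have [||||//|l2 [u2 [l20 l2E V2 uE2]]] := @variation_body_restrict u (fun i => c <= i)%N
    (maxn c) (fun a s => c <= a)%N c Vu.
- by move=> x y xy; rewrite geq_max leq_maxl (leq_trans xy (leq_maxr _ _)).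
- exact: big_nat_maxn.
- by move=> a s _; rewrite leq_maxl.
- by [].
exists l1, l2, u1, u2; split=> //; first last.
- by move=> i; case: ltnP => [/uE1|/uE2].
- by split; exact: norming_base.
have key p1 p2 : chains (fun a s => last a s <= c)%N p1 -> chains (fun a s => c <= a)%N p2 ->
    block_variation u p1.1 p1.2 + block_variation u p2.1 p2.2 <= 1.
  move: p1 p2 => [a s] [b t] [/= ps sc] [/= pt cb].
  apply: le_trans (Vu.2 a (s ++ b :: t) _); last first.
    by rewrite cat_path ps /= pt (leq_trans sc cb).
  by rewrite /block_variation chain_sum_cat /= lerD2l lerDr exprn_ge0// seminorm_ge0.
rewrite l1E l2E -lerBrDr; apply: ge_sup.
  by exists 0; exists (c, [::]) => //; split.
move=> _ [p1 p1D <-]; rewrite lerBrDl -lerBrDr; apply: ge_sup.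
  by exists 0; exists (c, [::]) => //; split.
by move=> _ [p2 p2D <-]; rewrite lerBrDr addrC; exact: key.
Qed.

(** When the cut falls inside one piece of a splice, the part of that piece next to the old junction
    is regrouped with the other piece into a multiple of a new splice. *)
Lemma norming_body_split u c : norming_body u -> splits_at c u.
Proof.
move=> Ku; elim: Ku c => [{}u Vu c|c s t {}u v s0 t0 st Ku IHu Kv IHv c'].
  exact: variation_body_split.
have k1 : (k = k.-1.+1)%N by rewrite prednK.
(* [l] belongs to the part next to the junction, [l'] to the part cut off. Write [l] as [r ^+ k] and
   take the p-norm of the pair [x * r], [y]: its k-th power is the common factor. The last
   inequality is convexity of the k-th power. *)
have main (x y l l' : R) : 0 <= x -> 0 <= y -> 0 <= l -> 0 <= l' ->
    x ^+ k.+1 + y ^+ k.+1 <= 1 -> l ^+ k.+1 + l' ^+ k.+1 <= 1 ->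
    exists m x' y', [/\ 0 <= m, 0 <= x', 0 <= y', x' ^+ k.+1 + y' ^+ k.+1 <= 1 &
      [/\ m * x' ^+ k = x ^+ k * l, m * y' ^+ k = y ^+ k &
      m ^+ k.+1 + (x ^+ k * l') ^+ k.+1 <= 1]].
  move=> x0 y0 l0 l'0 xy ll'.
  have [r r0 rE] := root_exists k_gt0 l0.
  have z0 : 0 <= (x * r) ^+ k.+1 + y ^+ k.+1.
    by rewrite addr_ge0 ?exprn_ge0// mulr_ge0.
  have [m m0 mE] := root_exists (ltn0Sn k) z0.
  have scal (z : R) : 0 <= z -> z ^+ k.+1 <= m ^+ k.+1 -> m ^+ k * (z / m) ^+ k = z ^+ k.
    move=> z00 zm; rewrite -exprMn mulrCA; have [m0'|/eqP mn0] := pselect (m = 0).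
      move: zm; rewrite m0' expr0n /= mul0r mulr0 => zm.
      have /eqP : z ^+ k.+1 = 0 by apply/eqP; rewrite eq_le zm exprn_ge0.
      by rewrite expf_eq0 /= => /eqP ->.
    by rewrite divff// mulr1.
  exists (m ^+ k), (x * r / m), (y / m); split.
  - exact: exprn_ge0.
  - by rewrite divr_ge0// mulr_ge0.
  - exact: divr_ge0.
  - rewrite !expr_div_n -mulrDl -mE; have [->|/eqP mn0] := pselect (m = 0).
      by rewrite expr0n mul0r.
    by rewrite divff// expf_neq0.
  - split.
    + rewrite scal ?exprMn ?rE// ?mulr_ge0// mE exprMn lerDl exprn_ge0//.
    + by rewrite scal// mE lerDr exprn_ge0// mulr_ge0.
    rewrite -exprM mulnC exprM mE [(x * r) ^+ _]exprMn.
    have x1 : 0 <= x ^+ k.+1 by rewrite exprn_ge0.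
    have y1 : 0 <= y ^+ k.+1 by rewrite exprn_ge0.
    have r1 : 0 <= r ^+ k.+1 by rewrite exprn_ge0.
    have := pow_convex k.-1 x1 y1 xy r1; rewrite -k1 => h1.
    have h2 : (x ^+ k * l') ^+ k.+1 <= x ^+ k.+1 * l' ^+ k.+1.
      rewrite exprMn ler_wpM2r ?exprn_ge0// -exprM mulnC exprM -[leRHS]expr1.
      by apply: ler_wiXn2l => //; apply: le_trans xy; rewrite lerDl.
    have h3 : x ^+ k.+1 * (r ^+ k.+1) ^+ k = x ^+ k.+1 * l ^+ k.+1.
      by rewrite -rE -!exprM mulnC.
    have h4 : x ^+ k.+1 * (l ^+ k.+1 + l' ^+ k.+1) <= x ^+ k.+1.
      by rewrite -[leRHS]mulr1 ler_wpM2l.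
    by rewrite h3 in h1; lra.
have [cc|cc] := leqP c' c.
  have [l1 [l2 [u1 [u2 [l10 l20 ll [K1 K2] uE]]]]] := IHu c'.
  rewrite addrC in ll.
  have [m [x [y [m0 x0 y0 xy [mx my mll]]]]] := main _ _ _ _ s0 t0 l20 l10 st ll.
  exists (s ^+ k * l1), m, u1, (splice c x y u2 v); split=> //.
  - by rewrite mulr_ge0// exprn_ge0.
  - by rewrite addrC.
  - by split=> //; exact: norming_splice.
  move=> i; rewrite /splice uE; case: (ltnP i c') => ic'.
    by rewrite (leq_trans ic' cc) scalerA.
  by case: ifP => _; rewrite !scalerA ?mx ?my.
have [l1 [l2 [u1 [u2 [l10 l20 ll [K1 K2] vE]]]]] := IHv c'.
rewrite addrC in st.
have [m [x [y [m0 x0 y0 xy [mx my mll]]]]] := main _ _ _ _ t0 s0 l10 l20 st ll.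
exists m, (t ^+ k * l2), (splice c y x u u1), u2; split=> //.
- by rewrite mulr_ge0// exprn_ge0.
- by split=> //; apply: norming_splice => //; rewrite addrC.
move=> i; rewrite /splice vE; case: (ltnP i c') => ic'.
  by case: ifP => _; rewrite !scalerA ?mx ?my.
by rewrite ltnNge (leq_trans (ltnW cc) ic') /= scalerA.
Qed.

(** Unrolling the splices cuts the interval into pieces on which [u] is a multiple of a sequence of
    [variation_body]; [hoelder_dual] adds the p-th powers. The term [g a] lets the base estimate
    look back before its interval; the intervals start at distinct points, so each [g i] is counted
    at most once. *)
Lemma norming_body_bound (phi : nat -> W -> R) (f : nat -> nat -> R) (g : nat -> R) :
  (forall i c w, phi i (c *: w) = c * phi i w) ->
  (forall i, 0 <= g i) ->
  (forall u a b, variation_body u -> (a < b)%N ->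
     `|\sum_(a <= i < b) phi i (u i)| ^+ k.+1 <= g a + f a b) ->
  forall u, norming_body u -> forall a b, (a <= b)%N ->
  exists s, [/\ path leq a s, last a s = b &
    `|\sum_(a <= i < b) phi i (u i)| ^+ k.+1 <=
      \sum_(a <= i < b) g i + chain_sum f a s].
Proof.
move=> phiZ g0 base u; elim=> [{}u Vu|c s t {}u v s0 t0 st Ku IHu Kv IHv] a b ab.
  move: ab; rewrite leq_eqVlt => /orP[/eqP <-|ab].
    by exists [::]; split=> //; rewrite !big_geq// normr0 expr0n /= addr0.
  exists [:: b]; split=> //=; first by rewrite (ltnW ab).
  apply: le_trans (base _ _ _ Vu ab) _; rewrite addr0 lerD2r big_ltn// lerDl.
  exact: sumr_ge0.
have [sn tn] : 0 <= s ^+ k.+1 /\ 0 <= t ^+ k.+1 by rewrite !exprn_ge0.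
have scal (r : R) w m n : 0 <= r -> r ^+ k.+1 <= 1 ->
    `|\sum_(m <= i < n) phi i (r ^+ k *: w i)| ^+ k.+1 <=
    `|\sum_(m <= i < n) phi i (w i)| ^+ k.+1.
  move=> r0 r1; under eq_bigr do rewrite phiZ.
  rewrite -mulr_sumr normrM exprMn ler_piMl ?exprn_ge0//.
  rewrite ger0_norm ?exprn_ge0// !exprn_ile1// ?exprn_ge0//.
  by move: r1; rewrite expr_le1.
have [ca|ac] := leqP c a.
  have [l [pl lE lb]] := IHv a b ab; exists l; split=> //; apply: le_trans lb.
  apply: le_trans (scal t v a b t0 _); last by lra.
  rewrite (@eq_big_nat _ _ _ _ _ _ (fun i => phi i (t ^+ k *: v i)))// => i /andP[ai _].
  by rewrite /splice ltnNge (leq_trans ca ai).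
have [bc|cb] := leqP b c.
  have [l [pl lE lb]] := IHu a b ab; exists l; split=> //; apply: le_trans lb.
  apply: le_trans (scal s u a b s0 _); last by lra.
  rewrite (@eq_big_nat _ _ _ _ _ _ (fun i => phi i (s ^+ k *: u i)))// => i /andP[_ ib].
  by rewrite /splice (leq_trans ib bc).
have [l1 [p1 e1 b1]] := IHu a c (ltnW ac); have [l2 [p2 e2 b2]] := IHv c b (ltnW cb).
exists (l1 ++ l2); split; first by rewrite cat_path p1 e1.
  by rewrite last_cat e1.
rewrite chain_sum_cat e1 (big_cat_nat (ltnW ac) (ltnW cb)) /=.
rewrite [X in _ <= X + _](big_cat_nat (ltnW ac) (ltnW cb)) /= addrACA.
apply: le_trans (lerD b1 b2).
have -> : \sum_(a <= i < c) phi i (splice c s t u v i) = s ^+ k * \sum_(a <= i < c) phi i (u i).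
  by rewrite mulr_sumr; apply: eq_big_nat => i /andP[_ ic]; rewrite /splice ic phiZ.
have -> : \sum_(c <= i < b) phi i (splice c s t u v i) = t ^+ k * \sum_(c <= i < b) phi i (v i).
  by rewrite mulr_sumr; apply: eq_big_nat => i /andP[ci _]; rewrite /splice ltnNge ci phiZ.
apply: le_trans (hoelder_dual (normr_ge0 _) (normr_ge0 _) s0 t0 st).
rewrite lerXn2r ?nnegrE// ?addr_ge0 ?mulr_ge0 ?exprn_ge0//.
rewrite (le_trans (ler_normD _ _))// !normrM.
by rewrite (ger0_norm (exprn_ge0 k s0)) (ger0_norm (exprn_ge0 k t0)).
Qed.

End BlockBody.

(** * The sequence space *)

Section SequenceSpace.
Variable R : realType.

(** The interface between [norming_body] and the space. [body_single] makes coordinates continuous,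
    [body_splice] and [body_split] give the lower and the upper estimate, and [blocks_frame] is
    finite dimensionality of a block, in the form of a reproducing system bounded on the body. *)
Record norming_data (W : lmodType R) := NormingData {
  blocks : nat -> set W;
  body : set (nat -> W);
  expo : nat;
  blocks_subspace : forall i, subspace (blocks i);
  body_blocks : forall u i, body u -> blocks i (u i);
  body0 : body (fun=> 0);
  bodyN : forall u, body u -> body (fun i => - u i);
  body_trunc : forall c u, body u -> body (fun i => if (i < c)%N then u i else 0);
  body_single : forall i w, blocks i w ->
    exists2 c : R, 0 < c & body (fun j => if j == i then c *: w else 0);
  body_splice : forall c (s t : R) u v, 0 <= s -> 0 <= t ->
    s ^+ expo.+1 + t ^+ expo.+1 <= 1 -> body u -> body v ->
    body (splice expo c s t u v);
  body_split : forall c u, body u -> exists (l1 l2 : R) u1 u2,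
    [/\ 0 <= l1, 0 <= l2, l1 ^+ expo.+1 + l2 ^+ expo.+1 <= 1, body u1 /\ body u2 &
      forall i, u i = if (i < c)%N then l1 *: u1 i else l2 *: u2 i];
  blocks_frame : forall i, exists2 t : seq (W * (W -> R)),
    (forall f, f \in t -> [/\ blocks i f.1,
      forall a x y, f.2 (a *: x + y) = a * f.2 x + f.2 y &
      exists M, forall u, body u -> `|f.2 (u i)| <= M]) &
    forall w, blocks i w -> w = \sum_(f <- t) f.2 w *: f.1
}.

Variables (W : lmodType R) (D : norming_data W).
Implicit Types (u : nat -> W).
Notation k := (expo D).

Definition zpair n (z : nat -> W -> R) u : R := \sum_(0 <= i < n) z i (u i).

(** Functions are total on [W]; the value 0 off the block makes the representative unique, so that
    [znorm] separates points. Bounded partial pairings are the only summability condition, which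
    later puts the candidate for a bidual element into the space. *)
Definition zvalid (z : nat -> W -> R) : Prop :=
  [/\ forall i a x y, blocks D i x -> blocks D i y ->
        z i (a *: x + y) = a * z i x + z i y,
      forall i w, ~ blocks D i w -> z i w = 0 &
      exists M, forall u n, body D u -> `|zpair n z u| <= M].

Definition zpred : {pred (nat -> W -> R^o)} := fun z => `[< zvalid z >].

Lemma zpairDZ n a (z z' : nat -> W -> R^o) u : zpair n (a *: z + z') u = a * zpair n z u + zpair n z' u.
Proof. by rewrite /zpair mulr_sumr -big_split. Qed.

Lemma zpred_submod : submod_closed zpred.
Proof.
split=> [|a z z' /asboolP[zl zo [M zM]] /asboolP[zl' zo' [M' zM']]].
  apply/asboolP; split=> [i a x y _ _|//|].
    by rewrite /GRing.zero/= mulr0 addr0.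
  by exists 0 => u n _; rewrite /zpair big1// normr0.
apply/asboolP; split=> [i b x y Ux Uy|i w Uw|].
- rewrite /= -[LHS]/(a * z i (b *: x + y) + z' i (b *: x + y)).
  rewrite -[RHS]/(b * (a * z i x + z' i x) + (a * z i y + z' i y)).
  by rewrite zl// zl'//; lra.
- by rewrite -[LHS]/(a * z i w + z' i w) zo// zo'// mulr0 addr0.
exists (`|a| * M + M') => u n Ku; rewrite zpairDZ (le_trans (ler_normD _ _))//.
by rewrite lerD ?zM'// normrM ler_wpM2l ?zM.
Qed.

HB.instance Definition _ := GRing.isSubmodClosed.Build R (nat -> W -> R^o) zpred zpred_submod.

Record zspace := ZSpace { zval : nat -> W -> R^o; zvalP : zval \in zpred }.

HB.instance Definition _ := [isSub for zval].
HB.instance Definition _ := [Choice of zspace by <:].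
HB.instance Definition _ := [SubChoice_isSubLmodule of zspace by <:].

Definition zapp (z : zspace) : nat -> W -> R := zval z.
Coercion zapp : zspace >-> Funclass.

Implicit Types z : zspace.

Lemma zspaceP z : zvalid z.
Proof. exact/asboolP/zvalP. Qed.

Lemma zspace_eq z z' : (forall i w, z i w = z' i w) -> z = z'.
Proof.
by move=> E; apply/val_inj/funext => i; apply/funext => w; exact: E.
Qed.

Lemma zvalDZ a z z' i w : (a *: z + z') i w = a * z i w + z' i w.
Proof. by []. Qed.
Lemma zvalB z z' i w : (z - z') i w = z i w - z' i w.
Proof. by []. Qed.
Lemma zval0 i w : (0 : zspace) i w = 0.
Proof. by []. Qed.

Lemma zvalZr z i a w : blocks D i w -> z i (a *: w) = a * z i w.
Proof.
move=> Uw; have [zl _ _] := zspaceP z; have U0 := (blocks_subspace D i).1.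
have z0 : z i 0 = 0.
  have := zl i 0 0 0 U0 U0; rewrite scaler0 addr0 mul0r add0r => h.
  by have := zl i 1 0 0 U0 U0; rewrite scaler0 addr0 mul1r => /esym/eqP; rewrite -subr_eq0 addrK => /eqP.
by rewrite -[a *: w]addr0 zl// z0 addr0.
Qed.

Lemma zpairD n z z' u : zpair n (z + z') u = zpair n z u + zpair n z' u.
Proof. by rewrite /zpair -big_split. Qed.

Lemma zpairB n z z' u : zpair n (z - z') u = zpair n z u - zpair n z' u.
Proof. by rewrite /zpair -sumrB. Qed.

Lemma zpair_single n z i w : (i < n)%N -> blocks D i w ->
  zpair n z (fun j => if j == i then w else 0) = z i w.
Proof.
move=> ni Uw; rewrite /zpair (eq_big_nat _ _ (F2 := fun j => if j == i then z i w else 0)).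
  by rewrite -big_mkcond big_nat1_eq leq0n ni.
move=> j _; case: eqP => [->//|_].
by have := zvalZr z 0 (blocks_subspace D j).1; rewrite scale0r mul0r.
Qed.

Definition znorm z : R := sup [set r | exists u n, body D u /\ r = `|zpair n z u|].

Lemma zset_ub z : has_ubound [set r | exists u n, body D u /\ r = `|zpair n z u|].
Proof.
have [_ _ [M zM]] := zspaceP z; exists M => _ [u [n [Ku ->]]]; exact: zM.
Qed.

Lemma zpair_le n z u : body D u -> `|zpair n z u| <= znorm z.
Proof. by move=> Ku; apply: (ub_le_sup (zset_ub z)); exists u, n. Qed.

Lemma znorm_le z M : (forall n u, body D u -> zpair n z u <= M) -> znorm z <= M.
Proof.
move=> zM; apply: ge_sup.
  by exists `|zpair 0 z (fun=> 0)|, (fun=> 0), 0%N; split=> //; exact: body0.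
move=> _ [u [n [Ku ->]]]; rewrite ler_norml zM// andbT lerNl.
have := zM n _ (bodyN Ku); congr (_ <= M).
rewrite /zpair -sumrN; apply: eq_bigr => i _.
by rewrite -scaleN1r zvalZr ?mulN1r//; exact: body_blocks.
Qed.

Lemma znorm_ge0 z : 0 <= znorm z.
Proof. exact: le_trans (normr_ge0 _) (zpair_le 0 z (body0 D)). Qed.

Lemma zval_le i w : blocks D i w -> exists2 c, 0 <= c & forall z, `|z i w| <= c * znorm z.
Proof.
move=> Uw; have [c c0 Kc] := body_single Uw; exists c^-1; first by rewrite invr_ge0 ltW.
move=> z'; have := zpair_le i.+1 z' Kc.
rewrite zpair_single//; last by apply: subspaceZ => //; exact: blocks_subspace.
by rewrite zvalZr// normrM gtr0_norm// => h; rewrite ler_pdivlMl.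
Qed.

Lemma znormD z z' : znorm (z + z') <= znorm z + znorm z'.
Proof.
apply: znorm_le => n u Ku; rewrite zpairD.
by apply: lerD; apply: le_trans (ler_norm _) _; exact: zpair_le.
Qed.

Lemma zpairZ n a z u : zpair n (a *: z) u = a * zpair n z u.
Proof. by rewrite /zpair mulr_sumr. Qed.

Lemma znormZ a z : znorm (a *: z) = `|a| * znorm z.
Proof.
have le b y : znorm (b *: y) <= `|b| * znorm y.
  apply: znorm_le => n u Ku; rewrite zpairZ (le_trans (ler_norm _))// normrM.
  by rewrite ler_wpM2l// zpair_le.
apply/eqP; rewrite eq_le le /=; have [->|a0] := eqVneq a 0.
  by rewrite normr0 mul0r znorm_ge0.
rewrite -ler_pdivlMl ?normr_gt0// -normfV.
by rewrite -[z in leLHS]scale1r -(mulVf a0) -scalerA le.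
Qed.

Lemma znorm0_eq0 z : znorm z = 0 -> z = 0.
Proof.
move=> z0; apply: zspace_eq => i w; have [Uw|nUw] := pselect (blocks D i w).
  have [c c0 /(_ z)] := zval_le Uw; rewrite z0 mulr0 => h.
  by apply/eqP; rewrite zval0 -normr_le0.
by have [_ zo _] := zspaceP z; rewrite zo.
Qed.

HB.instance Definition _ := Lmodule_isNormed.Build R zspace znormD znormZ znorm0_eq0.

Lemma znormE z : `|z| = znorm z. Proof. by []. Qed.

(** The limit is coordinatewise. A partial pairing involves finitely many coordinates, so the Cauchy
    estimate, uniform in [u] and [n], passes to the limit. *)
Lemma zspace_complete (F : set_system zspace) : ProperFilter F -> cauchy F -> cvg F.
Proof.
move=> FF /cauchyP Fc.
have evc i w : blocks D i w -> cvg ((fun z : zspace => z i w) @ F).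
  move=> Uw; apply/cauchy_cvgP/cauchyP => e e0.
  have [c c0 cP] := zval_le Uw.
  have ec : 0 < e / (c + 1) by rewrite divr_gt0// ltr_wpDl.
  have [z0 z0P] := Fc _ ec; exists (z0 i w).
  apply: (@filterS _ F _ (ball z0 (e / (c + 1)))) => // z.
  rewrite -ball_normE /= => zz; suff h : `|(z0 - z) i w| < e by exact: h.
  apply: le_lt_trans (cP _) _; rewrite -znormE.
  have c1 : 0 < c + 1 by rewrite ltr_wpDl.
  by rewrite ltr_pdivlMr// in zz; apply: le_lt_trans zz; rewrite mulrC ler_wpM2l// lerDl.
pose zl : nat -> W -> R := fun i w => if `[< blocks D i w >] then
  lim ((fun z : zspace => z i w) @ F) else 0.
have zlc i w : blocks D i w -> (fun z : zspace => z i w) @ F --> zl i w.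
  by move=> Uw; rewrite /zl asboolT//; exact: evc.
have pairc n u : body D u -> (fun z : zspace => zpair n z u) @ F --> zpair n zl u.
  move=> Ku; elim: n => [|n IH].
    have -> : (fun z : zspace => zpair 0 z u) = cst 0.
      by apply/funext => z; rewrite /zpair big_geq.
    by rewrite /zpair big_geq//; exact: cvg_cst.
  have -> : (fun z : zspace => zpair n.+1 z u) = (fun z => zpair n z u + z n (u n)).
    by apply/funext => z; rewrite /zpair big_nat_recr.
  by rewrite /zpair big_nat_recr//=; apply: cvgD => //; apply/zlc/body_blocks.
have near e : 0 < e -> exists z0 : zspace, (\forall z \near F, `|z0 - z| < e) /\
    forall n u, body D u -> `|zpair n z0 u - zpair n zl u| <= e.
  move=> e0; have [z0 z0P] := Fc _ e0; exists z0.
  have z0N : \forall z \near F, `|z0 - z| < e.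
    by apply: filterS z0P => z; rewrite -ball_normE.
  split=> // n u Ku.
  have lc : (fun z : zspace => `|zpair n z0 u - zpair n z u|) @ F -->
      `|zpair n z0 u - zpair n zl u|.
    by apply: cvg_norm; apply: cvgB; [exact: cvg_cst|exact: pairc].
  apply: (cvgr_to_le lc); apply: filterS z0N => z zz.
  by rewrite -zpairB; apply: le_trans (ltW zz); exact: zpair_le.
have zlP : (zl : nat -> W -> R^o) \in zpred.
  apply/asboolP; split=> [i a x y Ux Uy|i w nU|].
  - have Uxy : blocks D i (a *: x + y) by exact: (blocks_subspace D i).2.
    have h1 := zlc _ _ Uxy.
    have h2 : (fun z : zspace => z i (a *: x + y)) @ F --> a * zl i x + zl i y.
      have -> : (fun z : zspace => z i (a *: x + y)) = (fun z => a * z i x + z i y).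
        by apply/funext => z; have [zlin _ _] := zspaceP z; rewrite zlin.
      by apply: cvgD; [apply: cvgM; [exact: cvg_cst|exact: zlc]|exact: zlc].
    by rewrite -(cvg_lim (@Rhausdorff R) h1) (cvg_lim (@Rhausdorff R) h2).
  - by rewrite /zl asboolF.
  have [z0 [_ z0P]] := near 1 ltr01; exists (`|z0| + 1) => u n Ku.
  rewrite -[zpair n zl u](subrK (zpair n z0 u)) addrC (le_trans (ler_normD _ _))//.
  by rewrite lerD//; [exact: zpair_le|rewrite distrC z0P].
apply/cvg_ex; exists (ZSpace zlP); apply/cvgrPdist_lt => e e0.
have e2 : 0 < e / 2 by rewrite divr_gt0.
have [z0 [z0N z0P]] := near _ e2; apply: filterS z0N => z zz.
have h : `|ZSpace zlP - z0| <= e / 2.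
  apply: znorm_le => n u Ku; rewrite zpairB (le_trans (ler_norm _))//.
  by rewrite distrC z0P.
by rewrite -(subrK z0 (ZSpace zlP)) -addrA (le_lt_trans (ler_normD _ _))// [e]splitr ler_ltD.
Qed.

HB.instance Definition _ := Uniform_isComplete.Build zspace zspace_complete.


End SequenceSpace.

Section PowerDuality.
Variable R : realType.

(** Converse of Hoelder's inequality: test with [s = x / r] and [t = y / r], where [r] is the p-norm
    of the pair. *)
Lemma pow_dual k (x y M : R) : 0 <= x -> 0 <= y ->
  (forall s t, 0 <= s -> 0 <= t -> s ^+ k.+1 + t ^+ k.+1 <= 1 ->
     s ^+ k * x + t ^+ k * y <= M) ->
  x ^+ k.+1 + y ^+ k.+1 <= M ^+ k.+1.
Proof.
move=> x0 y0 xyM.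
have xy0 : 0 <= x ^+ k.+1 + y ^+ k.+1 by rewrite addr_ge0 ?exprn_ge0.
have [r r0 rE] := root_exists (ltn0Sn k) xy0.
have M0 : 0 <= M.
  have h : (1 : R) ^+ k.+1 + 0 ^+ k.+1 <= 1 by rewrite expr1n expr0n addr0.
  apply: le_trans (xyM _ _ ler01 (lexx 0) h).
  by rewrite addr_ge0// mulr_ge0// exprn_ge0.
rewrite -rE lerXn2r ?nnegrE//.
move: r0; rewrite le_eqVlt => /orP[/eqP <-//|r0].
have h : (x / r) ^+ k.+1 + (y / r) ^+ k.+1 <= 1.
  by rewrite !expr_div_n -mulrDl -rE divff// gt_eqF// exprn_gt0.
have := xyM _ _ (divr_ge0 x0 (ltW r0)) (divr_ge0 y0 (ltW r0)) h.
have e z : (z / r) ^+ k * z = z ^+ k.+1 / r ^+ k.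
  by rewrite expr_div_n mulrAC -exprSr.
by rewrite !e -mulrDl -rE exprSr mulrAC divff ?mul1r// gt_eqF// exprn_gt0.
Qed.

Lemma pow_squeeze k (a b : nat -> R) (L : R) : (forall n, 0 <= a n) -> (forall n, 0 <= b n) ->
  (forall n, a n ^+ k.+1 + b n ^+ k.+1 <= L ^+ k.+1) -> a @ \oo --> L -> b @ \oo --> 0.
Proof.
move=> a0 b0 ab aL; apply/cvgr0Pnorm_lt => e e0.
have h : (fun n => a n ^+ k.+1) @ \oo --> L ^+ k.+1.
  exact: (continuous_cvg _ (@exprn_continuous R k.+1 L)).
have ek : 0 < e ^+ k.+1 by rewrite exprn_gt0.
have /cvgrPdist_lt/(_ _ ek) := h; apply: filterS => n.
rewrite ger0_norm//; last by rewrite subr_ge0 (le_trans _ (ab n))// lerDl exprn_ge0.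
move=> hn; rewrite ger0_norm// ltNge; apply/negP => eb.
have : e ^+ k.+1 <= b n ^+ k.+1 by rewrite lerXn2r ?nnegrE// ltW.
by have := ab n; lra.
Qed.

End PowerDuality.

(** * Truncations and the two-piece estimates *)

Section SequenceSpaceTheory.
Variables (R : realType) (W : lmodType R) (D : norming_data W).
Notation Z := (zspace D).
Notation k := (expo D).
Implicit Types (z : Z) (u : nat -> W).

Lemma zapp0 z i : z i 0 = 0.
Proof. by have := zvalZr z 0 (blocks_subspace D i).1; rewrite scale0r mul0r. Qed.

Lemma zpair_trunc m n z u : (m <= n)%N ->
  zpair n z (fun i => if (i < m)%N then u i else 0) = zpair m z u.
Proof.
move=> mn; rewrite /zpair (big_nat_widen _ _ _ _ _ mn).
rewrite [RHS]big_mkcond; apply: eq_bigr => i _.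
by case: ifP => // _; rewrite zapp0.
Qed.

Lemma ztrunc_subproof c z :
  ((fun i w => if (i < c)%N then z i w else 0) : nat -> W -> R^o) \in zpred D.
Proof.
have [zl zo [M zM]] := zspaceP z; apply/asboolP; split.
- by move=> i a x y Ux Uy; case: ifP => _; rewrite ?zl// mulr0 addr0.
- by move=> i w nU; rewrite zo//; case: ifP.
exists M => u n Ku; rewrite (_ : zpair _ _ _ =
  zpair n z (fun i => if (i < c)%N then u i else 0)); first exact/zM/body_trunc.
by apply: eq_bigr => i _; case: ifP; rewrite ?zapp0.
Qed.

Definition ztrunc c z : Z := ZSpace (ztrunc_subproof c z).

Lemma ztruncE c z i w : ztrunc c z i w = if (i < c)%N then z i w else 0.
Proof. by []. Qed.

Lemma ztruncDZ c a z z' : ztrunc c (a *: z + z') = a *: ztrunc c z + ztrunc c z'.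
Proof.
apply: zspace_eq => i w; rewrite zvalDZ !ztruncE zvalDZ.
by case: ifP => // _; rewrite mulr0 addr0.
Qed.

Definition low c z := forall i w, (c <= i)%N -> z i w = 0.
Definition high c z := forall i w, (i < c)%N -> z i w = 0.

Lemma low_trunc c z : low c (ztrunc c z).
Proof. by move=> i w ci; rewrite ztruncE ltnNge ci. Qed.

Lemma high_tail c z : high c (z - ztrunc c z).
Proof. by move=> i w ic; rewrite zvalB ztruncE ic subrr. Qed.

Lemma znorm_scale_le c z (M : R) : 0 <= c -> (forall n u, body D u -> c * zpair n z u <= M) ->
  c * `|z| <= M.
Proof.
rewrite le_eqVlt => /orP[/eqP <-|c0] zM.
  by have := zM 0%N _ (body0 D); rewrite !mul0r.
rewrite -ler_pdivlMl// znormE; apply: znorm_le => n u Ku.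
by rewrite ler_pdivlMl// zM.
Qed.

(** Splice at [c] a test sequence for [x] with one for [y]; [pow_dual] optimises the coefficients.
    Truncations reconcile the different lengths [n] and [m] of the two pairings. *)
Lemma low_high_lower c x y : low c x -> high c y ->
  `|x| ^+ k.+1 + `|y| ^+ k.+1 <= `|x + y| ^+ k.+1.
Proof.
move=> xc yc; apply: pow_dual => // s t s0 t0 st.
rewrite -lerBrDr; apply: znorm_scale_le => [|n u Ku]; first exact: exprn_ge0.
rewrite lerBrDl -lerBrDr; apply: znorm_scale_le => [|m v Kv]; first exact: exprn_ge0.
rewrite lerBrDr.
have Kuv := body_splice c s0 t0 st (body_trunc n Ku) (body_trunc m Kv).
apply: le_trans (zpair_le (maxn n m) _ Kuv); apply: le_trans (ler_norm _).
rewrite zpairD -(zpair_trunc x u (leq_maxl n m)) -(zpair_trunc y v (leq_maxr n m)).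
rewrite addrC lerD// /zpair mulr_sumr; apply: ler_sum => i _; rewrite /splice.
  case: (ltnP i c) => ic; last by rewrite !xc// mulr0.
  by rewrite zvalZr//; case: ifP => _; [exact: body_blocks|exact: (blocks_subspace D i).1].
case: (ltnP i c) => ic; first by rewrite !yc// mulr0.
by rewrite zvalZr//; case: ifP => _; [exact: body_blocks|exact: (blocks_subspace D i).1].
Qed.

(** [a ^+ k.+1] stands for the q-th power of the norm of [x]. Every test sequence splits at [c] with
    coefficients in the p-ball, and [hoelder_pair] applies. *)
Lemma low_high_upper c x y a b r : low c x -> high c y ->
  0 <= a -> 0 <= b -> 0 <= r -> `|x| <= a ^+ k -> `|y| <= b ^+ k ->
  a ^+ k.+1 + b ^+ k.+1 = r ^+ k.+1 -> `|x + y| <= r ^+ k.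
Proof.
move=> xc yc a0 b0 r0 xa yb abr; rewrite znormE; apply: znorm_le => n u Ku.
have [l1 [l2 [u1 [u2 [l10 l20 ll [K1 K2] uE]]]]] := body_split c Ku.
apply: le_trans (hoelder_pair l10 l20 a0 b0 r0 ll abr).
have -> : zpair n (x + y) u = l1 * zpair n x u1 + l2 * zpair n y u2.
  rewrite zpairD /zpair !mulr_sumr; congr (_ + _); apply: eq_bigr => i _; rewrite uE.
    by case: ltnP => ic; [rewrite zvalZr//; exact: body_blocks|rewrite !xc// mulr0].
  by case: ltnP => ic; [rewrite !yc// mulr0|rewrite zvalZr//; exact: body_blocks].
apply: lerD; rewrite ler_wpM2l// (le_trans (ler_norm _))//.
  exact: le_trans (zpair_le _ _ K1) xa.
exact: le_trans (zpair_le _ _ K2) yb.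
Qed.

Lemma trunc_tail_pow c z :
  `|ztrunc c z| ^+ k.+1 + `|z - ztrunc c z| ^+ k.+1 <= `|z| ^+ k.+1.
Proof.
have := low_high_lower (@low_trunc c z) (@high_tail c z).
by rewrite addrC [ztrunc c z + _]addrC subrK addrC.
Qed.

Lemma ztrunc_le c z : `|ztrunc c z| <= `|z|.
Proof.
have := trunc_tail_pow c z; have := normr_ge0 (z - ztrunc c z).
move=> h0 h; rewrite -(@ler_pXn2r _ k.+1) ?nnegrE//.
by apply: le_trans h; rewrite lerDl exprn_ge0.
Qed.

Lemma ztail_le c z : `|z - ztrunc c z| <= `|z|.
Proof.
have := trunc_tail_pow c z; have := normr_ge0 (ztrunc c z).
move=> h0 h; rewrite -(@ler_pXn2r _ k.+1) ?nnegrE//.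
by apply: le_trans h; rewrite lerDr exprn_ge0.
Qed.

Lemma ztrunc_norm_cvg z : (fun n => `|ztrunc n z|) @ \oo --> `|z|.
Proof.
apply/cvgrPdist_lt => e e0.
have [_ [u [m [Ku ->]]] um] := @sup_adherent _ [set r | exists u n, body D u /\ r = `|zpair n z u|] _ e0
  (conj (ex_intro _ _ (ex_intro _ _ (ex_intro _ 0%N (conj (body0 D) erefl)))) (zset_ub z)).
exists m => // n /= mn.
rewrite ger0_norm ?subr_ge0 ?ztrunc_le// ltrBlDl -ltrBlDr.
apply: lt_le_trans um _.
have -> : zpair m z u = zpair m (ztrunc n z) u.
  by apply: eq_big_nat => i /andP[_ im]; rewrite ztruncE (leq_trans im mn).
exact: zpair_le.
Qed.

(** Long heads carry almost the full norm, so the lower estimate leaves nothing for the tails. Hence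
    block expansions converge in norm, although membership only asks for bounded pairings. *)
Lemma ztail_cvg0 z : (fun n => `|z - ztrunc n z|) @ \oo --> (0 : R).
Proof.
apply: (@pow_squeeze _ k (fun n => `|ztrunc n z|) _ `|z|) => //.
- by move=> n; exact: trunc_tail_pow.
- exact: ztrunc_norm_cvg.
Qed.

Lemma ztrunc_cvg z : (fun n => ztrunc n z) @ \oo --> z.
Proof.
apply/cvgrPdist_lt => e e0; have /cvgr0Pnorm_lt/(_ _ e0) := ztail_cvg0 z.
by apply: filterS => n; rewrite normr_id.
Qed.

Definition zcomp i z : Z := ztrunc i.+1 z - ztrunc i z.

Lemma zcompE i z j w : zcomp i z j w = if j == i then z j w else 0.
Proof.
rewrite zvalB !ztruncE ltnS leq_eqVlt; case: eqP => [->|_] /=; first by rewrite ltnn subr0.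
by case: ifP; rewrite subrr.
Qed.

Lemma series_zcomp n z : series (zcomp^~ z) n = ztrunc n z.
Proof.
rewrite /series /= telescope_sumr//; apply: zspace_eq => i w.
by rewrite zvalB !ztruncE subr0.
Qed.

Definition zblock (j : nat) : set Z := [set z | forall i w, i != j -> z i w = 0].

Lemma zblock_comp j z : zblock j (zcomp j z).
Proof. by move=> i w /negbTE ij; rewrite zcompE ij. Qed.

Lemma zapp_sum (t : Type) (r : seq t) (F : t -> Z) i w :
  (\sum_(f <- r) F f) i w = \sum_(f <- r) F f i w.
Proof. by elim/big_rec2: _ => // f y1 y2 _ <-. Qed.

(** A frame functional placed at coordinate [j] is an element of the space; the expansion of the
    vectors of the block transposes to one of the [j]-th components. *)
Lemma zblock_frame j : exists t : seq (W * Z), (forall f, f \in t -> blocks D j f.1 /\ zblock j f.2) /\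
  forall z, zcomp j z = \sum_(f <- t) z j f.1 *: f.2.
Proof.
have [t tP tr] := blocks_frame D j.
have /choice[e eP] : forall f, exists e : Z, f \in t -> zblock j e /\
    forall w, blocks D j w -> e j w = f.2 w.
  move=> f; have [ft|nft] := pselect (f \in t); last by exists 0.
  have [_ fl [M fM]] := tP _ ft.
  pose g : nat -> W -> R^o := fun i w => if (i == j) && `[< blocks D i w >] then f.2 w else 0.
  have gP : g \in zpred D.
    apply/asboolP; split=> [i a x y Ux Uy|i w nU|].
    - rewrite /g !asboolT//=; last exact: (blocks_subspace D i).2.
      by rewrite !andbT; case: eqP => _; rewrite ?fl// mulr0 addr0.
    - by rewrite /g asboolF// andbF.
    exists `|M| => u n Ku; rewrite /zpair.
    rewrite (eq_bigr (fun i => if i == j then f.2 (u j) else 0)); last first.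
      by move=> i _; rewrite /g asboolT ?andbT; [case: eqP => // ->|exact: body_blocks].
    rewrite -big_mkcond big_nat1_eq; case: ifP => _; last by rewrite normr0.
    by rewrite (le_trans (fM _ Ku))// ler_norm.
  exists (ZSpace gP) => _; split=> [i w ij|w Uw].
    by rewrite -[LHS]/(g i w) /g (negbTE ij).
  by rewrite -[LHS]/(g j w) /g eqxx asboolT.
exists [seq (f.1, e f) | f <- t]; split=> [_ /mapP[f ft ->]|z].
  by have [? _ _] := tP _ ft; have [? _] := eP _ ft.
rewrite big_map; apply: zspace_eq => i w; rewrite zcompE zapp_sum.
case: eqP => [->|/eqP ij]; last first.
  rewrite big_seq big1// => f ft; rewrite -[LHS]/(z j f.1 * e f i w).
  by have [h _] := eP _ ft; rewrite h// mulr0.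
have [zl zo _] := zspaceP z.
have [Uw|nUw] := pselect (blocks D j w); last first.
  rewrite zo// big1// => f _; rewrite -[LHS]/(z j f.1 * e f j w).
  by have [_ zo' _] := zspaceP (e f); rewrite zo'// mulr0.
transitivity (\sum_(f <- t) f.2 w * z j f.1); last first.
  rewrite big_seq [RHS]big_seq; apply: eq_bigr => f ft.
  by rewrite -[RHS]/(z j f.1 * e f j w); have [_ h] := eP _ ft; rewrite h// mulrC.
have zjP : forall r : seq (W * (W -> R)), (forall f, f \in r -> blocks D j f.1) ->
    blocks D j (\sum_(f <- r) f.2 w *: f.1) /\
    z j (\sum_(f <- r) f.2 w *: f.1) = \sum_(f <- r) f.2 w * z j f.1.
  elim=> [|f r IH] rP; first by rewrite !big_nil zapp0; split=> //; exact: (blocks_subspace D j).1.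
  have [|h1 h2] := IH; first by move=> g gr; apply: rP; rewrite in_cons gr orbT.
  have h3 := rP f (mem_head _ _).
  rewrite !big_cons zl// h2; split=> //.
  by apply: (blocks_subspace D j).2.
by rewrite {1}(tr _ Uw) (zjP t _).2// => f /tP[].
Qed.

End SequenceSpaceTheory.

(** * The FDD of the sequence space and its estimates *)

Section SequenceSpaceFDD.
Variables (R : realType) (W : lmodType R) (D : norming_data W).
Notation Z := (zspace D).
Notation k := (expo D).
Implicit Types (z : Z) (u : nat -> Z).

Lemma zblock_subspace j : subspace (@zblock R W D j).
Proof.
split=> [//|a x y xj yj i w ij]; rewrite -[LHS]/(a * x i w + y i w).
by rewrite xj// yj// mulr0 addr0.
Qed.

Lemma zcomp_block j z : zblock j z -> zcomp j z = z.
Proof.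
by move=> zj; apply: zspace_eq => i w; rewrite zcompE; case: eqP => // /eqP ij; rewrite zj.
Qed.

Lemma zblock_finite_dim j : finite_dim (@zblock R W D j).
Proof.
have [t [tP tE]] := zblock_frame D j.
exists (size t), (fun i => (nth (0, 0) t i).2); apply/seteqP; split=> z.
  move=> zj; exists (fun i => z j (nth (0, 0) t i).1) => //.
  by rewrite -[RHS](zcomp_block zj) tE (big_nth (0, 0)) big_mkord.
move=> [c _ <-]; apply: (subspace_sum _ (zblock_subspace j)).
move=> i _; apply: (subspaceZ _ (zblock_subspace j)).
by have [] := tP _ (mem_nth (0, 0) (ltn_ord i)).
Qed.

Lemma fdd_expansion_comp z : fdd_expansion (@zblock R W D) z (fun j => zcomp j z).
Proof.
split=> [j|]; first exact: zblock_comp.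
have -> : series (fun j => zcomp j z) = (fun n => ztrunc n z).
  by apply/funext => n; exact: series_zcomp.
exact: ztrunc_cvg.
Qed.

Lemma fdd_expansion_unique z u : fdd_expansion (@zblock R W D) z u -> u = (fun j => zcomp j z).
Proof.
move=> [uE uz]; apply/funext => j; apply: zspace_eq => i w; rewrite zcompE.
case: eqP => [ij|/eqP ij]; last exact: uE.
rewrite ij {i ij}; have [Uw|nUw] := pselect (blocks D j w); last first.
  have [_ zo _] := zspaceP z; have [_ uo _] := zspaceP (u j).
  by rewrite zo// uo.
have [c c0 cP] := zval_le Uw; have c1 : 0 < c + 1 by rewrite ltr_wpDl.
apply/esym/eqP; rewrite -subr_eq0 -normr_le0; apply/ler_addgt0Pr => e e0; rewrite add0r.
have /cvgrPdist_lt/(_ _ (divr_gt0 e0 c1))[n _ /(_ (maxn n j.+1) (leq_maxl _ _))] := uz.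
set m := maxn _ _ => zm.
have -> : z j w - u j j w = (z - series u m) j w.
  rewrite zvalB; congr (_ - _); rewrite /series /= zapp_sum.
  rewrite (eq_big_nat _ _ (F2 := fun i => if i == j then u j j w else 0)).
    by rewrite -big_mkcond big_nat1_eq leq0n leq_maxr.
  by move=> i _; case: eqP => [->//|/eqP ij]; apply: uE; rewrite eq_sym.
apply: le_trans (cP _) _; rewrite -znormE.
rewrite ltr_pdivlMr// mulrC in zm; apply: le_trans (ltW zm).
by rewrite ler_wpM2r// lerDl.
Qed.

Lemma zspace_fdd : is_fdd (@zblock R W D).
Proof.
split=> [j|z]; first exact: zblock_finite_dim.
exists (fun j => zcomp j z); split; first exact: fdd_expansion_comp.
by move=> u /fdd_expansion_unique ->.
Qed.

Lemma fdd_components_comp z : fdd_components (@zblock R W D) z = (fun j => zcomp j z).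
Proof.
apply: fdd_expansion_unique; rewrite /fdd_components.
exact: (xgetI (fun=> 0) (fdd_expansion_comp z)).
Qed.

Lemma suppP z j : supp (@zblock R W D) z j <-> zcomp j z != 0.
Proof. by rewrite /supp /= fdd_components_comp. Qed.

Lemma low_supp c z : (forall j, supp (@zblock R W D) z j -> (j < c)%N) -> low c z.
Proof.
move=> zc i w ci; have : zcomp i z = 0.
  by apply/eqP/negP => /negP /suppP /zc; rewrite ltnNge ci.
by move/(congr1 (fun y : Z => y i w)); rewrite zcompE eqxx.
Qed.

Lemma high_supp c z : (forall j, supp (@zblock R W D) z j -> (c <= j)%N) -> high c z.
Proof.
move=> zc i w ic; have : zcomp i z = 0.
  by apply/eqP/negP => /negP /suppP /zc; rewrite leqNgt ic.
by move/(congr1 (fun y : Z => y i w)); rewrite zcompE eqxx.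
Qed.

Lemma supp_neq0 z : z != 0 -> exists j, supp (@zblock R W D) z j.
Proof.
move=> z0; apply: contrapT => /forallNP h; move/eqP: z0; apply.
apply: zspace_eq => i w; have : zcomp i z = 0.
  by apply/eqP/negP => /negP; rewrite -suppP; exact: h.
by move/(congr1 (fun y : Z => y i w)); rewrite zcompE eqxx.
Qed.

(** By definition only consecutive supports are ordered; as no term is zero, supports are nonempty
    and the order spreads by transitivity. The cut is the least index in the last support. *)
Lemma block_sequence_cut n (x : 'I_n.+1 -> Z) : block_sequence (@zblock R W D) x ->
  block_sequence (@zblock R W D) (fun i => x (widen_ord (leqnSn n) i)) /\
  exists c, (forall i, low c (x (widen_ord (leqnSn n) i))) /\ high c (x ord_max).
Proof.
move=> [x0 xf xs]; split.
  by split=> // i i' ii' j l; exact: xs.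
have ltm m : forall i : 'I_n.+1, forall i' : 'I_n.+1, i' = (i + m.+1)%N :> nat ->
    forall j l, supp (@zblock R W D) (x i) j -> supp (@zblock R W D) (x i') l -> (j < l)%N.
  elim: m => [|m IH] i i' ii' j l xj xl; first by apply: xs xj xl; rewrite ii' addn1.
  have lt1 : (i + m.+1 < n.+1)%N by have := ltn_ord i'; rewrite ii' addnS => /ltnW.
  have [a xa] := supp_neq0 (x0 (Ordinal lt1)).
  apply: (@ltn_trans a); first exact: IH xj xa.
  by apply: xs xa xl; rewrite ii' addnS.
have [c0 xc0] := supp_neq0 (x0 ord_max).
have ex : exists c, `[< supp (@zblock R W D) (x ord_max) c >] by exists c0; apply/asboolP.
case: (ex_minnP ex) => c /asboolP xc cmin; exists c; split=> [i|].
  apply: low_supp => j xj; apply: (ltm (n - i).-1 _ _ _ _ _ xj xc) => /=.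
  by rewrite prednK ?subn_gt0// subnKC// ltnW.
by apply: high_supp => j xj; apply: cmin; apply/asboolP.
Qed.

Lemma low_sum c n (x : 'I_n -> Z) : (forall i, low c (x i)) -> low c (\sum_i x i).
Proof.
by move=> xc i w ci; rewrite zapp_sum big1// => j _; exact: xc.
Qed.

Lemma block_lower n (x : 'I_n -> Z) : block_sequence (@zblock R W D) x ->
  \sum_i `|x i| ^+ k.+1 <= `|\sum_i x i| ^+ k.+1.
Proof.
elim: n x => [|n IH] x xb; first by rewrite !big_ord0 exprn_ge0.
have [/IH h [c [xl xh]]] := block_sequence_cut xb.
rewrite !big_ord_recr /=; apply: le_trans (low_high_lower _ xh); last exact: low_sum xl.
by rewrite lerD2r.
Qed.

Lemma block_upper n (x : 'I_n -> Z) (a : 'I_n -> R) r :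
  (forall i, 0 <= a i) -> 0 <= r -> (forall i, `|x i| <= a i ^+ k) ->
  \sum_i a i ^+ k.+1 = r ^+ k.+1 ->
  block_sequence (@zblock R W D) x -> `|\sum_i x i| <= r ^+ k.
Proof.
elim: n x a r => [|n IH] x a r a0 r0 xa ar xb.
  by rewrite big_ord0 normr0 exprn_ge0.
have [xb' [c [xl xh]]] := block_sequence_cut xb.
pose s := \sum_i a (widen_ord (leqnSn n) i) ^+ k.+1.
have s0 : 0 <= s by apply: sumr_ge0 => i _; rewrite exprn_ge0.
have [r' r'0 r'E] := root_exists (ltn0Sn k) s0.
rewrite big_ord_recr /=; apply: (@low_high_upper _ _ _ c _ _ r' (a ord_max)) => //.
- exact: low_sum.
- by apply: (IH _ (fun i => a (widen_ord (leqnSn n) i))).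
by rewrite r'E -ar big_ord_recr.
Qed.

Lemma zspace_estimates : (0 < k)%N ->
  satisfies_estimates (@zblock R W D) 1 k.+1%:R (k.+1%:R / k%:R).
Proof.
move=> k0 n x xb; rewrite invr1 !mul1r; apply/andP; split.
  have h := block_lower xb.
  have -> : \sum_i `|x i| `^ k.+1%:R = \sum_i `|x i| ^+ k.+1.
    by apply: eq_bigr => i _; rewrite powR_mulrn.
  have s0 : 0 <= \sum_i `|x i| ^+ k.+1 by apply: sumr_ge0 => i _; rewrite exprn_ge0.
  rewrite (le_trans (ge0_ler_powR _ _ _ h)) ?nnegrE ?invr_ge0 ?exprn_ge0//.
  by rewrite -powR_mulrn// -powRrM divff ?powRr1// pnatr_eq0.
(* With [a i] the k-th root of the norm, [a i ^+ k.+1] is its q-th power, and [block_upper] applies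
   with integral powers. *)
have /choice[a aP] : forall i, exists a, 0 <= a /\ a ^+ k = `|x i|.
  by move=> i; have [a a0 aE] := root_exists k0 (normr_ge0 (x i)); exists a.
pose s := \sum_i a i ^+ k.+1.
have s0 : 0 <= s by apply: sumr_ge0 => i _; rewrite exprn_ge0//; case: (aP i).
have [r r0 rE] := root_exists (ltn0Sn k) s0.
have kn0 : k%:R != 0 :> R by rewrite pnatr_eq0 -lt0n.
have kn1 : k.+1%:R != 0 :> R by rewrite pnatr_eq0.
have -> : \sum_i `|x i| `^ (k.+1%:R / k%:R) = s.
  apply: eq_bigr => i _; have [a0 <-] := aP i.
  by rewrite -!powR_mulrn// -powRrM mulrC divfK.
rewrite -rE -powR_mulrn// -powRrM invf_div mulrC divfK// powR_mulrn//.
by apply: (block_upper (a := a)) => // i; have [a0 aE] := aP i; rewrite ?aE.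
Qed.

End SequenceSpaceFDD.

Section DualNorm.
Variables (R : realType) (X : normedModType R).
Implicit Types (f g : X -> R^o) (x : X).

Lemma linear_scale f a x : linear f -> f (a *: x) = a * f x.
Proof.
move=> fl; have f0 : f 0 = 0.
  by apply: (addrI (f 0)); have := fl 1 0 0; rewrite !scale1r !addr0 => <-.
by rewrite -[a *: x]addr0 fl f0 addr0.
Qed.

Lemma linear_sub f x y : linear f -> f (x - y) = f x - f y.
Proof. by move=> fl; rewrite addrC -scaleN1r fl scaleN1r addrC. Qed.

Lemma dual_bound f : dual X f -> exists2 M, 0 <= M & forall x, `|f x : R| <= M * `|x|.
Proof.
move=> [fl fc]; have f0 : f 0 = 0 by rewrite -(scale0r 0) linear_scale// mul0r.
have /cvgrPdist_lt/(_ _ (@ltr01 R)) := fc 0.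
rewrite f0 => /nbhs_ballP[d /= d0 fd].
exists (2 / d) => [|x]; first by rewrite divr_ge0// ltW.
have [->|x0] := eqVneq x 0; first by rewrite f0 !normr0 mulr0.
have x1 : 0 < `|x| by rewrite normr_gt0.
have c0 : 0 < d / (2 * `|x|) by rewrite divr_gt0// mulr_gt0.
have : ball 0 d ((d / (2 * `|x|)) *: x).
  rewrite -ball_normE /= sub0r normrN normrZ gtr0_norm//.
  by rewrite invfM mulrA mulrVK ?unitfE ?normr_eq0// ltr_pdivrMr// mulrC ltr_pMl// ltr1n.
move=> /fd; rewrite /= sub0r normrN linear_scale// normrM gtr0_norm//.
rewrite mulrC -ltr_pdivlMr// => h; apply: le_trans (ltW h) _.
by rewrite mul1r invf_div mulrAC.
Qed.

Lemma dual_of_bound f (M : R) : linear f -> (forall x, `|f x : R| <= M * `|x|) -> dual X f.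
Proof.
move=> fl fM; split=> // x; apply/cvgrPdist_lt => e e0.
have M1 : 0 < `|M| + 1 by rewrite ltr_wpDl.
have d0 : 0 < e / (`|M| + 1) by rewrite divr_gt0.
near=> y; rewrite -linear_sub//; apply: le_lt_trans (fM _) _.
have : `|x - y| < e / (`|M| + 1) by near: y; exact: cvgr_dist_lt.
rewrite ltr_pdivlMr// mulrC; apply: le_lt_trans.
by rewrite ler_wpM2r// (le_trans (ler_norm _))// lerDl.
Unshelve. all: by end_near. Qed.

Lemma dual_norm_has_ubound f : dual X f ->
  has_ubound [set `|f x : R| | x in [set x : X | `|x| <= 1]].
Proof.
move=> /dual_bound[M M0 fM]; exists M => _ [x /= x1 <-].
by apply: le_trans (fM _) _; rewrite ler_piMr.
Qed.

Lemma dual_norm_ge0 f : dual X f -> 0 <= dual_norm f.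
Proof.
move=> fd; apply: le_trans (normr_ge0 (f 0 : R)) _.
by apply: (ub_le_sup (dual_norm_has_ubound fd)); exists 0 => //=; rewrite normr0.
Qed.

Lemma dual_norm_ball f x : dual X f -> `|x| <= 1 -> `|f x : R| <= dual_norm f.
Proof.
by move=> fd x1; apply: (ub_le_sup (dual_norm_has_ubound fd)); exists x.
Qed.

Lemma dual_norm_le f (M : R) : (forall x, `|x| <= 1 -> f x <= M) -> linear f ->
  dual_norm f <= M.
Proof.
move=> fM fl; apply: ge_sup; first by exists `|f 0 : R|, 0 => //=; rewrite normr0.
move=> _ [x /= x1 <-]; rewrite ler_norml fM// andbT lerNl.
have <- : f (- x) = - f x by rewrite -scaleN1r linear_scale// mulN1r.
by apply: fM; rewrite normrN.
Qed.

Lemma dual_submod a f g : dual X f -> dual X g -> dual X (a *: f + g).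
Proof.
move=> fd gd; have [M M0 fM] := dual_bound fd; have [M' M'0 gM'] := dual_bound gd.
apply: (@dual_of_bound _ (`|a| * M + M')).
  move=> b x y; rewrite -[LHS]/(a * f (b *: x + y) + g (b *: x + y)).
  rewrite fd.1 gd.1 -[RHS]/(b * (a * f x + g x) + (a * f y + g y)).
  by rewrite -![_ *: _]/(_ * _); lra.
move=> x; rewrite -[(_ + _) x]/(a * f x + g x) (le_trans (ler_normD _ _))//.
by rewrite normrM mulrDl -mulrA lerD// ler_wpM2l.
Qed.

End DualNorm.

(** * Reflexivity of the sequence space *)

Section SequenceSpaceReflexive.
Variables (R : realType) (W : lmodType R) (D : norming_data W).
Notation Z := (zspace D).
Notation k := (expo D).
Implicit Types (z : Z) (u : nat -> W).

Lemma dual_trunc c (f : Z -> R^o) : dual Z f -> dual Z (fun z => f (ztrunc c z)).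
Proof.
move=> fd; have [M M0 fM] := dual_bound fd; apply: (@dual_of_bound _ _ _ M).
  by move=> a x y; rewrite ztruncDZ fd.1.
by move=> z; apply: le_trans (fM _) _; rewrite ler_wpM2l// ztrunc_le.
Qed.

Lemma dual_tail c (f : Z -> R^o) : dual Z f -> dual Z (fun z => f (z - ztrunc c z)).
Proof.
move=> fd; have [M M0 fM] := dual_bound fd; apply: (@dual_of_bound _ _ _ M).
  move=> a x y; rewrite ztruncDZ -fd.1; congr f.
  by rewrite scalerBr opprD addrACA.
by move=> z; apply: le_trans (fM _) _; rewrite ler_wpM2l// ztail_le.
Qed.

Lemma scaled_sum_le1 c (x y : Z) (s t : R) : `|x| <= 1 -> `|y| <= 1 -> 0 <= s -> 0 <= t ->
  s ^+ k.+1 + t ^+ k.+1 <= 1 ->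
  `|s ^+ k *: ztrunc c x + t ^+ k *: (y - ztrunc c y)| <= 1.
Proof.
move=> x1 y1 s0 t0 st.
have st0 : 0 <= s ^+ k.+1 + t ^+ k.+1 by rewrite addr_ge0 ?exprn_ge0.
have [r r0 rE] := root_exists (ltn0Sn k) st0.
apply: (@le_trans _ _ (r ^+ k)); last first.
  by apply: exprn_ile1 => //; rewrite -(@expr_le1 _ k.+1) ?rE.
have sc (a : R) (z : Z) : 0 <= a -> `|z| <= 1 -> `|a ^+ k *: z| <= a ^+ k.
  by move=> a0 z1; rewrite normrZ ger0_norm ?exprn_ge0// ler_piMr// exprn_ge0.
apply: (@low_high_upper _ _ _ c _ _ s t r) => //.
- move=> i w ci; rewrite -[LHS]/(s ^+ k * ztrunc c x i w) low_trunc//; exact: mulr0.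
- move=> i w ic; rewrite -[LHS]/(t ^+ k * (y - ztrunc c y) i w) (@high_tail _ _ _ c)//; exact: mulr0.
- by apply: sc => //; apply: le_trans x1; exact: ztrunc_le.
- by apply: sc => //; apply: le_trans y1; exact: ztail_le.
Qed.

Lemma dual_norm_scale_le (f : Z -> R^o) (c M : R) : 0 <= c -> dual Z f ->
  (forall z, `|z| <= 1 -> c * f z <= M) -> c * dual_norm f <= M.
Proof.
rewrite le_eqVlt => /orP[/eqP <- _ fM|c0 fd fM].
  by have := fM 0; rewrite normr0 !mul0r => -> //; exact: ler01.
rewrite -ler_pdivlMl//; apply: dual_norm_le; last exact: fd.1.
by move=> z z1; rewrite ler_pdivlMl// fM.
Qed.

(** The upper q-estimate, in the form [scaled_sum_le1], dualises to a lower p-estimate for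
    functionals, p and q being conjugate. It makes the FDD shrinking. *)
Lemma dual_trunc_tail_pow c (f : Z -> R^o) : dual Z f ->
  dual_norm (fun z => f (ztrunc c z)) ^+ k.+1 +
  dual_norm (fun z => f (z - ztrunc c z)) ^+ k.+1 <= dual_norm f ^+ k.+1.
Proof.
move=> fd; have fd1 := dual_trunc c fd; have fd2 := dual_tail c fd.
apply: pow_dual => [||s t s0 t0 st]; try exact: dual_norm_ge0.
rewrite -lerBrDr; apply: dual_norm_scale_le => // [|x x1]; first exact: exprn_ge0.
rewrite lerBrDl -lerBrDr; apply: dual_norm_scale_le => // [|y y1]; first exact: exprn_ge0.
rewrite lerBrDr addrC; have h := scaled_sum_le1 c x1 y1 s0 t0 st.
apply: le_trans (dual_norm_ball fd h); apply: le_trans (ler_norm _).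
by rewrite fd.1 -[s ^+ k * _]/(s ^+ k *: (f _ : R^o)) lerD2l linear_scale//; case: fd.
Qed.

Lemma dual_tail_cvg0 (f : Z -> R^o) : dual Z f ->
  (fun n => dual_norm (fun z => f (z - ztrunc n z))) @ \oo --> (0 : R).
Proof.
move=> fd; apply: (@pow_squeeze _ k (fun n => dual_norm (fun z => f (ztrunc n z))) _ (dual_norm f)).
- by move=> n; apply/dual_norm_ge0/dual_trunc.
- by move=> n; apply/dual_norm_ge0/dual_tail.
- by move=> n; exact: dual_trunc_tail_pow.
apply/cvgrPdist_lt => e e0.
have sn : [set `|f x : R| | x in [set x : Z | `|x| <= 1]] !=set0.
  by exists `|f 0 : R|, 0 => //=; rewrite normr0.
have [_ [z /= z1 <-] zf] := sup_adherent e0 (conj sn (dual_norm_has_ubound fd)).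
have fz : (fun n => `|f (ztrunc n z) : R|) @ \oo --> `|f z : R|.
  by apply: cvg_norm; exact: (cvg_comp _ _ (@ztrunc_cvg _ _ _ z) (fd.2 z)).
near=> n.
have hn : dual_norm f - e < `|f (ztrunc n z) : R| by near: n; exact: cvgr_gt fz _ zf.
have h1 : dual_norm (fun z => f (ztrunc n z)) <= dual_norm f.
  apply: dual_norm_le; last exact: (dual_trunc n fd).1.
  move=> x x1; apply: (le_trans (ler_norm _)); apply: dual_norm_ball => //.
  exact: le_trans (ztrunc_le _ _) x1.
have h2 := dual_norm_ball (dual_trunc n fd) z1.
by rewrite ger0_norm ?subr_ge0// ltrBlDl -ltrBlDr (lt_le_trans hn).
Unshelve. all: by end_near. Qed.

Lemma dual_zapp i w : blocks D i w -> dual Z (fun z => z i w : R^o).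
Proof.
by move=> /zval_le[c c0 cP]; apply: (@dual_of_bound _ _ _ c).
Qed.

Lemma dual_zpair n u : body D u -> dual Z (fun z => zpair n z u : R^o).
Proof.
move=> Ku; apply: (@dual_of_bound _ _ _ 1) => [a x y|z].
  by rewrite zpairD zpairZ.
by rewrite mul1r zpair_le.
Qed.

(** James' argument: the values of [Phi] on coordinates form an element [S], because partial
    pairings with the body are functionals of norm at most one. [Phi] and [S] agree on truncated
    functionals, and tails of functionals vanish in norm. *)
Lemma zspace_reflexive : reflexive_space Z.
Proof.
move=> Phi [PhiL [C PhiC]].
pose s : nat -> W -> R^o := fun i w =>
  if `[< blocks D i w >] then Phi (fun z => z i w : R^o) else 0.
have sE i w : blocks D i w -> s i w = Phi (fun z => z i w : R^o).
  by move=> Uw; rewrite /s asboolT.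
have Phi0 : Phi (fun=> 0) = 0.
  have d0 : dual Z (fun=> 0 : R^o).
    by apply: (@dual_of_bound _ _ _ 0) => [a x y|x]; rewrite ?scaler0 ?addr0// normr0 mul0r.
  have := PhiL (- 1) _ _ d0 d0; rewrite mulN1r addNr => H; rewrite -[RHS]H; congr Phi.
  by apply/funext => z; rewrite -[RHS]/(- 1 * 0 + 0) mulr0 addr0.
have sP : s \in zpred D.
  apply/asboolP; split=> [i a x y Ux Uy|i w nU|].
  - rewrite !sE//; last exact: (blocks_subspace D i).2.
    rewrite -PhiL; [|exact: dual_zapp|exact: dual_zapp]; congr Phi.
    by apply/funext => z; have [zl _ _] := zspaceP z; rewrite zl.
  - by rewrite /s asboolF.
  exists `|C| => u n Ku.
  have -> : zpair n s u = Phi (fun z => zpair n z u : R^o).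
    elim: n => [|n IH].
      rewrite /zpair big_geq//; rewrite -Phi0; congr Phi.
      by apply/funext => z; rewrite big_geq.
    rewrite /zpair big_nat_recr//= -/(zpair n s u) IH sE; last exact: body_blocks.
    rewrite -[Phi (fun z => zpair n z u : R^o)]mul1r -PhiL; first last.
    - exact/dual_zapp/body_blocks.
    - exact: dual_zpair.
    congr Phi; apply/funext => z; rewrite scale1r big_nat_recr//.
  apply: le_trans (PhiC _ (dual_zpair n Ku)) _.
  have dn : dual_norm (fun z => zpair n z u : R^o) <= 1.
    apply: dual_norm_le (dual_zpair n Ku).1 => z z1.
    by apply: le_trans (ler_norm _) _; apply: le_trans (zpair_le _ _ Ku) z1.
  have := dual_norm_ge0 (dual_zpair n Ku) => dn0.
  apply: (@le_trans _ _ (`|C| * dual_norm (fun z => zpair n z u : R^o))).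
    by rewrite ler_wpM2r// ler_norm.
  by rewrite ler_piMr.
exists (ZSpace sP) => f fd; set S := ZSpace sP.
(* On one block a functional is evaluation at a vector of [blocks D j], where the value of [Phi] is
   known through [s]. *)
have fcomp j : exists w, blocks D j w /\ forall z, f (zcomp j z) = z j w.
  have [t [tP tE]] := zblock_frame D j.
  have fsum (r : seq (W * Z)) (z : Z) : f (\sum_(g <- r) z j g.1 *: g.2) =
      \sum_(g <- r) z j g.1 * f g.2.
    elim: r => [|g r IH]; first by rewrite !big_nil -(scale0r 0) linear_scale ?mul0r//; case: fd.
    by rewrite !big_cons fd.1 IH.
  suff H : forall r : seq (W * Z), (forall g, g \in r -> blocks D j g.1) ->
      exists w, blocks D j w /\ forall z, \sum_(g <- r) z j g.1 * f g.2 = z j w.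
    have [w [Uw wE]] := H t (fun g gt => (tP g gt).1).
    by exists w; split=> // z; rewrite tE fsum.
  elim=> [|g r IH] rU.
    exists 0; split; first exact: (blocks_subspace D j).1.
    by move=> z; rewrite big_nil zapp0.
  have [|w [Uw wE]] := IH; first by move=> h hr; apply: rU; rewrite in_cons hr orbT.
  have Ug := rU g (mem_head _ _).
  exists (f g.2 *: g.1 + w); split; first exact: (blocks_subspace D j).2.
  by move=> z; rewrite big_cons wE; have [zl _ _] := zspaceP z; rewrite zl// mulrC.
have Phitrunc n : Phi (fun z => f (ztrunc n z)) = f (ztrunc n S).
  elim: n => [|n IH].
    have t0 z : ztrunc 0 z = 0 by apply: zspace_eq => i w; rewrite ztruncE.
    have f0 : f 0 = 0 by rewrite -(scale0r 0) linear_scale ?mul0r//; case: fd.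
    by rewrite t0 f0 -Phi0; congr Phi; apply/funext => z; rewrite t0 f0.
  have [w [Uw wE]] := fcomp n.
  have tS z : ztrunc n.+1 z = 1 *: ztrunc n z + zcomp n z.
    by rewrite scale1r /zcomp addrC subrK.
  rewrite tS fd.1 wE -IH -[S n w]/(s n w) sE// scale1r.
  rewrite -[Phi (fun z => f (ztrunc n z))]mul1r -PhiL; [|exact: dual_trunc|exact: dual_zapp].
  by congr Phi; apply/funext => z; rewrite tS fd.1 wE.
apply/eqP; rewrite -subr_eq0 -normr_le0.
have h n : `|Phi f - f S| <= `|C| * dual_norm (fun z => f (z - ztrunc n z)) +
    `|f (S - ztrunc n S) : R|.
  have -> : Phi f = Phi (fun z => f (ztrunc n z)) + Phi (fun z => f (z - ztrunc n z)).
    rewrite -[Phi (fun z => f (ztrunc n z))]mul1r -PhiL; [|exact: dual_trunc|exact: dual_tail].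
    congr Phi; apply/funext => z.
    by rewrite -[RHS]/(1 *: f (ztrunc n z) + f (z - ztrunc n z)) -fd.1 scale1r addrC subrK.
  rewrite Phitrunc (linear_sub _ _ fd.1).
  set a := f (ztrunc n S); set b := f S; set c := Phi _.
  have -> : a + c - b = c - (b - a) by rewrite opprB [a + c]addrC -addrA.
  apply: le_trans (ler_normB _ _) _; rewrite lerD2r.
  apply: le_trans (PhiC _ (dual_tail n fd)) _.
  by rewrite ler_wpM2r ?ler_norm//; apply/dual_norm_ge0/dual_tail.
have l1 : (fun n => `|C| * dual_norm (fun z => f (z - ztrunc n z)) +
    `|f (S - ztrunc n S) : R|) @ \oo --> `|C| * 0 + `|0 : R|.
  apply: cvgD; first by apply: cvgM; [exact: cvg_cst|exact: dual_tail_cvg0].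
  apply: cvg_norm; have <- : f 0 = 0.
    by rewrite -(scale0r 0) linear_scale ?mul0r//; case: fd.
  have h0 : (fun n => S - ztrunc n S) @ \oo --> (0 : Z).
    by rewrite -(subrr S); apply: cvgB; [exact: cvg_cst|exact: ztrunc_cvg].
  exact: (cvg_comp _ _ h0 (fd.2 0)).
rewrite mulr0 normr0 addr0 in l1.
by apply: (cvgr_to_ge l1); apply: nearW.
Qed.

End SequenceSpaceReflexive.

(** * The embedding *)

Section Embedding.
Variables (R : realType) (X W : lmodType R) (B : X -> W -> R).
Variables (NX : X -> R) (NW : W -> R).
Hypotheses (PB : pairing B) (SX : seminorm NX) (SW : seminorm NW).
Hypothesis NW0 : forall w, NW w = 0 -> w = 0.
Hypothesis sepX : forall x, (forall w, B x w = 0) -> x = 0.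
Hypothesis sepW : forall w, (forall x, B x w = 0) -> w = 0.
Variables (cB c0 delta : R).
Hypotheses (cB_ge0 : 0 <= cB) (B_le : forall x w, `|B x w| <= cB * NX x * NW w).
Hypotheses (c0_gt0 : 0 < c0)
  (normingW : forall x, exists2 w, NW w <= 1 & c0 * NX x <= B x w).
Hypothesis delta01 : 0 < delta <= 1.
Notation B' := (flip_pairing B).
Hypotheses (compX : weakly_compact_ball B NX) (compW : weakly_compact_ball B' NW).
Hypotheses (growX : asymptotic_growth B NX delta) (growW : asymptotic_growth B' NW delta).
Variable xs : nat -> X.
Hypothesis xs_dense : forall x e, 0 < e -> exists n, NX (x - xs n) < e.

Let PB' : pairing B' := pairing_flip PB.
Let e (m : nat) : R := (delta / 16) ^+ m.

Let e_gt0 m : 0 < e m.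
Proof. by case/andP: delta01 => d0 _; rewrite exprn_gt0// divr_gt0. Qed.

Let delta16 : 0 <= delta / 16 <= 1.
Proof. by case/andP: delta01 => d0 d1; apply/andP; split; lra. Qed.

Let e_le1 m : e m <= 1.
Proof. by case/andP: delta16 => h0 h1; rewrite exprn_ile1. Qed.

Let e_decr i j : (i < j)%N -> e j <= delta / 16 * e i.
Proof.
case/andP: delta16 => h0 h1 ij; rewrite /e -exprS.
exact: ler_wiXn2l.
Qed.

(* [st m] and [mid m] alternate: passing from [st m] to [mid m] serves the
   decompositions in [W], passing from [mid m] to [st m.+1] those in [X]. *)
Lemma skeleton : exists (st mid : nat -> seq X * seq W), [/\ st 0%N = ([::], [::]),
  forall m, {subset (st m).1 <= (mid m).1} /\ {subset (st m).2 <= (mid m).2},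
  forall m, {subset (mid m).1 <= (st m.+1).1} /\ {subset (mid m).2 <= (st m.+1).2},
  forall m, xs m \in (st m.+1).1 &
  forall m, step_property B' NW delta (e m.+1) (st m).2 (mid m).2 (st m).1 (mid m).1 /\
    step_property B NX delta (e m.+1) (mid m).1 (st m.+1).1 (mid m).2 (st m.+1).2].
Proof.
have next (p : nat * (seq X * seq W)) : exists q : (seq X * seq W) * (seq X * seq W),
   [/\ {subset p.2.1 <= q.1.1} /\ {subset p.2.2 <= q.1.2},
     {subset q.1.1 <= q.2.1} /\ {subset q.1.2 <= q.2.2}, xs p.1 \in q.1.1,
     step_property B' NW delta (e p.1.+1) p.2.2 q.1.2 p.2.1 q.1.1 &
     step_property B NX delta (e p.1.+1) q.1.1 q.2.1 q.1.2 q.2.2].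
  case: p => m [F G] /=.
  have [G1 [F1 [GG1 FF1 st1]]] := step_exists PB' SW compW sepX growW G (xs m :: F) (e_gt0 m.+1).
  have [F2 [G2 [FF2 GG2 st2]]] := step_exists PB SX compX sepW growX F1 G1 (e_gt0 m.+1).
  exists ((F1, G1), (F2, G2)); split=> //=.
  - by split=> // x xF; apply: FF1; rewrite in_cons xF orbT.
  - by apply: FF1; rewrite mem_head.
  move=> a /st1[h [h1 h2 h3 h4]]; exists h; split=> //.
  by apply: annih_sub h2 => x xF; rewrite in_cons xF orbT.
have [f fP] := choice next.
pose st := fix st m := if m is m'.+1 then (f (m', st m')).2 else ([::], [::]).
exists st, (fun m => (f (m, st m)).1); split=> // m; have [h1 h2 h3 h4 h5] := fP (m, st m) => //.
by have [h _] := h2; exact: h.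
Qed.

(** The last clause prepares the renorming: vectors whose image starts after coordinate [n] form a
    set that contains the annihilator of a finite list. *)
Lemma embedding_exists : exists (D : norming_data W) (T : {linear X -> zspace D}),
  [/\ (0 < expo D)%N, exists c C : R, [/\ 0 < c, 0 < C &
        forall x, c * NX x <= `|T x| <= C * NX x] &
      forall n, exists L : seq W, forall x, annih B L x -> ztrunc n (T x) = 0].
Proof.
have [st [mid [st0 st_mid mid_st xs_st steps]]] := skeleton.
have [n0 n0P] := chain_variation delta01.
pose k := maxn n0 1; have k0 : (0 < k)%N by rewrite leq_max orbT.
have [C0 C00 CP] : exists2 C0 : R, 0 <= C0 & _ := n0P k.+1 (leq_trans (leq_maxl _ _) (leqnSn _)).
(* Approximants have norm at most 2, so distances are at most 4; errors are at most 1. The summand 1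
   ensures [1 <= V]. *)
pose V := C0 * 5 ^+ k.+1 + 1.
have V0 : 0 < V by rewrite ltr_wpDl// mulr_ge0// exprn_ge0.
have var (A : lmodType R) (N : A -> R) (h : nat -> A) : seminorm N ->
    (forall m, N (h m) <= 2) -> growing N delta e h ->
    forall a s, path leq a s -> chain_sum (fun i j => N (h j - h i) ^+ k.+1) a s <= V.
  move=> SN h2 hg a s ps.
  have h4 i j : N (h j - h i) <= 4.
    apply: le_trans (SN.1 _ _) _; rewrite seminormN//.
    by have := h2 i; have := h2 j; lra.
  have := CP (fun i j => N (h j - h i)) e _ _ e_gt0 e_decr hg a s 4 ps (fun i j _ _ => h4 i j).
  move=> /(_ _ _)/le_trans; apply.
  - by move=> i; rewrite subrr seminorm0.
  - by move=> c i j; rewrite (seminormB SN (h i) (h c)) [leRHS]addrC; exact: seminorm_subD.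
  rewrite /V -[leLHS]addr0 lerD// ler_wpM2l// lerXn2r ?nnegrE//.
    by have := e_gt0 a; lra.
  by have := e_le1 a; lra.
(* Made to contain [h m.+1 - h m] for approximants [h] of [w]: this difference annihilates
   [(st m.-1).1] because [w - h m] and [w - h m.+1] do. For [m = 0] that list is empty. *)
pose U m := lspan (mid m).2 `&` annih B' (st m.-1).1.
have US m : subspace (U m).
  by apply: subspaceI; [exact: lspan_subspace|exact: annih_subspace].
have st_mono m n : (m <= n)%N -> {subset (st m).1 <= (st n).1}.
  move/subnK <-; elim: (n - m)%N => //= d IH x /IH xs'.
  by apply: (mid_st _).1; exact: (st_mid _).1.
have mid_mono m n : (m <= n)%N -> {subset (mid m).2 <= (mid n).2}.
  move/subnK <-; elim: (n - m)%N => //= d IH x /IH xs'.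
  by apply: (st_mid _).2; exact: (mid_st _).2.
have frame i : exists2 t : seq (W * (W -> R)),
    (forall f, f \in t -> [/\ U i f.1,
      forall a x y, f.2 (a *: x + y) = a * f.2 x + f.2 y &
      exists M, forall u, norming_body NW U k u -> `|f.2 (u i)| <= M]) &
    forall w, U i w -> w = \sum_(f <- t) f.2 w *: f.1.
  have [s sU UE] := subspace_lspan (US i) (@subIsetl _ _ _).
  have [t ts tr] := reproducing_system PB' s sepW.
  exists [seq (f.1, B f.2) | f <- t].
    move=> _ /mapP[f ft ->] /=; split; first by rewrite UE; exact: ts.
      by move=> a x y; exact: PB.2.
    exists (cB * NX f.2) => u Ku; apply: le_trans (B_le _ _) _.
    rewrite ler_piMr ?mulr_ge0 ?seminorm_ge0//.
    exact: norming_body_le1 Ku.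
  by move=> w; rewrite {1}UE big_map => /tr.
pose D := NormingData US
  (fun u i => @norming_body_sub R W NW U k US u i)
  (norming_body0 k SW US) (fun u => @norming_bodyN R W NW U k SW US u)
  (fun c u => @norming_body_trunc R W NW U k SW US c u)
  (fun i w => @norming_body_single R W NW U k SW US i w)
  (fun c s t u v => @norming_splice R W NW U k c s t u v)
  (fun c u Ku => @norming_body_split R W NW U k SW NW0 US k0 u c Ku)
  frame.
have decX x : NX x <= 1 -> exists z : nat -> X, [/\ z 0%N = 0,
    forall m, lspan (st m.+1).1 (z m.+1), forall m, annih B (mid m).2 (x - z m.+1),
    forall m, NX (z m) <= 2 & growing NX delta e z].
  apply: (@decomposition _ _ _ B NX SX delta e (fun m => (mid m).1) (fun m => (st m.+1).1)
    (fun m => (mid m).2) (fun m => (st m.+1).2)) => //.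
  - by move=> m; case: (mid_st m).
  - by move=> m; case: (st_mid m.+1).
  - by move=> m; case: (mid_st m).
  - by move=> m; case: (st_mid m.+1).
  - by move=> m; case: (steps m).
have decW w : NW w <= 1 -> exists h : nat -> W, [/\ h 0%N = 0,
    forall m, lspan (mid m).2 (h m.+1), forall m, annih B' (st m).1 (w - h m.+1),
    forall m, NW (h m) <= 2 & growing NW delta e h].
  apply: (@decomposition _ _ _ B' NW SW delta e (fun m => (st m).2) (fun m => (mid m).2)
    (fun m => (st m).1) (fun m => (mid m).1)) => //.
  - by move=> m; case: (st_mid m).
  - by move=> m; case: (mid_st m).
  - by move=> m; case: (st_mid m).
  - by move=> m; case: (mid_st m).
  - by move=> m; case: (steps m).
have [C C_gt0 Cbound] : exists2 C : R, 0 < C & forall x u n, NX x <= 1 -> body D u ->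
    `|\sum_(0 <= i < n) B x (u i)| <= C.
  pose M := cB ^+ k.+1 * 2 ^+ k.+1.
  have M0 : 0 <= M by rewrite mulr_ge0 ?exprn_ge0.
  have [C Cpos CE] := root_exists (ltn0Sn k) (addr_ge0 (mulr_ge0 M0 (ltW V0)) (mulr_ge0 M0 (ltW V0))).
  exists (C + 1) => [|x u n x1 Ku]; first by rewrite ltr_wpDl.
  suff : `|\sum_(0 <= i < n) B x (u i)| <= C by move/le_trans; apply; rewrite lerDl.
  have [z [z0 zs za z2 zg]] := decX x x1.
  pose d i j := NX (z j - z i).
  have d0 i j : 0 <= d i j ^+ k.+1 by rewrite exprn_ge0// seminorm_ge0.
  have [||v a b [Uv Vv] ab|s [ps _ sb]] := @norming_body_bound R W NW U k
      (fun _ w => B x w) (fun i j => M * d i j ^+ k.+1) (fun i => M * d i.-1 i ^+ k.+1)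
      _ _ _ u Ku 0%N n (leq0n n).
  - by move=> _ c w; exact: pairingZr.
  - by move=> i; rewrite mulr_ge0.
  - pose S := block_sum v a b.
    have S1 : NW S <= 1.
      have := Vv a [:: b]; rewrite /= (ltnW ab) /block_variation /= addr0 => /(_ isT).
      by rewrite expr_le1// seminorm_ge0.
    (* Between [a] and [b] the vector [x] may be replaced by an increment of its approximants, as
       [v i] is orthogonal to [x - z b] and to [z a.-1]. The index [a.-1] reflects the one in [U];
       the extra increment is what [g] pays for. *)
    have -> : \sum_(a <= i < b) B x (v i) = B (z b - z a.-1) S.
      rewrite /S /block_sum (pairing_sumr PB); apply: eq_big_nat => i /andP[ai ib].
      apply/eqP; rewrite -subr_eq0 -(pairingBl PB) opprB addrA addrAC.
      have [v1 v2] := Uv i.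
      rewrite (pairingDl PB) (_ : B (x - z b) (v i) = 0) ?add0r; last first.
        case: b ib {ab S S1} => // b ib; apply: annih_lspan (za b) _ => //.
        by apply: lspanS v1; apply: mid_mono.
      case: a ai {ab S S1} => [|[|a]] ai /=; rewrite ?z0 ?pairing0l//.
      have zv : annih B' (st a.+1).1 (v i).
        by apply: annih_sub v2; apply: st_mono; move: ai; case: i {v1 ib}.
      by apply/eqP; exact: (annih_lspan PB' zv (zs a)).
    have h : `|B (z b - z a.-1) S| <= cB * (d a.-1 a + d a b).
      apply: le_trans (B_le _ _) _; apply: (@le_trans _ _ (cB * NX (z b - z a.-1))).
        by rewrite ler_piMr// mulr_ge0// seminorm_ge0.
      by rewrite ler_wpM2l// [leRHS]addrC; exact: seminorm_subD.
    apply: (@le_trans _ _ ((cB * (d a.-1 a + d a b)) ^+ k.+1)).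
      by rewrite lerXn2r ?nnegrE// mulr_ge0// addr_ge0 ?seminorm_ge0.
    rewrite exprMn -mulrDr /M -mulrA ler_wpM2l ?exprn_ge0//.
    by apply: exprD_le; exact: seminorm_ge0.
  rewrite -(@ler_pXn2r _ k.+1) ?nnegrE// CE; apply: le_trans sb _; apply: lerD.
    rewrite -mulr_sumr ler_wpM2l//.
    (* The look-back terms form the variation along consecutive indices; the one at 0 vanishes since
       [0.-1 = 0]. *)
    case: n => [|n]; first by rewrite big_geq// ltW.
    rewrite big_nat_recl// /= {1}/d subrr seminorm0// expr0n add0r.
    have -> : \sum_(0 <= i < n) d i i.+1 ^+ k.+1 =
        chain_sum (fun i j => d i j ^+ k.+1) 0 (iota 1 n).
      by rewrite chain_sum_iota add0n.
    by apply: var => //; have := iota_sorted 0 n.+1.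
  by rewrite chain_sumZ ler_wpM2l//; exact: var.
have bound x u n : body D u -> `|\sum_(0 <= i < n) B x (u i)| <= C * NX x.
  move=> Ku; have [x0|/eqP x0] := pselect (NX x = 0).
    rewrite big1 ?normr0 ?x0 ?mulr0// => i _; apply/eqP; rewrite -normr_le0.
    by apply: le_trans (B_le _ _) _; rewrite x0 mulr0 mul0r.
  have x_gt0 : 0 < NX x by rewrite lt0r x0 seminorm_ge0.
  have y1 : NX ((NX x)^-1 *: x) <= 1 by rewrite SX.2 gtr0_norm ?invr_gt0// mulVf.
  have := Cbound _ u n y1 Ku.
  under eq_bigr do rewrite (pairingZl PB).
  by rewrite -mulr_sumr normrM gtr0_norm ?invr_gt0// ler_pdivrMl// mulrC.
have TP x : ((fun i w => if `[< U i w >] then B x w else 0) : nat -> W -> R^o) \in zpred D.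
  apply/asboolP; split=> [i a v w Uv Uw|i w nU|].
  - by rewrite !asboolT//; [exact: PB.2|exact: (US i).2].
  - by rewrite asboolF.
  exists (C * NX x) => u n Ku; apply: le_trans (bound x u n Ku).
  rewrite /zpair; under eq_bigr => i _ do rewrite (asboolT (norming_body_sub US i Ku)).
  exact: lexx.
pose Tf x : zspace D := ZSpace (TP x).
have TfE x i w : U i w -> Tf x i w = B x w.
  by move=> Uw; rewrite -[LHS]/(if `[< U i w >] then B x w else 0) asboolT.
have Tflin : linear Tf.
  move=> a x y; apply: zspace_eq => i w; rewrite zvalDZ.
  rewrite -!/((if `[< U i w >] then B _ w else 0)).
  rewrite -[LHS]/(if `[< U i w >] then B (a *: x + y) w else 0).
  rewrite -[Tf x i w]/(if `[< U i w >] then B x w else 0).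
  rewrite -[Tf y i w]/(if `[< U i w >] then B y w else 0).
  by case: ifP => _; [exact: PB.1|rewrite mulr0 addr0].
pose Tlin := GRing.isLinear.Build R X (zspace D) *:%R Tf Tflin.
pose T : {linear X -> zspace D} := HB.pack Tf Tlin.
have TpairE n x u : body D u -> zpair n (T x) u = \sum_(0 <= i < n) B x (u i).
  by move=> Ku; apply: eq_bigr => i _; apply: TfE; exact: (norming_body_sub US i Ku).
exists D, T; split=> //.
  have V1 : 1 <= V by rewrite /V lerDr mulr_ge0// exprn_ge0.
  have [r r0 rE] := root_exists (ltn0Sn k) (ltW V0).
  have r_gt0 : 0 < r by rewrite lt0r r0 andbT; apply: contraPneq rE => ->; rewrite expr0n /=; lra.
  exists (r^-1 * c0), C; split=> // [|x]; first by rewrite mulr_gt0// invr_gt0.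
  apply/andP; split; last first.
    rewrite znormE; apply: znorm_le => n u Ku; rewrite TpairE//.
    exact: le_trans (ler_norm _) (bound _ _ _ Ku).
  have [w w1 wx] := normingW x.
  have [h [h0 hs ha h2 hg]] := decW w w1.
  (* Scaled increments of the approximants of a norming functional form a test sequence of variation
     at most one, and its pairing with [x] telescopes to [r^-1 * B x (h n)]. *)
  pose u m := r^-1 *: (h m.+1 - h m).
  have Ku : body D u.
    apply: norming_base; split=> [m|a s ps].
      apply: subspaceZ => //; split.
        apply: subspaceB; [exact: lspan_subspace|exact: hs|].
        case: m => [|m]; first by rewrite h0; case: (lspan_subspace (mid 0%N).2).
        by apply: lspanS (hs m); apply: mid_mono.
      have -> : h m.+1 - h m = (w - h m) - (w - h m.+1).
        by rewrite [- (w - h m.+1)]opprB [RHS]addrC addrA subrK.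
      apply: (@subspaceB _ _ (annih B' (st m.-1).1)).
      - exact: annih_subspace.
      - case: m => [|m] /=; first by rewrite st0.
        exact: ha.
      - by apply: annih_sub (ha m); apply: st_mono; exact: leq_pred.
    have sumE i j : (i <= j)%N -> block_sum u i j = r^-1 *: (h j - h i).
      by move=> ij; rewrite /block_sum -scaler_sumr telescope_sumr.
    apply: (@le_trans _ _ (r^-1 ^+ k.+1 * chain_sum (fun i j => NW (h j - h i) ^+ k.+1) a s)).
      rewrite -chain_sumZ; apply: ler_chain_sum => i j.
      have [ij|ji] := leqP i j.
        by rewrite sumE// SW.2 exprMn ger0_norm// invr_ge0.
      rewrite /block_sum big_geq ?(ltnW ji)// seminorm0// expr0n /=.
      by rewrite mulr_ge0 ?exprn_ge0 ?invr_ge0 ?seminorm_ge0.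
    by rewrite exprVn rE ler_pdivrMl// mulr1; exact: var.
  have hx n : r^-1 * B x (h n) <= `|T x|.
    apply: le_trans (zpair_le n _ Ku); apply: le_trans (ler_norm _); rewrite TpairE//.
    under eq_bigr do rewrite (pairingZr PB).
    by rewrite -mulr_sumr -(pairing_sumr PB) telescope_sumr// h0 subr0.
  rewrite -mulrA ler_pdivrMl//; apply: le_trans wx _; apply/ler_addgt0Pr => eta eta0.
  have eta1 : 0 < eta / (cB * 3 + 1) by rewrite divr_gt0// ltr_wpDl// mulr_ge0.
  (* [xs n] lies in [(st n.+1).1], which [w - h n.+2] annihilates; 3 bounds the norm of that
     difference. *)
  have [n xn] := xs_dense x eta1.
  have e1 : B x (w - h n.+2) <= eta.
    have h1 : B (xs n) (w - h n.+2) = 0 by apply: (ha n.+1); exact: xs_st.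
    have -> : B x (w - h n.+2) = B (x - xs n) (w - h n.+2).
      by rewrite (pairingBl PB) h1 subr0.
    apply: le_trans (ler_norm _) _; apply: le_trans (B_le _ _) _.
    have n3 : NW (w - h n.+2) <= 3.
      apply: le_trans (SW.1 _ _) _; rewrite seminormN//; have := h2 n.+2; lra.
    apply: (@le_trans _ _ (cB * NX (x - xs n) * 3)).
      by rewrite ler_wpM2l// mulr_ge0// seminorm_ge0.
    rewrite mulrAC; rewrite ltr_pdivlMr in xn; last by rewrite ltr_wpDl// mulr_ge0.
    apply: le_trans (ltW xn); rewrite mulrC ler_wpM2l ?seminorm_ge0//.
    by rewrite lerDl.
  have := hx n.+2; rewrite ler_pdivrMl// => h3.
  by rewrite (pairingBr PB) in e1; lra.
move=> n; exists (flatten [seq (mid i).2 | i <- iota 0 n]) => x xL.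
apply: zspace_eq => i w; rewrite ztruncE; case: ifP => // ni.
rewrite -[LHS]/(if `[< U i w >] then B x w else 0); case: asboolP => // -[mw _].
apply: annih_lspan mw => // v vi; apply: xL; apply/flatten_mapP.
by exists i => //; rewrite mem_iota.
Qed.

End Embedding.

(** * Hahn-Banach, duality and weak compactness *)

Section HahnBanach.
Variables (R : realType) (V : lmodType R).
Implicit Types (p q : V -> R).

Definition sublinear p : Prop :=
  (forall x y, p (x + y) <= p x + p y) /\ (forall a x, 0 <= a -> p (a *: x) = a * p x).

Lemma sublinear0 p : sublinear p -> p 0 = 0.
Proof. by move=> [_ pZ]; have := pZ 0 0 (lexx _); rewrite scale0r mul0r. Qed.

Lemma sublinear_opp p x : sublinear p -> - p (- x) <= p x.
Proof.
move=> sp; have := sp.1 x (- x); rewrite subrr sublinear0// => h.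
by rewrite lerNl -subr_ge0 opprK addrC.
Qed.

Let slice q x0 x := [set q (x + t *: x0) - t * q x0 | t in [set t | 0 <= t]].

Let slice_lb q x0 x : sublinear q -> lbound (slice q x0 x) (- q (- x)).
Proof.
move=> sq _ [t /= t0 <-]; have := sq.1 (x + t *: x0) (- x).
by rewrite addrAC subrr add0r sq.2// => h; lra.
Qed.

(* Tilting a sublinear functional in the direction [x0] makes it odd along [x0];
   a minimal sublinear functional is therefore linear. *)
Lemma sublinear_tilt q x0 : sublinear q -> exists q', [/\ sublinear q',
  forall x, q' x <= q x & q' (- x0) <= - q x0].
Proof.
move=> sq; pose q' x := inf (slice q x0 x).
have S0 x : slice q x0 x !=set0 by exists (q (x + 0 *: x0) - 0 * q x0), 0 => /=.
have lbS x : has_lbound (slice q x0 x) by exists (- q (- x)); exact: slice_lb.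
have q'le x t : 0 <= t -> q' x <= q (x + t *: x0) - t * q x0.
  by move=> t0; apply: ge_inf => //; exists t.
exists q'; split; [split| |].
- move=> x y; rewrite -lerBlDr; apply: lb_le_inf => // _ [t /= t0 <-].
  rewrite lerBlDr -lerBlDl; apply: lb_le_inf => // _ [s /= s0 <-].
  rewrite lerBlDl; apply: le_trans (q'le _ (t + s) (addr_ge0 t0 s0)) _.
  have := sq.1 (x + t *: x0) (y + s *: x0); rewrite addrACA -scalerDl; lra.
- have scale_le a x : 0 < a -> q' (a *: x) <= a * q' x.
    move=> a0; rewrite -ler_pdivrMl//; apply: lb_le_inf => // _ [t /= t0 <-].
    rewrite ler_pdivrMl//; apply: le_trans (q'le _ (a * t) _) _.
      by rewrite mulr_ge0// ltW.
    by rewrite -scalerA -scalerDr (sq.2 _ _ (ltW a0)) mulrBr -mulrA.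
  move=> a x; rewrite le_eqVlt => /orP[/eqP <-|a0].
    rewrite scale0r mul0r; apply/eqP; rewrite eq_le; apply/andP; split.
      by have := q'le 0 0 (lexx _); rewrite scale0r mul0r addr0 subr0 (sublinear0 sq).
    by apply: lb_le_inf => // _ [t /= t0 <-]; rewrite add0r sq.2// subrr.
  apply/eqP; rewrite eq_le scale_le//= -ler_pdivlMl//.
  have := scale_le a^-1 (a *: x); rewrite scalerA mulVf ?gt_eqF// scale1r.
  by apply; rewrite invr_gt0.
- by move=> x; have := q'le x 0 (lexx _); rewrite scale0r mul0r addr0 subr0.
by have := q'le (- x0) 1 ler01; rewrite scale1r addNr sublinear0// mul1r sub0r.
Qed.

(** After a tilt at [x0], every linear functional below [p1] that is also below [p] must equal
    [p x0] at [x0]. Zorn gives a minimal sublinear functional; by minimality all further tilts are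
    trivial, so it is odd, hence linear. *)
Lemma hahn_banach p x0 : sublinear p -> exists f : V -> R,
  [/\ forall a x y, f (a *: x + y) = a * f x + f y,
      forall x, f x <= p x & f x0 = p x0].
Proof.
move=> sp; have [p1 [sp1 p1p p1x0]] := sublinear_tilt x0 sp.
pose T := {q : V -> R | sublinear q /\ forall x, q x <= p1 x}.
(* The order is reversed, so that a maximal element is a minimal functional. *)
pose ord : rel T := fun q1 q2 : T => `[< forall x, sval q2 x <= sval q1 x >].
have tlb (q : T) x : - p1 (- x) <= sval q x.
  case: q => q [sq qp] /=; apply: le_trans (sublinear_opp x sq).
  by rewrite lerN2.
have [||||[q [sq qp]] qmin] := @Zorn T ord.
- by move=> q; apply/asboolP.
- move=> q1 q2 q3 /asboolP h1 /asboolP h2; apply/asboolP => x.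
  exact: le_trans (h2 x) (h1 x).
- move=> [q1 h1] [q2 h2] /asboolP /= le21 /asboolP /= le12; apply: eq_exist.
  by apply/funext => x; apply/eqP; rewrite eq_le le12 le21.
- move=> A Atot; have [[a0 Aa0]|An] := pselect (A !=set0); last first.
    have h1 : sublinear p1 /\ forall x, p1 x <= p1 x by split.
    by exists (exist _ p1 h1) => s As; exfalso; apply: An; exists s.
  pose S x := [set sval (q : T) x | q in A].
  have Sn x : S x !=set0 by exists (sval a0 x), a0.
  have lbS x : has_lbound (S x) by exists (- p1 (- x)) => _ [q _ <-].
  pose m x := inf (S x).
  have mle (q : T) x : A q -> m x <= sval q x by move=> Aq; apply: ge_inf => //; exists q.
  have sm : sublinear m.
    have scale_le a x : 0 < a -> m (a *: x) <= a * m x.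
      move=> a_gt0; rewrite -ler_pdivrMl//; apply: lb_le_inf => // _ [q Aq <-].
      rewrite ler_pdivrMl//; apply: le_trans (mle q _ Aq) _.
      by rewrite ((svalP q).1.2 _ _ (ltW a_gt0)).
    split=> [x y|a x].
      rewrite -lerBlDr; apply: lb_le_inf => // _ [q Aq <-].
      rewrite lerBlDr -lerBlDl; apply: lb_le_inf => // _ [q' Aq' <-].
      rewrite lerBlDl; have [/asboolP qq|/asboolP qq] := Atot _ _ Aq Aq'.
        apply: le_trans (mle q' _ Aq') _; apply: le_trans ((svalP q').1.1 x y) _.
        by rewrite lerD.
      apply: le_trans (mle q _ Aq) _; apply: le_trans ((svalP q).1.1 x y) _.
      by rewrite lerD.
    rewrite le_eqVlt => /orP[/eqP <-|a_gt0].
      rewrite scale0r mul0r; apply/eqP; rewrite eq_le; apply/andP; split.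
        by have := mle _ 0 Aa0; rewrite (sublinear0 (svalP a0).1).
      by apply: lb_le_inf => // _ [q Aq <-]; rewrite (sublinear0 (svalP q).1).
    apply/eqP; rewrite eq_le scale_le//= -ler_pdivlMl//.
    have := scale_le a^-1 (a *: x); rewrite scalerA mulVf ?gt_eqF// scale1r.
    by apply; rewrite invr_gt0.
  have mp x : m x <= p1 x by apply: le_trans (mle _ x Aa0) _; exact: (svalP a0).2.
  exists (exist _ m (conj sm mp)) => q Aq; apply/asboolP => x; exact: mle.
have qN x : q (- x) = - q x.
  have [q' [sq' q'q q'x]] := sublinear_tilt x sq.
  have q'p y : q' y <= p1 y by exact: le_trans (q'q y) (qp y).
  have /(congr1 sval) /= E := qmin (exist _ q' (conj sq' q'p)) (asboolT q'q).
  have := sublinear_opp x sq; rewrite -{1}E => h.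
  by apply/eqP; rewrite eq_le -{1}E q'x /= lerNl -{1}E.
have qD x y : q (x + y) = q x + q y.
  apply/eqP; rewrite eq_le sq.1 /=; have := sq.1 (- x) (- y).
  by rewrite -opprD !qN; lra.
have qZ a x : q (a *: x) = a * q x.
  have [a0|/ltW a0] := leP 0 a; first exact: sq.2.
  have := sq.2 (- a) x; rewrite oppr_ge0 => /(_ a0).
  by rewrite scaleNr qN mulNr => /oppr_inj.
exists q; split=> [a x y|x|]; first by rewrite qD qZ.
  exact: le_trans (qp x) (p1p x).
apply/eqP; rewrite eq_le (le_trans (qp x0))//=.
by have := le_trans (qp (- x0)) p1x0; rewrite qN lerN2.
Qed.

End HahnBanach.

(** * Weak compactness of unit balls *)

Section WeakCompactness.
Variables (R : realType) (A C : lmodType R) (B : A -> C -> R) (N : A -> R) (M : C -> R).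
Hypotheses (PB : pairing B) (B_bound : forall a c, N a <= 1 -> `|B a c| <= M c).
Hypothesis represent : forall f : C -> R,
  (forall t x y, f (t *: x + y) = t * f x + f y) -> (forall c, `|f c| <= M c) ->
  exists2 a, N a <= 1 & forall c, f c = B a c.

(** Banach-Alaoglu: without a finite cover the sets [Far s] generate a proper filter, whose image in
    a product of segments clusters by Tychonoff. The cluster point is linear, hence given by some
    [a] in the ball, which contradicts [Far [:: a]]. *)
Lemma bounded_represented_compact : weakly_compact_ball B N.
Proof.
move=> L eps eps0; apply: contrapT => nocover.
pose Far (s : seq A) := [set a | N a <= 1 /\ forall a0, a0 \in s ->
  exists2 c, c \in L a0 & eps a0 <= `|B (a - a0) c|].
pose Dom := [set s : seq A | forall a, a \in s -> N a <= 1].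
have FarP s : Dom s -> Far s !=set0.
  move=> sD; apply: contrapT => /set0P/negP; rewrite negbK => /eqP s0.
  apply: nocover; exists s => // a a1; apply: contrapT => h.
  suff : Far s a by rewrite s0.
  split=> // a0 a0s; apply: contrapT => h2; apply: h; exists a0 => // c cL.
  by rewrite ltNge; apply/negP => h3; apply: h2; exists c.
pose G := filter_from Dom Far.
have FG : Filter G.
  apply: filter_from_filter; first by exists [::].
  move=> s t sD tD; exists (s ++ t).
    by move=> a; rewrite mem_cat => /orP[/sD|/tD].
  by move=> a [a1 h]; split; split=> // a0 a0s; apply: h; rewrite mem_cat a0s ?orbT.
have PG : ProperFilter G by apply: filter_from_proper => s; exact: FarP.
pose T := prod_topology (fun _ : C => R).
pose J (a : A) : T := fun c => B a c.
have K0c := @tychonoff C (fun _ => R) (fun c => `[- M c, M c]%classic)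
  (fun c => @segment_compact R (- M c) (M c)).
have [|f [fK fcl]] := K0c (J @ G).
  exists [::] => // a [a1 _] c /=; rewrite in_itv /=.
  by rewrite -ler_norml; exact: B_bound.
have near (cs : seq C) (e : R) (s : seq A) : 0 < e -> Dom s ->
    exists2 a, Far s a & forall c, c \in cs -> `|B a c - f c| < e.
  move=> e0 sD.
  have nb : nbhs f [set g : T | forall c, c \in cs -> `|g c - f c| < e].
    elim: cs => [|c cs IH]; first by apply: filterS filterT.
    have h : nbhs f [set g : T | `|g c - f c| < e].
      have nbR : nbhs (f c : R) [set r | `|r - f c| < e].
        by apply/nbhs_ballP; exists e => // r; rewrite -ball_normE /= distrC.
      exact: (@proj_continuous C (fun _ => R) c f _ nbR).
    apply: filterS (filterI h IH) => g [h1 h2] c'.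
    by rewrite in_cons => /orP[/eqP -> //|/h2].
  have FJ : (J @ G) (J @` Far s) by exists s => // a Fa; exists a.
  have [_ [[a Fa <-] h]] := fcl _ _ FJ nb.
  by exists a.
have [a a1 fE] : exists2 a, N a <= 1 & forall c, f c = B a c.
  apply: represent => [t x y|c]; last first.
    by have := fK c; rewrite /= in_itv /= -ler_norml.
  apply/eqP; rewrite -subr_eq0 -normr_le0; apply/ler_addgt0Pr => e e0; rewrite add0r.
  have t0 : 0 < `|t| + 2 by rewrite ltr_wpDl.
  have [a _ ha] := near [:: t *: x + y; x; y] _ [::] (divr_gt0 e0 t0) (fun _ => ltac:(by [])).
  set d := e / _ in ha.
  have -> : f (t *: x + y) - (t * f x + f y) =
      t * (B a x - f x) + (B a y - f y) - (B a (t *: x + y) - f (t *: x + y)).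
    by rewrite PB.2; lra.
  have h1 := ha (t *: x + y) (mem_head _ _).
  have h2 : `|B a x - f x| < d by apply: ha; rewrite !inE eqxx orbT.
  have h3 : `|B a y - f y| < d by apply: ha; rewrite !inE eqxx !orbT.
  apply: le_trans (ler_normB _ _) _; apply: le_trans (lerD (ler_normD _ _) (lexx _)) _.
  have eE : e = d * (`|t| + 2) by rewrite /d divfK// gt_eqF.
  have h4 : `|t| * `|B a x - f x| <= `|t| * d by rewrite ler_wpM2l// ltW.
  by rewrite normrM eE; lra.
have D1 : Dom [:: a] by move=> b; rewrite inE => /eqP ->.
have [b [_ bfar] hb] := near (L a) (eps a) [:: a] (eps0 a) D1.
have [c cL] := bfar a (mem_head _ _).
by rewrite (pairingBl PB) -fE leNgt hb.
Qed.

End WeakCompactness.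

(** * The dual space and finite codimensional subspaces *)

Section DualSpace.
Variables (R : realType) (X : normedModType R).

Definition dual_pred : {pred X -> R^o} := fun f => `[< dual X f >].

Lemma dual_pred_submod : submod_closed dual_pred.
Proof.
split=> [|a f g /asboolP fd /asboolP gd]; apply/asboolP; last exact: dual_submod.
apply: (@dual_of_bound _ _ _ 0) => [a x y|x].
  by rewrite -[LHS]/(0 : R) -[RHS]/(a * 0 + 0) mulr0 addr0.
by rewrite -[(0 : X -> R^o) x]/(0 : R) normr0 mul0r.
Qed.

HB.instance Definition _ := GRing.isSubmodClosed.Build R (X -> R^o) dual_pred dual_pred_submod.

Record dual_space := DualSpace { dual_val : X -> R^o; dual_valP : dual_val \in dual_pred }.

HB.instance Definition _ := [isSub for dual_val].
HB.instance Definition _ := [Choice of dual_space by <:].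
HB.instance Definition _ := [SubChoice_isSubLmodule of dual_space by <:].

Definition eval (x : X) (w : dual_space) : R := dual_val w x.
Arguments eval : simpl never.

Lemma dual_space_dual w : dual X (dual_val w).
Proof. exact/asboolP/dual_valP. Qed.

Lemma eval_pairing : pairing eval.
Proof. by split=> [a x y w|//]; exact: (dual_space_dual w).1. Qed.

Lemma eval_sep w : (forall x, eval x w = 0) -> w = 0.
Proof. by move=> w0; apply/val_inj/funext => x; exact: w0. Qed.

Lemma dual_space_of (f : X -> R) M : (forall a x y, f (a *: x + y) = a * f x + f y) ->
  (forall x, `|f x| <= M * `|x|) -> exists w, forall x, eval x w = f x.
Proof.
move=> fl fM; have fd : (f : X -> R^o) \in dual_pred.
  by apply/asboolP; exact: (@dual_of_bound _ _ _ M).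
by exists (DualSpace fd).
Qed.

Section EquivalentNorm.
Variables (N : X -> R) (EN : equivalent_norm N).

Lemma equivalent_seminorm : seminorm N.
Proof. by case: EN => -[]. Qed.

Lemma equivalent_norm0 x : N x = 0 -> x = 0.
Proof. by case: EN => -[_ _ h] _; exact: h. Qed.

Lemma equivalent_norm_lower : exists2 c, 0 < c & forall x, c * `|x| <= N x.
Proof. by case: EN => _ [c [C [c0 _ h]]]; exists c => // x; case/andP: (h x). Qed.

Lemma equivalent_norm_upper : exists2 C, 0 < C & forall x, N x <= C * `|x|.
Proof. by case: EN => _ [c [C [_ C0 h]]]; exists C => // x; case/andP: (h x). Qed.

Let SN := equivalent_seminorm.

Definition dual_normN (w : dual_space) : R := sup [set `|eval x w| | x in [set x | N x <= 1]].

Lemma dual_normN_set w : has_ubound [set `|eval x w| | x in [set x | N x <= 1]].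
Proof.
have [M M0 wM] := dual_bound (dual_space_dual w); have [c c0 cN] := equivalent_norm_lower.
exists (M / c) => _ [x /= x1 <-]; apply: le_trans (wM x) _; rewrite ler_wpM2l//.
by rewrite -[c^-1]mul1r ler_pdivlMr// mulrC (le_trans (cN x)).
Qed.

Lemma eval_le x w : `|eval x w| <= dual_normN w * N x.
Proof.
have [x0|/eqP x0] := pselect (N x = 0).
  by rewrite (equivalent_norm0 x0) (pairing0l eval_pairing) normr0 seminorm0// mulr0.
have x_gt0 : 0 < N x by rewrite lt0r x0 seminorm_ge0.
rewrite -ler_pdivrMr//; apply: (ub_le_sup (dual_normN_set w)).
exists ((N x)^-1 *: x) => /=.
  by rewrite SN.2 gtr0_norm ?invr_gt0// mulVf.
by rewrite (pairingZl eval_pairing) normrM gtr0_norm ?invr_gt0// mulrC.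
Qed.

Lemma dual_normN_le w M : (forall x, N x <= 1 -> eval x w <= M) -> dual_normN w <= M.
Proof.
move=> wM; apply: ge_sup; first by exists `|eval 0 w|, 0 => //=; rewrite seminorm0.
move=> _ [x /= x1 <-]; rewrite ler_norml wM// andbT lerNl.
have <- : eval (- x) w = - eval x w.
  by rewrite -scaleN1r (pairingZl eval_pairing) mulN1r.
by apply: wM; rewrite seminormN.
Qed.

Lemma dual_normN_ge0 w : 0 <= dual_normN w.
Proof.
apply: le_trans (normr_ge0 (eval 0 w)) _; apply: (ub_le_sup (dual_normN_set w)).
by exists 0 => //=; rewrite seminorm0.
Qed.

Lemma dual_normN0 w : dual_normN w = 0 -> w = 0.
Proof.
move=> w0; apply: eval_sep => x; apply/eqP; rewrite -normr_le0.
by have := eval_le x w; rewrite w0 mul0r.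
Qed.

Lemma dual_normN_seminorm : seminorm dual_normN.
Proof.
have le a w : dual_normN (a *: w) <= `|a| * dual_normN w.
  apply: dual_normN_le => x x1; rewrite (pairingZr eval_pairing) (le_trans (ler_norm _))//.
  rewrite normrM ler_wpM2l// (le_trans (eval_le _ _))//.
  by rewrite ler_piMr// dual_normN_ge0.
split=> [v w|a w].
  apply: dual_normN_le => x x1; rewrite (pairingDr eval_pairing).
  apply: lerD; apply: le_trans (ler_norm _) _; apply: le_trans (eval_le _ _) _.
    by rewrite ler_piMr// dual_normN_ge0.
  by rewrite ler_piMr// dual_normN_ge0.
apply/eqP; rewrite eq_le le /=; have [->|a0] := eqVneq a 0.
  by rewrite normr0 mul0r dual_normN_ge0.
rewrite -ler_pdivlMl ?normr_gt0// -normfV.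
by rewrite -[w in leLHS]scale1r -(mulVf a0) -scalerA le.
Qed.

Lemma dual_normN_adherent w e : 0 < e -> exists2 x, N x <= 1 & dual_normN w - e < eval x w.
Proof.
move=> e0; have Sn : [set `|eval x w| | x in [set x | N x <= 1]] !=set0.
  by exists `|eval 0 w|, 0 => //=; rewrite seminorm0.
have [_ [x /= x1 <-] xw] := sup_adherent e0 (conj Sn (dual_normN_set w)).
have [w0|w0] := leP 0 (eval x w); first by exists x => //; rewrite ger0_norm in xw.
exists (- x); first by rewrite seminormN.
by rewrite -[- x]scaleN1r (pairingZl eval_pairing) mulN1r; rewrite ltr0_norm in xw.
Qed.

Lemma bounded_dual (f : X -> R) : (forall a x y, f (a *: x + y) = a * f x + f y) ->
  (forall x, f x <= N x) -> exists w, dual_normN w <= 1 /\ forall x, eval x w = f x.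
Proof.
move=> fl fN; have [C C0 NC] := equivalent_norm_upper.
have f0 : f 0 = 0.
  by apply: (addrI (f 0)); have := fl 1 0 0; rewrite scale1r addr0 mul1r addr0 => <-.
have fN' x : `|f x| <= N x.
  rewrite ler_norml fN andbT lerNl -(seminormN SN).
  have <- : f (- x) = - f x by rewrite -[- x]addr0 -scaleN1r fl f0 addr0 mulN1r.
  exact: fN.
have [w wf] := dual_space_of fl (fun x => le_trans (fN' x) (NC x)).
by exists w; split=> //; apply: dual_normN_le => x x1; rewrite wf (le_trans (fN x)).
Qed.

Lemma norming_functional x : exists2 w, dual_normN w <= 1 & eval x w = N x.
Proof.
have sN : sublinear N by split=> [y z|a y a0]; rewrite ?SN.1// SN.2 ger0_norm.
have [f [fl fN fx]] := hahn_banach x sN.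
by have [w [w1 wf]] := bounded_dual fl fN; exists w => //; rewrite wf.
Qed.

Lemma dual_ball_compact : weakly_compact_ball (flip_pairing eval) dual_normN.
Proof.
apply: (bounded_represented_compact (M := N)).
- exact: pairing_flip eval_pairing.
- move=> w x w1; apply: le_trans (eval_le x w) _; rewrite ler_piMl//.
  exact: seminorm_ge0.
- move=> f fl fN; have [w [w1 wf]] := bounded_dual fl (fun x => le_trans (ler_norm _) (fN x)).
  by exists w => // x; rewrite -wf.
Qed.

(** A bounded linear [f] on the dual, extended by 0 to all functions, is a bidual element and so a
    vector; a norming functional shows that this vector lies in the ball of [N]. *)
Lemma reflexive_ball_compact : reflexive_space X -> weakly_compact_ball eval N.
Proof.
move=> refl; apply: (bounded_represented_compact (M := dual_normN)).
- exact: eval_pairing.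
- move=> x w x1; apply: le_trans (eval_le x w) _; rewrite ler_piMr//.
  exact: dual_normN_ge0.
move=> f fl fM; have [c c0 cN] := equivalent_norm_lower.
pose Phi (g : X -> R^o) : R := if insub g is Some w then f w else 0.
have PhiE g (gd : g \in dual_pred) : Phi g = f (DualSpace gd).
  rewrite /Phi; case: insubP => [w _ wE|]; last by rewrite gd.
  by congr f; apply: val_inj.
have [|x xE] := refl Phi.
  split=> [a g h gd hd|].
    have gP : g \in dual_pred by exact/asboolP.
    have hP : h \in dual_pred by exact/asboolP.
    have ghP : a *: g + h \in dual_pred by apply/asboolP; exact: dual_submod.
    rewrite (PhiE _ gP) (PhiE _ hP) (PhiE _ ghP) -fl; congr f.
    exact: val_inj.
  exists c^-1 => g gd; have gP : g \in dual_pred by exact/asboolP.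
  rewrite (PhiE _ gP) (le_trans (fM _))//; apply: dual_normN_le => x x1.
  rewrite ler_pdivlMl// mulrC; have [x0|/eqP x0] := pselect (x = 0).
    rewrite x0 (pairing0l eval_pairing) mul0r; exact: dual_norm_ge0.
  have x_gt0 : 0 < `|x| by rewrite normr_gt0.
  have := dual_norm_ball (x := `|x|^-1 *: x) gd.
  rewrite normrZ normfV normr_id mulVf ?gt_eqF// lexx => /(_ isT) h.
  have := le_trans (ler_norm _) h.
  rewrite (linear_scale _ _ gd.1) ler_pdivrMl// => h2.
  have h3 : c * `|x| <= 1 by apply: le_trans x1.
  have g0 := dual_norm_ge0 gd.
  rewrite mulrC; apply: le_trans (ler_wpM2l (ltW c0) h2) _.
  by rewrite mulrA ler_piMl.
have xw w : f w = eval x w.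
  have wd := dual_space_dual w; rewrite /eval -(xE _ wd) (PhiE _ (dual_valP w)).
  by congr f; apply: val_inj.
exists x => //; have [w w1 <-] := norming_functional x.
by rewrite -xw (le_trans (ler_norm _))// (le_trans (fM _)).
Qed.

End EquivalentNorm.

Lemma normed_equivalent : equivalent_norm (fun x : X => `|x|).
Proof.
split; first by split=> [x y|a x|x /normr0_eq0//]; [exact: ler_normD|exact: normrZ].
by exists 1, 1; split=> // x; rewrite mul1r lexx.
Qed.

(** Hahn-Banach for the distance to [Y]: it is sublinear, zero on [Y], and positive at [x] since [Y]
    is closed. *)
Lemma separate_closed (Y : set X) x : subspace Y -> closed Y -> ~ Y x ->
  exists2 w, (forall y, Y y -> eval y w = 0) & eval x w != 0.
Proof.
move=> SY cY nYx; pose D z := [set `|z - y| | y in Y]; pose p z := inf (D z).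
have Y0 := SY.1; have D0 z : D z !=set0 by exists `|z - 0|, 0.
have lbD z : has_lbound (D z) by exists 0 => _ [y _ <-].
have ple z y : Y y -> p z <= `|z - y| by move=> Yy; apply: ge_inf => //; exists y.
have p0 z : 0 <= p z by apply: lb_le_inf => // _ [y _ <-].
have sp : sublinear p.
  split=> [u v|a z].
    rewrite -lerBlDr; apply: lb_le_inf => // _ [y Yy <-].
    rewrite lerBlDr -lerBlDl; apply: lb_le_inf => // _ [y' Yy' <-].
    rewrite lerBlDl; apply: le_trans (ple _ (y + y') _) _; first exact: subspaceD.
    by rewrite opprD addrACA ler_normD.
  have scale_le b u : 0 < b -> p (b *: u) <= b * p u.
    move=> b0; rewrite -ler_pdivrMl//; apply: lb_le_inf => // _ [y Yy <-].
    rewrite ler_pdivrMl//; apply: le_trans (ple _ (b *: y) _) _; first exact: subspaceZ.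
    by rewrite -scalerBr normrZ gtr0_norm.
  rewrite le_eqVlt => /orP[/eqP <-|a0].
    rewrite scale0r mul0r; apply/eqP; rewrite eq_le p0 andbT.
    by apply: le_trans (ple 0 0 Y0) _; rewrite subrr normr0.
  apply/eqP; rewrite eq_le scale_le//= -ler_pdivlMl//.
  have := scale_le a^-1 (a *: z); rewrite scalerA mulVf ?gt_eqF// scale1r.
  by apply; rewrite invr_gt0.
have px : 0 < p x.
  have /nbhs_ballP[r /= r0 rY] : nbhs x (~` Y) by exact: (open_nbhs_nbhs (conj (closed_openC cY) nYx)).
  apply: lt_le_trans r0 _; apply: lb_le_inf => // _ [y Yy <-].
  by rewrite leNgt; apply/negP => xy; apply: (rY y) Yy; rewrite -ball_normE.
have [f [fl fp fx]] := hahn_banach x sp.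
have [w [_ wf]] := bounded_dual normed_equivalent fl (fun z => le_trans (fp z)
  (le_trans (ple z 0 Y0) (eq_ind_r (fun u => `|u| <= `|z|) (lexx _) (subr0 z)))).
exists w => [y Yy|]; last by rewrite wf fx gt_eqF.
have py z : Y z -> p z <= 0 by move=> Yz; apply: le_trans (ple _ _ Yz) _; rewrite subrr normr0.
apply/eqP; rewrite eq_le wf (le_trans (fp y) (py _ Yy)) /= -wf.
have YN : Y (- y) by rewrite -scaleN1r; exact: subspaceZ.
have := le_trans (fp _) (py _ YN).
by rewrite -wf -scaleN1r (pairingZl eval_pairing) mulN1r oppr_le0.
Qed.

Lemma submod_subspace (Y : set X) : GRing.submod_closed [in Y] <-> subspace Y.
Proof.
split=> [[Y0 YD]|[Y0 YD]]; split.
- by rewrite -in_setE.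
- by move=> a x y /mem_set Yx /mem_set Yy; rewrite -in_setE; exact: YD.
- by rewrite inE.
- by move=> a x y; rewrite !inE; exact: YD.
Qed.

(** Functionals vanishing on [Y] are determined by their values on a finite complement, hence
    finitely generated (each point costs at most one generator); by separation their common kernel
    lies in [Y]. *)
Lemma cof_contains_annih (Y : set X) : cof X Y -> exists L : seq dual_space, annih eval L `<=` Y.
Proof.
move=> [/submod_subspace SY cY [F [n [b FE]] YF]].
pose P := [set w | forall y, Y y -> eval y w = 0].
have SP : subspace P.
  split=> [y _|a v w vP wP y Yy]; first exact: (pairing0r eval_pairing).
  by rewrite eval_pairing.2 vP// wP// mulr0 addr0.
have fin (s : seq X) : forall Q : set dual_space, subspace Q ->
    (forall w, Q w -> (forall x, x \in s -> eval x w = 0) -> w = 0) ->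
    exists t, Q `<=` lspan t.
  elim: s => [|x s IH] Q SQ Qs; first by exists [::] => w Qw; exact: Qs.
  have [||t tQ] := IH (Q `&` [set w | eval x w = 0]).
  - apply: (subspaceI SQ); split=> [|a v w /= v0 w0]; first exact: (pairing0r eval_pairing).
    by rewrite /= eval_pairing.2 v0 w0 mulr0 addr0.
  - move=> w [Qw /= xw] ws; apply: Qs => // y; rewrite in_cons => /orP[/eqP ->//|].
    exact: ws.
  have [h|/existsNP[w0 /not_implyP[Qw0 /eqP xw0]]] := pselect (forall w, Q w -> eval x w = 0).
    by exists t => w Qw; apply: tQ; split=> //; exact: h.
  exists (w0 :: t) => w Qw; exists (eval x w / eval x w0); apply: tQ; split.
    by apply: subspaceB => //; exact: subspaceZ.
  by rewrite /= (pairingBr eval_pairing) (pairingZr eval_pairing) divfK// subrr.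
have [|t tP] := fin [seq b i | i <- enum 'I_n] P SP.
  move=> w wP wb; apply: eval_sep => x; have [y [f [Yy Ff ->]]] := YF x.
  rewrite (pairingDl eval_pairing) wP// add0r; move: Ff; rewrite FE => -[c _ <-].
  rewrite (pairing_suml eval_pairing) big1// => i _.
  by rewrite (pairingZl eval_pairing) wb ?mulr0// map_f// mem_enum.
exists t => x xt; apply: contrapT => nYx.
have [w wY /eqP xw] := separate_closed SY cY nYx; apply: xw.
by apply: (annih_lspan eval_pairing xt); exact: tP.
Qed.

Lemma annih_cof (L : seq dual_space) : cof X (annih eval L).
Proof.
have SA := annih_subspace eval_pairing L.
have sepX (x : X) : (forall w, eval x w = 0) -> x = 0.
  move=> h; have [w _] := norming_functional normed_equivalent x.
  by rewrite h => /esym/normr0_eq0.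
split; first exact/submod_subspace.
  have -> : annih eval L = \bigcap_(w in [set` L]) ((dual_val w) @^-1` [set 0]).
    by apply/seteqP; split=> x xL w wL; exact: xL.
  apply: closed_bigI => w _; apply: preimage_closed; last exact: closed_eq.
  by move=> x _; exact: (dual_space_dual w).2.
have [t _ tr] := reproducing_system (pairing_flip eval_pairing) L eval_sep.
exists (range (fun c : 'I_(size t) -> R => \sum_i c i *: (nth (0, 0) t i).2)).
  by exists (size t), (fun i => (nth (0, 0) t i).2).
move=> x; pose f := \sum_(g <- t) eval x g.1 *: g.2.
exists (x - f), f; split; last by rewrite subrK.
  move=> w wL; rewrite (pairingBl eval_pairing) /f (pairing_suml eval_pairing).
  rewrite {1}(tr w (mem_lspan wL)) (pairing_sumr eval_pairing) -sumrB big1// => g _.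
  by rewrite (pairingZr eval_pairing) (pairingZl eval_pairing) mulrC subrr.
exists (fun i => eval x (nth (0, 0) t i).1) => //.
by rewrite /f (big_nth (0, 0)) big_mkord.
Qed.

End DualSpace.

(** * Growth from the asymptotic moduli *)

Section Nets.
Variables (R : realType) (A C : lmodType R) (B : A -> C -> R) (N : A -> R).
Hypotheses (PB : pairing B) (SN : seminorm N) (compN : weakly_compact_ball B N).

(** Centres given by compactness may lie outside [S]; each useful one is replaced by a nearby point
    of [S], at the price of halving [e]. *)
Lemma weak_net (S : set A) (cs : seq C) (e : R) : S `<=` [set a | N a <= 1] -> 0 < e ->
  exists2 s : seq A, (forall a, a \in s -> S a) &
    forall a, S a -> exists2 a0, a0 \in s & forall c, c \in cs -> `|B (a - a0) c| < e.
Proof.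
move=> S1 e0; have e2 : 0 < e / 2 by rewrite divr_gt0.
have [s s1 scov] := compN (fun _ => cs) (fun _ => e2).
have /choice[r rP] : forall a0, exists b, (exists2 a, S a & forall c, c \in cs -> `|B (a - a0) c| < e / 2) ->
    S b /\ forall c, c \in cs -> `|B (b - a0) c| < e / 2.
  move=> a0; have [[a Sa ha]|h] := pselect (exists2 a, S a &
    forall c, c \in cs -> `|B (a - a0) c| < e / 2); first by exists a.
  by exists 0.
exists [seq r a0 | a0 <- s & `[< S (r a0) >]].
  by move=> _ /mapP[a0 + ->]; rewrite mem_filter => /andP[/asboolP].
move=> a Sa; have [a0 a0s ha] := scov a (S1 _ Sa).
have [|Sr hr] := rP a0; first by exists a.
exists (r a0) => [|c ccs]; first by apply: map_f; rewrite mem_filter a0s asboolT.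
have -> : a - r a0 = (a - a0) - (r a0 - a0) by rewrite opprB addrA subrK.
rewrite (pairingBl PB) [e]splitr; apply: le_lt_trans (ler_normB _ _) _.
by apply: ltrD; [exact: ha|exact: hr].
Qed.

(** On a finite dimensional span the reproducing system bounds the norm by finitely many pairings,
    so a weak net is a norm net. *)
Lemma lspan_net (G : seq A) (S : set A) (e : R) :
  (forall x, (forall w, B x w = 0) -> x = 0) ->
  S `<=` [set a | N a <= 1] -> S `<=` lspan G -> 0 < e ->
  exists2 s : seq A, (forall a, a \in s -> S a) &
    forall a, S a -> exists2 a0, a0 \in s & N (a - a0) <= e.
Proof.
move=> sepB S1 SG e0; have [t _ tr] := reproducing_system PB G sepB.
have s0 : 0 <= \sum_(f <- t) N f.1 by apply: sumr_ge0 => f _; exact: seminorm_ge0.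
have s1 : 0 < 1 + \sum_(f <- t) N f.1 by rewrite ltr_pwDl.
have [s sS scov] := weak_net (map snd t) S1 (divr_gt0 e0 s1).
exists s => // a Sa; have [a0 a0s ha] := scov a Sa; exists a0 => //.
have : lspan G (a - a0).
  by apply: subspaceB; [exact: lspan_subspace|exact: SG|exact/SG/sS].
move=> /tr ->; apply: le_trans (seminorm_sum SN _ _ _) _.
apply: (@le_trans _ _ (\sum_(f <- t) e / (1 + \sum_(f <- t) N f.1) * N f.1)).
  rewrite big_seq [leRHS]big_seq; apply: ler_sum => f ft.
  rewrite SN.2 ler_wpM2r ?seminorm_ge0//; apply/ltW/ha; exact: map_f.
by rewrite -mulr_sumr mulrAC ler_pdivrMr// ler_wpM2l ?ltW// ltrDr.
Qed.

Lemma growth_of_unit (delta : R) : 0 < delta <= 1 -> (forall x, N x = 0 -> x = 0) ->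
  (forall G : seq A, exists F : seq C, forall g v, lspan G g -> annih B F v ->
    N g = 1 -> 8^-1 <= N v -> 1 + delta * N v <= N (g + v)) ->
  asymptotic_growth B N delta.
Proof.
move=> /andP[d0 d1] N0 H G; have [F FP] := H G; exists F => g v gG vF gv.
have [g0|/eqP g0] := pselect (N g = 0).
  by rewrite (N0 _ g0) seminorm0// !add0r ler_piMl// seminorm_ge0.
have g_gt0 : 0 < N g by rewrite lt0r g0 seminorm_ge0.
have sc w : N ((N g)^-1 *: w) = (N g)^-1 * N w by rewrite SN.2 gtr0_norm// invr_gt0.
have := FP ((N g)^-1 *: g) ((N g)^-1 *: v).
rewrite -scalerDr !sc mulVf// [_^-1 * N v]mulrC ler_pdivlMr// => h.
have gG' : lspan G ((N g)^-1 *: g) by apply: subspaceZ => //; exact: lspan_subspace.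
have vF' : annih B F ((N g)^-1 *: v) by apply: (subspaceZ _ (annih_subspace PB F)).
have := h gG' vF' erefl gv.
by rewrite [(N g)^-1 * _]mulrC ler_pdivlMr// mulrDl mul1r -mulrA divfK.
Qed.

End Nets.

Section Growth.
Variables (R : realType) (X : normedModType R) (N : X -> R).
Hypotheses (EN : equivalent_norm N) (reflX : reflexive_space X).
Notation W := (dual_space X).
Notation eval := (@eval R X).

Let SN := equivalent_seminorm EN.
Let compX := reflexive_ball_compact EN reflX.
Let compW := dual_ball_compact EN.
Let SW := dual_normN_seminorm EN.

Lemma eval_sepX (x : X) : (forall w, eval x w = 0) -> x = 0.
Proof.
move=> h; have [w _] := norming_functional EN x.
by rewrite h => /esym/(equivalent_norm0 EN).
Qed.

Lemma auc_growth : auc N -> exists2 delta, 0 < delta <= 1 & asymptotic_growth eval N delta.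
Proof.
move=> aucN; have t0 : 0 < 8^-1 :> R by rewrite invr_gt0.
have := aucN _ t0; rewrite /delta_bar; set I := ereal_inf _ => I0.
have [d d0 dI] : exists2 d : R, 0 < d & ((1 + d)%:E < I)%E.
  case: I I0 => [r| |]; [|by exists 1 => //; rewrite ltry|by []].
  rewrite -EFinB lte_fin subr_gt0 => r1; exists ((r - 1) / 2).
    by rewrite divr_gt0// subr_gt0.
  by rewrite lte_fin; lra.
have pt x : N x = 1 -> exists L : seq W, forall y, annih eval L y -> 8^-1 <= N y -> 1 + d <= N (x + y).
  move=> x1; have := lt_le_trans dI (ereal_inf_lbound (ex_intro2 _ _ x x1 erefl)).
  move=> /ereal_sup_gt[_ [Y Ycof <-]] dY; have [L LY] := cof_contains_annih Ycof.
  exists L => y /LY Yy y8; rewrite -lee_fin; apply: le_trans (ltW dY) _.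
  by apply: ereal_inf_lbound; exists y.
have /choice[L LP] : forall x, exists L : seq W, N x = 1 ->
    forall y, annih eval L y -> 8^-1 <= N y -> 1 + d <= N (x + y).
  by move=> x; have [/pt[L LP]|h] := pselect (N x = 1); [exists L|exists [::]].
(* For [N v <= 4] the gain [d] minus the net error [d / 2] dominates [delta * N v]; for larger [N v]
   the triangle inequality gives [N v - 1], which exceeds [1 + N v / 2]. *)
pose delta := Num.min (d / 8) 2^-1.
have dl0 : 0 < delta by rewrite lt_min divr_gt0//= invr_gt0.
have dl1 : delta <= d / 8 by rewrite ge_min lexx.
have dl2 : delta <= 2^-1 by rewrite ge_min lexx orbT.
have dl01 : 0 < delta <= 1 by rewrite dl0 /=; lra.
exists delta => //; apply: (growth_of_unit (eval_pairing X) SN) => //.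
  exact: equivalent_norm0.
move=> G; pose S := [set g | lspan G g /\ N g = 1].
have S1 : S `<=` [set a | N a <= 1] by move=> g [_ /= ->].
have SG : S `<=` lspan G by move=> g [].
have d2 : 0 < d / 2 by rewrite divr_gt0.
have [s sS snet] := lspan_net (eval_pairing X) SN compX eval_sepX S1 SG d2.
exists (flatten [seq L x | x <- s]) => g v gG vF g1 v8.
have [x xs gx] := snet g (conj gG g1); have [_ x1] := sS _ xs.
have h1 : 1 + d <= N (x + v).
  apply: LP => // w wL; apply: vF; apply/flatten_mapP; by exists x.
have h2 : N (x + v) <= N (g + v) + N (g - x).
  have := SN.1 (g + v) (x - g).
  by rewrite [g + v + _]addrC addrA subrK (seminormB SN x g).
have h3 : N v <= N (g + v) + N g.
  by have := SN.1 (g + v) (- g); rewrite addrAC subrr add0r seminormN.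
have [v4|v4] := leP (N v) 4.
  have : delta * N v <= d / 8 * 4.
    by apply: ler_pM => //; [exact: ltW|exact: seminorm_ge0].
  lra.
have : delta * N v <= 2^-1 * N v by rewrite ler_wpM2r// seminorm_ge0.
rewrite g1 in h3; lra.
Qed.

(** [g] is nearly normed by some [x], and [v] is tested on [y'] of size at most [t], taken where
    [x + y'] is barely longer than [x]. As [v] kills [x] and [g] kills [y'], testing [g + v] on
    [x + y'] adds both contributions. *)
Lemma aus_growth : aus N -> exists2 delta, 0 < delta <= 1 &
  asymptotic_growth (flip_pairing eval) (dual_normN N) delta.
Proof.
move=> ausN.
have [t [t0 t1 rt]] : exists t : R, [/\ 0 < t, t <= 1 & (rho_bar N t < (t / 20 / 16)%:E)%E].
  have c0 : 0 < 20^-1 / 16 :> R by rewrite divr_gt0 ?invr_gt0.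
  have nb : nbhs (0%E : \bar R) [set y : \bar R | (y < (20^-1 / 16)%:E)%E].
    by apply: open_nbhs_nbhs; split; [exact: open_ereal_lt_ereal|rewrite /= lte_fin].
  have rn : \forall t \near (0 : R)^'+, (rho_bar N t * (t^-1)%:E < (20^-1 / 16)%:E)%E.
    exact: ausN nb.
  have [t /= [rt [t0 t1]]] := @filter_ex _ _ (at_right_proper_filter (0 : R)) _ (filterI rn
    (filterI (nbhs_right_gt 0) (nbhs_right_le (@ltr01 R)))).
  exists t; split=> //; case: (rho_bar N t) rt => [r| |_]; last by rewrite ltNyr.
  - by rewrite -EFinM !lte_fin ltr_pdivrMr// => h; lra.
  - by rewrite gt0_mulye ?lte_fin ?invr_gt0.
have pt x : N x = 1 -> exists L : seq W, forall y, annih eval L y -> N y <= t ->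
    N (x + y) <= 1 + t / 20 / 16.
  move=> x1; move: rt; rewrite /rho_bar; set I := ereal_sup _ => It.
  have I1 : (I < (1 + t / 20 / 16)%:E)%E.
    case: I It => [r|//|_]; last by rewrite ltNyr.
    by rewrite -EFinB !lte_fin; lra.
  have := le_lt_trans (ereal_sup_ubound (ex_intro2 _ _ x x1 erefl)) I1.
  move=> /ereal_inf_lt[_ [Y Ycof <-]] dY; have [L LY] := cof_contains_annih Ycof.
  exists L => y /LY Yy yt; rewrite -lee_fin; apply: le_trans (ltW dY).
  by apply: ereal_sup_ubound; exists y.
have /choice[L LP] : forall x, exists L : seq W, N x = 1 ->
    forall y, annih eval L y -> N y <= t -> N (x + y) <= 1 + t / 20 / 16.
  by move=> x; have [/pt[L LP]|h] := pselect (N x = 1); [exists L|exists [::]].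
pose eta := t / 20 / 16; have eta0 : 0 < eta by rewrite !divr_gt0.
have /choice[norm normP] : forall w : W, exists x, dual_normN N w = 1 -> N x = 1 /\ 1 - eta <= eval x w.
  move=> w; have [w1|h] := pselect (dual_normN N w = 1); last by exists 0.
  have [x x1] := dual_normN_adherent EN w eta0; rewrite w1 => xw.
  have x0 : 0 < N x.
    rewrite lt0r seminorm_ge0// andbT; apply/eqP => x0.
    move: xw; rewrite (equivalent_norm0 EN x0) (pairing0l (eval_pairing X)) /eta; lra.
  exists ((N x)^-1 *: x) => _; split; first by rewrite SN.2 gtr0_norm ?invr_gt0// mulVf// gt_eqF.
  rewrite (pairingZl (eval_pairing X)) mulrC ler_pdivlMr//; apply: le_trans (ltW xw).
  by rewrite ler_piMr// /eta; lra.
(* Let b be the norm of [v] and a that of [g + v]. The test gives 1 - 2 eta + t b / 6 <= (1 + eta) a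
   with eta = t / 320 and b >= 1/8; for this [delta] the conclusion comes down to 3/320 <= 1/96. *)
pose delta := t / 24.
have dl01 : 0 < delta <= 1 by rewrite /delta divr_gt0//=; lra.
exists delta => //.
have PB' := pairing_flip (eval_pairing X).
apply: (growth_of_unit PB' SW) => //; first exact: dual_normN0.
move=> G; pose S := [set g | lspan G g /\ dual_normN N g = 1].
have S1 : S `<=` [set a | dual_normN N a <= 1] by move=> g [_ /= ->].
have SG : S `<=` lspan G by move=> g [].
have [s sS snet] := lspan_net PB' SW compW (@eval_sep R X) S1 SG eta0.
pose LL := G ++ flatten [seq L (norm g) | g <- s].
have [tt _ tr] := reproducing_system PB' LL (@eval_sep R X).
have ss0 : 0 <= \sum_(f <- tt) N f.2 by apply: sumr_ge0 => f _; exact: seminorm_ge0.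
have ss1 : 0 < 1 + \sum_(f <- tt) N f.2 by rewrite ltr_pwDl.
have e4 : 0 < 4^-1 / (1 + \sum_(f <- tt) N f.2) by rewrite divr_gt0.
have [bs bs1 bnet] := weak_net (eval_pairing X) compX (map fst tt)
  (fun x (h : [set x | N x <= 1] x) => h) e4.
exists (bs ++ map norm s) => g v gG vF g1 v8.
have [g0 g0s gg0] := snet g (conj gG g1); have [_ g01] := sS _ g0s.
have [x1 xg0] := normP _ g01; set x := norm g0 in x1 xg0.
have vx : eval x v = 0 by apply: vF; rewrite mem_cat map_f ?orbT.
have dv0 := dual_normN_ge0 EN v.
(* [z] nearly norms [v], and [v] kills the net point [z0]. The difference [z - z0] is almost
   orthogonal to [LL], and the small [r] repairs this. A quarter of the norm of [v] is lost to [z],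
   another to [r]. *)
have [y [Yy y3 yv]] : exists y, [/\ annih eval LL y, N y <= 3 & dual_normN N v / 2 <= eval y v].
  have v4 : 0 < dual_normN N v / 4 by rewrite divr_gt0//; lra.
  have [z z1 zv] := dual_normN_adherent EN v v4.
  have [z0 z0s zz0] := bnet z z1.
  pose r := \sum_(f <- tt) eval (z - z0) f.1 *: f.2.
  have Nr : N r <= 4^-1.
    apply: le_trans (seminorm_sum SN _ _ _) _.
    apply: (@le_trans _ _ (\sum_(f <- tt) 4^-1 / (1 + \sum_(f <- tt) N f.2) * N f.2)).
      rewrite big_seq [leRHS]big_seq; apply: ler_sum => f ft.
      rewrite SN.2 ler_wpM2r ?seminorm_ge0//; apply/ltW/zz0; exact: map_f.
    by rewrite -mulr_sumr mulrAC ler_pdivrMr// ler_wpM2l ?ltrDr ?invr_ge0// ltW// ltr_pwDl.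
  exists (z - z0 - r); split.
  - move=> w wL; rewrite (pairingBl (eval_pairing X)) /r (pairing_suml (eval_pairing X)).
    rewrite {1}(tr w (mem_lspan wL)) (pairing_sumr (eval_pairing X)) -sumrB big1// => f _.
    by rewrite (pairingZr (eval_pairing X)) (pairingZl (eval_pairing X)) mulrC subrr.
  - apply: le_trans (SN.1 _ _) _; rewrite seminormN//.
    have := SN.1 z (- z0); rewrite seminormN//; have := bs1 _ z0s => /=; lra.
  have vz0 : eval z0 v = 0 by apply: vF; rewrite mem_cat z0s.
  rewrite !(pairingBl (eval_pairing X)) vz0 subr0.
  have := le_trans (ler_norm _) (eval_le EN r v).
  have : dual_normN N v * N r <= dual_normN N v * 4^-1 by rewrite ler_wpM2l.
  lra.
pose y' := (t / 3) *: y.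
have y't : N y' <= t.
  rewrite SN.2 gtr0_norm ?divr_gt0//; have := ler_wpM2l (ltW t0) y3; lra.
have Yy' : annih eval LL y' by apply: (subspaceZ _ (annih_subspace (eval_pairing X) LL)).
have Nxy : N (x + y') <= 1 + t / 20 / 16.
  apply: LP => // w wL; apply: Yy'; rewrite mem_cat; apply/orP; right.
  by apply/flatten_mapP; exists g0.
have gy' : eval y' g = 0.
  apply: (annih_lspan (eval_pairing X) (s := G)) => // w wG.
  by apply: Yy'; rewrite mem_cat wG.
have gx : 1 - 2 * eta <= eval x g.
  have := eval_le EN x (g - g0); rewrite x1 mulr1 (pairingBr (eval_pairing X)).
  rewrite ler_norml => /andP[h _]; have := gg0; lra.
have vy' : t / 6 * dual_normN N v <= eval y' v.
  rewrite /y' (pairingZl (eval_pairing X)); have := ler_wpM2l (ltW t0) yv; lra.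
have := le_trans (ler_norm _) (eval_le EN (x + y') (g + v)).
rewrite (pairingDl (eval_pairing X)) !(pairingDr (eval_pairing X)) vx gy' addr0 add0r => h.
have h2 := ler_wpM2l (dual_normN_ge0 EN (g + v)) Nxy.
set a := dual_normN N (g + v) in h h2 *; set b := dual_normN N v in v8 vy' *.
have tb : t * 8^-1 <= t * b by rewrite ler_wpM2l// ltW.
have db0 : 0 <= delta * b by rewrite mulr_ge0//; case/andP: dl01 => /ltW.
have tb2 : t / 20 / 16 * (delta * b) <= delta * b by rewrite ler_piMl//; lra.
have c1 : 0 < 1 + t / 20 / 16 by lra.
rewrite /flip_pairing in h *; rewrite -(ler_pM2r c1).
rewrite /eta in gx; have e1 : delta * b = t * b / 24 by rewrite /delta; lra.
move: (delta * b) tb2 e1 db0 => db tb2 e1 db0; lra.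
Qed.

End Growth.

(** * The renorming and the conclusion *)

Section Renorming.
Variables (R : realType) (X : normedModType R) (W : lmodType R) (D : norming_data W).
Variable T : {linear X -> zspace D}.
Hypothesis T_embedding : isomorphic_embedding T.
Hypothesis T_trunc : forall n, exists2 Y, cof X Y & forall y, Y y -> ztrunc n (T y) = 0.
Hypothesis k_gt0 : (0 < expo D)%N.
Notation k := (expo D).
Let N x := `|T x|.

Lemma embedding_equivalent_norm : equivalent_norm N.
Proof.
have [c [C [c0 C0 cC]]] := T_embedding; split; last by exists c, C.
split=> [x y|a x|x Nx0]; rewrite /N.
- by rewrite linearD ler_normD.
- by rewrite linearZ normrZ.
have /andP[h _] := cC x; rewrite -[`|T x|]/(N x) Nx0 in h.
by apply/normr0_eq0/eqP; rewrite eq_le normr_ge0 andbT -(pmulr_rle0 _ c0).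
Qed.

Lemma tail_small x e : 0 < e -> exists n, `|T x - ztrunc n (T x)| < e.
Proof.
move=> e0; have /cvgr0Pnorm_lt/(_ _ e0)[n _ /(_ n (leqnn n))] := ztail_cvg0 (T x).
by rewrite /= normr_id; exists n.
Qed.

Lemma high_trunc0 n (z : zspace D) : ztrunc n z = 0 -> high n z.
Proof.
move=> h i w ni; have := congr1 (fun y : zspace D => y i w) h.
by rewrite ztruncE ni.
Qed.

(** On a subspace where the first coordinates of the image vanish, the upper estimate gives (1 +
    t^q)^(1/q) <= 1 + t^q, so the constant is 1. In the proof [b ^+ k] is [t] and [r ^+ k] is the
    q-norm of the pair 1, [t]. *)
Lemma embedding_aus : aus_power_type N (k.+1%:R / k%:R).
Proof.
exists 1 => t t0; rewrite mul1r /rho_bar leeBlDr//.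
apply: ge_ereal_sup => _ [x /= x1 <-]; apply/lee_addgt0Pr => e e0.
have [n xn] := tail_small x e0; have [Y Ycof Yn] := T_trunc n.
apply: (@le_trans _ _ (ereal_sup [set (N (x + y))%:E | y in [set y | Y y /\ (N y <= t)%R]])).
  by apply: ereal_inf_lbound; exists Y.
apply: ge_ereal_sup => _ [y [Yy yt] <-].
rewrite -!EFinD lee_fin.
have [b b0 bE] := root_exists k_gt0 (ltW t0).
have b1 : 0 <= 1 + b ^+ k.+1 by rewrite addr_ge0 ?exprn_ge0.
have [r r0 rE] := root_exists (ltn0Sn k) b1.
have -> : t `^ (k.+1%:R / k%:R) = b ^+ k.+1.
  rewrite -bE -!powR_mulrn// -powRrM mulrC divfK// pnatr_eq0 -lt0n//.
have r1 : 1 <= r by rewrite -(@expr_ge1 _ k.+1)// rE lerDl exprn_ge0.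
have h : `|ztrunc n (T x) + T y| <= r ^+ k.
  apply: (@low_high_upper _ _ _ n _ _ 1 b) => //.
  - exact: low_trunc.
  - exact/high_trunc0/Yn.
  - by rewrite expr1n -[leRHS]x1; exact: ztrunc_le.
  - by rewrite bE.
  - by rewrite rE expr1n.
have h2 : r ^+ k <= 1 + b ^+ k.+1 by rewrite -rE; exact: ler_weXn2l.
have h3 : N (x + y) <= `|ztrunc n (T x) + T y| + `|T x - ztrunc n (T x)|.
  rewrite /N linearD; have := ler_normD (ztrunc n (T x) + T y) (T x - ztrunc n (T x)).
  by rewrite [ztrunc n (T x) + T y + _]addrC addrA subrK.
lra.
Qed.

Lemma bernoulli_upper m (v : R) : 0 <= v -> v <= 1 -> (1 + v) ^+ m <= 1 + (2 ^+ m - 1) * v.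
Proof.
move=> v0 v1; elim: m => [|m IH]; first by rewrite !expr0 subrr mul0r addr0.
have v1' : 0 <= 1 + v by rewrite addr_ge0.
have := ler_wpM2r v1' IH; rewrite !exprSr.
have : 1 <= 2 ^+ m :> R by rewrite exprn_ege1// ler1n.
move: (2 ^+ m : R) => p p1 h; apply: le_trans h _.
have : 0 <= (p - 1) * (v * (1 - v)) by rewrite !mulr_ge0// ?subr_ge0.
lra.
Qed.

Lemma embedding_auc : auc_power_type N k.+1%:R.
Proof.
(* By the chord bound [bernoulli_upper] this [K] gives (1 + K t^p)^p <= 1 + t^p, the form in which
   the lower estimate applies. *)
pose K : R := (2 ^+ k.+1)^-1; have K0 : 0 < K by rewrite invr_gt0 exprn_gt0.
have K1 : K <= 1 by rewrite invf_le1 ?exprn_gt0// exprn_ege1// ler1n.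
exists K => // t t0 t1; rewrite (powR_mulrn _ (ltW t0)) /delta_bar leeBrDr//.
apply: le_ereal_inf_tmp => _ [x /= x1 <-]; apply/lee_addgt0Pr => e e0.
(* The loss [e'] in the head of [T x] is multiplied by 1 + K t^p <= 2, and its tail costs another
   [e']. *)
pose e' := Num.min (e / 3) 1.
have e'0 : 0 < e' by rewrite lt_min divr_gt0/=.
have e'1 : e' <= e / 3 by rewrite ge_min lexx.
have e'2 : e' <= 1 by rewrite ge_min lexx orbT.
have [n xn] := tail_small x e'0; have [Y Ycof Yn] := T_trunc n.
rewrite -leeBlDr//; apply: (@le_trans _ _
  (ereal_inf [set (N (x + y))%:E | y in [set y | Y y /\ (t <= N y)%R]])); last first.
  by apply: ereal_sup_ubound; exists Y.
apply: le_ereal_inf_tmp => _ [y [Yy ty] <-].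
have tk0 : 0 <= t ^+ k.+1 by rewrite exprn_ge0// ltW.
have tk1 : t ^+ k.+1 <= 1 by rewrite exprn_ile1// ltW.
have Kt0 : 0 <= K * t ^+ k.+1 by rewrite mulr_ge0// ltW.
have Kt1 : K * t ^+ k.+1 <= 1 by rewrite mulr_ile1// ltW.
have h1 : (1 + K * t ^+ k.+1) ^+ k.+1 <= 1 + t ^+ k.+1.
  apply: le_trans (bernoulli_upper _ Kt0 Kt1) _; rewrite lerD2l mulrA ler_piMl//.
  by rewrite mulrBl divff ?expf_neq0// mul1r gerBl ltW.
have h2 : 1 - e' <= `|ztrunc n (T x)|.
  have := ler_normD (ztrunc n (T x)) (T x - ztrunc n (T x)).
  rewrite [ztrunc n (T x) + _]addrC subrK -[`|T x|]/(N x) x1; lra.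
have h3 : (1 - e') * (1 + K * t ^+ k.+1) <= `|ztrunc n (T x) + T y|.
  rewrite -(@ler_pXn2r _ k.+1) ?nnegrE// ?mulr_ge0 ?subr_ge0// ?addr_ge0//.
  apply: le_trans (low_high_lower (@low_trunc _ _ _ n (T x)) (high_trunc0 (Yn _ Yy))).
  rewrite exprMn; apply: (@le_trans _ _ ((1 - e') ^+ k.+1 * (1 + t ^+ k.+1))).
    by rewrite ler_wpM2l// exprn_ge0// subr_ge0.
  have e3 : (1 - e') ^+ k.+1 <= 1 by rewrite exprn_ile1// ?subr_ge0// lerBlDr lerDl ltW.
  rewrite mulrDr mulr1; apply: lerD.
    by rewrite lerXn2r ?nnegrE ?subr_ge0.
  apply: (@le_trans _ _ (t ^+ k.+1)); first by rewrite ler_piMl.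
  by rewrite lerXn2r ?nnegrE// ltW.
have h4 : `|ztrunc n (T x) + T y| <= N (x + y) + `|T x - ztrunc n (T x)|.
  rewrite /N linearD; have := ler_normB (T x + T y) (T x - ztrunc n (T x)).
  by rewrite opprB addrC addrA subrK.
rewrite -!EFinD lee_fin; move: (K * t ^+ k.+1) Kt0 Kt1 h3 => s s0 s1 h3.
have h5 : e' * s <= e' * 1 by rewrite ler_wpM2l// ltW.
lra.
Qed.

End Renorming.

Lemma asymptotic_growth_le (R : realType) (A C : lmodType R) (B : A -> C -> R) (N : A -> R)
    (d d' : R) : seminorm N -> d' <= d -> asymptotic_growth B N d -> asymptotic_growth B N d'.
Proof.
move=> SN dd gr G; have [F FP] := gr G; exists F => g v gG vF gv.
apply: le_trans (FP g v gG vF gv).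
by rewrite lerD2l ler_wpM2r// seminorm_ge0.
Qed.

Lemma separable_sequence (R : realType) (X : normedModType R) : is_separable X ->
  exists xs : nat -> X, forall x e, 0 < e -> exists n, `|x - xs n| < e.
Proof.
move=> [A /countable_injP[f finj] dA].
exists (fun n => xget 0 [set a | A a /\ f a = n]) => x e e0.
have [a [xa Aa]] := dA (ball x e) (ex_intro _ x (ballxx x e0)) (@ball_open _ _ x e).
exists (f a).
have [Ab fab] := @xgetPex _ 0 [set b | A b /\ f b = f a] (ex_intro _ a (conj Aa erefl)).
by rewrite (finj _ _ (mem_set Ab) (mem_set Aa) fab); move: xa; rewrite -ball_normE.
Qed.

Theorem theorem4p3 (R : realType) (X : completeNormedModType R)
    (X_infinite_dim : ~ finite_dim [set: X])
    (X_separable : is_separable X)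
    (X_reflexive : reflexive_space X)
    (X_aus : exists N : X -> R, equivalent_norm N /\ aus N)
    (X_auc : exists N : X -> R, equivalent_norm N /\ auc N) :
  exists q p : R, [/\ 1 < q, q <= p,
    exists (Z : completeNormedModType R) (E : nat -> set Z)
           (T : {linear X -> Z}),
      [/\ reflexive_space Z, is_fdd E, satisfies_estimates E 1 p q
        & isomorphic_embedding T]
    & exists N : X -> R,
      [/\ equivalent_norm N, aus_power_type N q & auc_power_type N p]].
Proof.
have [N1 [EN1 aus1]] := X_aus; have [N2 [EN2 auc2]] := X_auc.
have [d1 /andP[d10 d11] growW] := aus_growth EN1 X_reflexive aus1.
have [d2 /andP[d20 d21] growX] := auc_growth EN2 X_reflexive auc2.
pose d := Num.min d1 d2.
have d01 : 0 < d <= 1 by rewrite lt_min d10 d20 /= ge_min d11.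
have dd1 : d <= d1 by rewrite ge_min lexx.
have dd2 : d <= d2 by rewrite ge_min lexx orbT.
have [c1 c10 N1l] := equivalent_norm_lower EN1; have [C1 C10 N1u] := equivalent_norm_upper EN1.
have [c2 c20 N2l] := equivalent_norm_lower EN2; have [C2 C20 N2u] := equivalent_norm_upper EN2.
(* [X] is measured by the convex norm [N2], [W] by the dual of the smooth norm [N1]; comparing them
   yields [cB] and [c0]. *)
have N12 x : N1 x <= C1 / c2 * N2 x.
  by apply: le_trans (N1u x) _; rewrite -mulrA (ler_pM2l C10) ler_pdivlMl.
have N21 x : c1 / C2 * N2 x <= N1 x.
  by apply: le_trans (N1l x); rewrite -mulrA (ler_pM2l c10) ler_pdivrMl.
have [xs0 xs0P] := separable_sequence X_separable.
have xsP x e : 0 < e -> exists n, N2 (x - xs0 n) < e.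
  move=> e0; have [n xn] := xs0P x _ (divr_gt0 e0 C20); exists n.
  by apply: le_lt_trans (N2u _) _; rewrite mulrC -ltr_pdivlMr.
have [D [T [k0 [c [C [c_gt0 C_gt0 cC]]] Ttr]]] := @embedding_exists R X (dual_space X)
  (@eval R X) N2 (dual_normN N1) (eval_pairing X) (equivalent_seminorm EN2)
  (dual_normN_seminorm EN1) (@dual_normN0 _ _ _ EN1) (eval_sepX EN1) (@eval_sep R X)
  (C1 / c2) (c1 / C2) d
  (divr_ge0 (ltW C10) (ltW c20))
  (fun x w => le_trans (eval_le EN1 x w) (le_trans (ler_wpM2l (dual_normN_ge0 EN1 w) (N12 x))
     (eq_ind_r (fun u => u <= C1 / c2 * N2 x * dual_normN N1 w) (lexx _) (mulrC _ _))))
  (divr_gt0 c10 C20)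
  (fun x => let: ex_intro2 w w1 wx := norming_functional EN1 x in
     ex_intro2 _ _ w w1 (eq_ind_r (fun u => c1 / C2 * N2 x <= u) (N21 x) wx))
  d01 (reflexive_ball_compact EN2 X_reflexive) (dual_ball_compact EN1)
  (asymptotic_growth_le (equivalent_seminorm EN2) dd2 growX)
  (asymptotic_growth_le (dual_normN_seminorm EN1) dd1 growW) xs0 xsP.
have iso : isomorphic_embedding T.
  exists (c * c2), (C * C2); split=> [||x]; try exact: mulr_gt0.
  have /andP[h1 h2] := cC x; apply/andP; split.
    by apply: le_trans h1; rewrite -mulrA ler_wpM2l// ltW.
  by apply: le_trans h2 _; rewrite -mulrA ler_wpM2l// ltW.
have Tcof n : exists2 Y, cof X Y & forall y, Y y -> ztrunc n (T y) = 0.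
  by have [L LP] := Ttr n; exists (annih (@eval R X) L) => //; exact: annih_cof.
have kn0 : 0 < (expo D)%:R :> R by rewrite ltr0n.
exists ((expo D).+1%:R / (expo D)%:R), (expo D).+1%:R; split.
- by rewrite ltr_pdivlMr// mul1r ltr_nat.
- by rewrite ler_pdivrMr// ler_peMr// ler1n.
- exists (zspace D : completeNormedModType R), (@zblock R (dual_space X) D), T; split.
  + exact: zspace_reflexive.
  + exact: zspace_fdd.
  + exact: zspace_estimates.
  + exact: iso.
exists (fun x => `|T x|); split.
- exact: embedding_equivalent_norm.
- exact: embedding_aus.
- exact: embedding_auc.
Qed.
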